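(* For every integer $t\geq 1$, the $\mathbb F_2$-vector space $Q^{\otimes 6}_{5(2^{t+4}-1)+41\cdot 2^{t+4}}$ has dimension $165690$.
   Context: Let $\mathscr A$ be the mod 2 Steenrod algebra, $\overline{\mathscr A}$ its positive degree part, and $\mathcal P_m=\mathbb F_2[x_1,\dots,x_m]$ with $\deg x_i=1$, viewed as an $\mathscr A$-module via $Sq^0(x_i)=x_i$, $Sq^1(x_i)=x_i^2$, $Sq^j(x_i)=0$ for $j>1$, and the Cartan formula. Put $Q^{\otimes m}=\mathbb F_2\otimes_{\mathscr A}\mathcal P_m=\mathcal P_m/\overline{\mathscr A}\mathcal P_m$, and let $Q^{\otimes m}_n$ be its homogeneous part of degree $n$. *)

(* Defs.v *)
From HB Require Import structures.
From mathcomp Require Import all_boot all_order all_algebra.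
From mathcomp Require Import generic_quotient ring_quotient boolp finmap.
From mathcomp Require Import -(notations) monalg.
From mathcomp Require Import mpoly.
From mathcomp Require Import ring zify.

Set Implicit Arguments.
Unset Strict Implicit.
Unset Printing Implicit Defensive.

Import GRing.Theory.

Local Open Scope ring_scope.

Lemma mpoly_mulX_ind m (Q : {mpoly 'F_2[m]} -> Prop) :
  Q 1 -> (forall (c : 'F_2) f g, Q f -> Q g -> Q (c *: f + g)) ->
  (forall i f, Q f -> Q ('X_i * f)) -> forall f, Q f.
Proof.
move=> Q1 QD QX.
have Q0 : Q 0 by have := QD (-1) 1 1 Q1 Q1; rewrite scaleN1r addNr.
elim/mpolyind => // c w f _ _ Qf; apply: QD => //.
have [n] := ubnP (mdeg w); elim: n w => // n IH w.
have [/eqP|nz] := eqVneq w 0%MM; first by move=> /eqP-> _; rewrite mpolyX0.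
have [i wi] : exists i, w i != 0%N.
  apply/existsP; apply: contraR nz => /existsPn H.
  by apply/eqP/mnmP=> i; rewrite mnm0E; apply/eqP; move: (H i); rewrite negbK.
have -> : w = (U_(i) + (w - U_(i)))%MM by rewrite addmC submK // lep1mP.
by rewrite mpolyXD mdegD mdeg1 add1n ltnS => lt; apply/QX/IH.
Qed.

Section Adem.
Variables (m : nat) (S : nat -> {mpoly 'F_2[m]} -> {mpoly 'F_2[m]}).
Local Notation P := {mpoly 'F_2[m]}.

Hypothesis SD : forall k f g, S k (f + g) = S k f + S k g.
Hypothesis SZ : forall k c f, S k (c *: f) = c *: S k f.
Hypothesis S0 : forall f, S 0 f = f.
Hypothesis S1 : forall k, S k 1 = (k == 0)%:R.
Hypothesis SX : forall k i f,
  S k.+1 ('X_i * f) = 'X_i * S k.+1 f + 'X_i ^+ 2 * S k f.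

Let SO k : S k 0 = 0.
Proof. by have := SZ k 0 0; rewrite !scale0r. Qed.

(* [Sqd n k] is Sq^(k-n), where squares of negative index are zero. *)
Let Sqd n k f := if (n <= k)%N then S (k - n) f else 0.

Let SqdX n k i f : Sqd n k ('X_i * f) = 'X_i * Sqd n k f + 'X_i ^+ 2 * Sqd n.+1 k f.
Proof.
rewrite /Sqd; case: (ltngtP n k) => [lt|lt|->]; rewrite ?mulr0 ?addr0 //.
  by rewrite (subnS k n); case: (k - n)%N (subn_gt0 n k) => [|j _]; rewrite ?lt ?SX.
by rewrite subnn !S0.
Qed.

Let char2 (p : P) : p + p = 0.
Proof.
by rewrite -mulr2n -scaler_nat (_ : 2%:R = 0 :> 'F_2) ?scale0r //; apply/val_inj.
Qed.

Let SqdX2 n k i f :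
  Sqd n k ('X_i ^+ 2 * f) = 'X_i ^+ 2 * Sqd n k f + 'X_i ^+ 4 * Sqd n.+2 k f.
Proof.
rewrite expr2 -mulrA !SqdX; set A := Sqd n k f; set B := Sqd _ k f.
set C := Sqd _ k f; rewrite -[RHS]addr0 -(char2 ('X_i ^+ 3 * B)); ring.
Qed.

Let Sqd0 k f : Sqd 0 k f = S k f. Proof. by rewrite /Sqd subn0. Qed.

Let SqdS n k f : Sqd n.+1 k.+1 f = Sqd n k f. Proof. by []. Qed.

(* Binomial coefficients C(x - 1, j) mod 2, including C(-1, j) = 1. *)
Let bin1 x j : 'F_2 := if x is y.+1 then 'C(y, j)%:R else 1.

Let bin1_pascal x j : bin1 x.+1 j.+1 = bin1 x j.+1 + bin1 x j.
Proof. by case: x => [|x] /=; [apply/val_inj | rewrite binS natrD]. Qed.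

Let co a b c : 'F_2 := if (c.*2 <= a)%N then bin1 (b - c) (a - c.*2) else 0.

Let co_rec a b c : (a < b.*2.+1)%N ->
  co a.+1 b.+1 c + co a.+1 b.+1 c.+1 = co a b.+1 c + co a.+1 b c.
Proof.
move=> ab; rewrite /co subSS.
have [lt|le] := ltnP a.+1 c.*2.
  by rewrite !ifF ?addr0 //; lia.
rewrite subSn; last lia.
have [j|/eqP j] := eqVneq (a.+1 - c.*2)%N 0%N.
  rewrite (_ : (c.+1.*2 <= a.+1)%N = false) ?j ?addr0; last lia.
  rewrite (_ : (c.*2 <= a)%N = false) ?add0r; last lia.
  by case: (b - c)%N => [|x]; rewrite /bin1 !bin0.
have -> : (a.+1 - c.*2 = (a - c.*2).+1)%N by lia.
rewrite (_ : (c.*2 <= a)%N); last lia.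
case: ifP => cS.
  have -> : (a - c.*2 = (a.+1 - c.+1.*2).+1)%N by lia.
  by rewrite !bin1_pascal -addrA addrC.
have -> : (a - c.*2 = 0)%N by lia.
by rewrite bin1_pascal addr0 /bin1 !bin0; case: (b - c)%N => [|x]; rewrite addrC ?bin0.
Qed.

Let co0 a b c : (a < c.*2)%N -> co a b c = 0.
Proof. by move=> lt; rewrite /co leqNgt lt. Qed.

Let SqdE n k f : (n <= k)%N -> Sqd n k f = S (k - n) f.
Proof. by rewrite /Sqd => ->. Qed.

Let adem_trivial a b N f : (b.*2 <= a < b.*2.+2)%N -> (a < N.*2)%N ->
  S a (S b f) = \sum_(c < N) co a b c *: S (a + b - c) (S c f).
Proof.
move=> ab aN; have bN : (b < N)%N by lia.
rewrite (bigD1 (Ordinal bN)) //= big1 ?addr0 => [|c /eqP neq].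
  by rewrite addnK /co subnn ifT ?scale1r //; lia.
have [lt|le] := ltnP a c.*2; first by rewrite co0 ?scale0r.
have cb : (c < b)%N.
  have cb : c <> b :> nat by move=> cb; apply: neq; apply/val_inj.
  lia.
rewrite /co ifT ?scale0r //; case E : (b - c)%N => [|x]; first lia.
by rewrite /= bin_small ?scale0r //; lia.
Qed.

Lemma adem_sum a b N f : (a < b.*2.+2)%N -> (a < N.*2)%N ->
  S a (S b f) = \sum_(c < N) co a b c *: S (a + b - c) (S c f).
Proof.
elim/mpoly_mulX_ind: f a b N => [|u f g IHf IHg|i z IH] a b N ab aN.
- have [le|lt] := leqP b.*2 a; first by apply: adem_trivial; rewrite ?le.
  rewrite (S1 b) (_ : (b == 0)%N = false) ?SO; last lia.
  rewrite big1 // => c _; rewrite S1.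
  have [-> /=|] := eqVneq (c : nat) 0%N; last by rewrite SO scaler0.
  by rewrite S1 (_ : (_ == 0)%N = false) ?scaler0 //; lia.
- rewrite !SD !SZ (IHf _ _ N) // (IHg _ _ N) // scaler_sumr -big_split /=.
  apply: eq_bigr => c _; rewrite !SD !SZ scalerDr.
  by rewrite !scalerA [u * _]mulrC.
have [le|lt] := leqP b.*2 a; first by apply: adem_trivial; rewrite ?le.
case: a ab aN lt => [_ N0 lt|a ab aN lt].
  case: N N0 => // N _; rewrite big_ord_recl big1 ?addr0 => [|c _].
    rewrite /co /= !S0 add0n subn0; case: b lt => // b _.
    by rewrite !subn0 /= bin0 scale1r.
  by rewrite co0 ?scale0r.
case: b ab lt => [|b] ab lt; first lia.
case: N aN => [|N] aN; first lia.
have SqX' k f : S k ('X_i * f) = 'X_i * S k f + 'X_i ^+ 2 * Sqd 1 k f.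
  by rewrite -!Sqd0 SqdX.
have SqX2' k f : S k ('X_i ^+ 2 * f) = 'X_i ^+ 2 * S k f + 'X_i ^+ 4 * Sqd 2 k f.
  by rewrite -!Sqd0 SqdX2.
rewrite SqX' SD SqX' SqX2' !SqdS !Sqd0.
under eq_bigr => c _.
  rewrite SqX' SD SqX' SqX2' !scalerDr.
  over.
rewrite !big_split /=.
have -> : \sum_(c < N.+1) co a.+1 b.+1 c *: ('X_i * S (a.+1 + b.+1 - c) (S c z))
   = 'X_i * S a.+1 (S b.+1 z).
  rewrite (IH _ _ N.+1) // mulr_sumr; apply: eq_bigr => c _; exact: scalerAr.
rewrite -!addrA; congr (_ + _); rewrite !addrA.
have shift (F : nat -> P -> P) : (forall c, F c 0 = 0) ->
  \sum_(c < N.+1) co a.+1 b.+1 c *: (F c (Sqd 1 c z)) =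
  \sum_(c < N.+1) co a.+1 b.+1 c.+1 *: (F c.+1 (S c z)) :> P.
  move=> F0; rewrite big_ord_recl big_ord_recr /= F0 scaler0 add0r.
  rewrite (@co0 _ _ N.+1) ?scale0r ?addr0; last lia.
  by apply: eq_bigr => c _; rewrite SqdS Sqd0.
congr (_ + _); last first.
  rewrite (shift (fun c w => 'X_i ^+ 4 * Sqd 2 (a.+1 + b.+1 - c) w)); last first.
    by move=> c; rewrite /Sqd; case: ifP; rewrite ?SO mulr0.
  case: a ab aN lt {shift} => [|a] ab aN lt.
    by rewrite /= mulr0 big1 // => c _; rewrite co0 ?scale0r //; lia.
  rewrite SqdS Sqd0 (IH _ _ N.+1); [|lia|lia].
  rewrite mulr_sumr; apply: eq_bigr => c _; rewrite scalerAr.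
  have [lt'|le] := ltnP a c.*2; first by rewrite !co0 ?scale0r ?mulr0 //; lia.
  rewrite SqdE; last lia.
  have -> : (a.+2 + b.+1 - c.+1 - 2 = a + b - c)%N by lia.
  by rewrite /co doubleS !ltnS !subSS.
rewrite (shift (fun c w => 'X_i ^+ 2 * S (a.+1 + b.+1 - c) w)); last first.
  by move=> c; rewrite SO mulr0.
rewrite (IH _ _ N.+1); [|lia|lia].
rewrite (IH _ _ N.+1); [|lia|lia].
rewrite !mulr_sumr -!big_split /=; apply: eq_bigr => c _.
have [lt'|le] := ltnP a.+1 c.*2; first by rewrite !co0 ?scale0r ?mulr0 //; lia.
rewrite SqdE; last lia.
have -> : (a.+1 + b.+1 - c - 1 = a + b.+1 - c)%N by lia.
have -> : (a.+1 + b.+1 - c.+1 = a + b.+1 - c)%N by lia.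
have -> : (a.+1 + b - c = a + b.+1 - c)%N by lia.
by rewrite -!scalerAr -!scalerDl co_rec //; lia.
Qed.

Lemma adem_gen a b f : (0 < a < b.*2)%N ->
  S a (S b f) =
  \sum_(c < a./2.+1) 'C(b - c - 1, a - c.*2)%:R *: S (a + b - c) (S c f).
Proof.
case/andP=> a0 ab; rewrite (adem_sum _ (N := a./2.+1)); [|lia|lia].
apply: eq_bigr => -[c /= cl] _; rewrite /co ifT; last lia.
by case E : (b - c)%N => [|x]; [lia | rewrite subn1].
Qed.

End Adem.

Section Squares.
Variable m : nat.
Local Notation P := {mpoly 'F_2[m]}.

(* The total square sum_k (Sq^k f) t^k: the Cartan formula makes it a ring
   morphism P -> P[t], and it sends x_i to x_i + x_i^2 t. *)
Definition total_sq (f : P) : {poly P} :=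
  mpoly.mmap (fun c : 'F_2 => (c%:MP : P)%:P)
    (fun i => ('X_i : P)%:P + ('X_i ^+ 2 : P) *: 'X) f.

Definition Sq (k : nat) (f : P) : P := (total_sq f)`_k.

Let h (i : 'I_m) := ('X_i : P)%:P + ('X_i ^+ 2 : P) *: 'X.
Let c0 : {rmorphism 'F_2 -> {poly P}} := (@polyC P \o @mpolyC m 'F_2).

Lemma total_sqE f : total_sq f = mpoly.mmap c0 h f. Proof. by []. Qed.

Lemma total_sqM f g : total_sq (f * g) = total_sq f * total_sq g.
Proof. by rewrite !total_sqE rmorphM. Qed.

Lemma total_sq1 : total_sq 1 = 1.
Proof. by rewrite !total_sqE rmorph1. Qed.

Lemma Sq_is_linear k : linear (Sq k).
Proof.
move=> c f g; rewrite /Sq !total_sqE raddfD /= mpoly.mmapZ coefD coefCM.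
by rewrite mul_mpolyC.
Qed.

HB.instance Definition _ k := GRing.isLinear.Build 'F_2 P P *:%R (Sq k)
  (Sq_is_linear k).

Lemma Sq_cartan k f g : Sq k (f * g) = \sum_(i < k.+1) Sq i f * Sq (k - i) g.
Proof. by rewrite /Sq total_sqM coefM. Qed.

Lemma SqX (k : nat) (i : 'I_m) :
  Sq k 'X_i = if k is 0 then 'X_i else if k is 1 then 'X_i ^+ 2 else 0.
Proof.
rewrite /Sq total_sqE mpoly.mmapX mmap1U /h coefD coefC coefZ coefX.
by case: k => [|[|k]] /=; rewrite ?mulr0 ?mulr1 ?addr0 ?add0r.
Qed.

Lemma Sq1 k : Sq k 1 = (k == 0)%:R.
Proof. by rewrite /Sq total_sq1 coef1. Qed.

Lemma Sq0 f : Sq 0 f = f.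
Proof.
elim/mpoly_mulX_ind: f => [|c f g IHf IHg|i f IH].
- by rewrite Sq1.
- by rewrite linearD linearZ /= IHf IHg.
- by rewrite Sq_cartan big_ord1 SqX IH.
Qed.

Lemma Sq_adem a b f : (0 < a < b.*2)%N ->
  Sq a (Sq b f) =
  \sum_(c < a./2.+1) 'C(b - c - 1, a - c.*2)%:R *: Sq (a + b - c) (Sq c f).
Proof.
apply: adem_gen => [k g l|k c g|g|k|k i g].
- exact: linearD.
- exact: linearZ.
- exact: Sq0.
- exact: Sq1.
rewrite Sq_cartan 2!big_ord_recl /= big1 ?addr0 => [|l _]; last first.
  by rewrite SqX /= mul0r.
by rewrite !SqX /= !subn0 /bump /= subn1.
Qed.

End Squares.

(* The mod 2 Steenrod algebra: the free associative F_2-algebra on the symbols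
   Sq^i (i >= 0), modulo Sq^0 = 1 and the Adem relations. *)

Definition free_steenrod : Type := malg (fmonom nat) 'F_2.

HB.instance Definition _ := GRing.Lalgebra.on free_steenrod.

Definition free_sq (i : nat) : free_steenrod := mkmalgU (fmu i) 1.

Inductive adem_ideal : free_steenrod -> Prop :=
| adem_sq0 : adem_ideal (free_sq 0 - 1)
| adem_rel a b : (0 < a < b.*2)%N ->
    adem_ideal (free_sq a * free_sq b -
      \sum_(c < a./2.+1)
        'C(b - c - 1, a - c.*2)%:R *: (free_sq (a + b - c) * free_sq c))
| adem_zero : adem_ideal 0
| adem_sub x y : adem_ideal x -> adem_ideal y -> adem_ideal (x - y)
| adem_mull z x : adem_ideal x -> adem_ideal (z * x)
| adem_mulr z x : adem_ideal x -> adem_ideal (x * z).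

Definition adem_pred : {pred free_steenrod} := fun x => `[< adem_ideal x >].

Lemma adem_predP x : reflect (adem_ideal x) (x \in adem_pred).
Proof. exact: asboolP. Qed.

Lemma adem_zmod_closed : zmod_closed adem_pred.
Proof.
split=> [|x y /adem_predP xI /adem_predP yI]; apply/adem_predP.
  exact: adem_zero.
exact: adem_sub.
Qed.

HB.instance Definition _ := GRing.isZmodClosed.Build free_steenrod adem_pred
  adem_zmod_closed.

Definition steenrod : Type := {ideal_quot adem_pred}.

HB.instance Definition _ := GRing.Zmodule.on steenrod.
HB.instance Definition _ := Quotient.on steenrod.

Definition steenrod_pi (x : free_steenrod) : steenrod := (\pi_steenrod x)%qT.

Section SteenrodRing.
Local Notation pi := steenrod_pi.

Let reprK' q : pi (repr q) = q.
Proof. exact: reprK. Qed.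

Lemma steenrod_surj q : exists x, q = pi x.
Proof. by exists (repr q); rewrite reprK'. Qed.

Lemma steenrod_pi_eq x y : pi x = pi y <-> adem_ideal (x - y).
Proof.
split=> [E|xy].
  by apply/adem_predP; rewrite Quotient.idealrBE; apply/eqP.
by apply/eqP; rewrite -Quotient.idealrBE; apply/adem_predP.
Qed.

Lemma steenrod_piD x y : pi (x + y) = pi x + pi y.
Proof. exact: Quotient.pi_add. Qed.

Let sone : steenrod := pi 1.
Let smul (x y : steenrod) : steenrod := pi (repr x * repr y).

Let smulE x y : smul (pi x) (pi y) = pi (x * y).
Proof.
apply/steenrod_pi_eq; set u := repr _; set v := repr _.
have uI : adem_ideal (u - x) by apply/steenrod_pi_eq; rewrite reprK'.
have vI : adem_ideal (v - y) by apply/steenrod_pi_eq; rewrite reprK'.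
have -> : u * v - x * y = u * (v - y) - (- (u - x)) * y.
  by rewrite mulNr opprK mulrBr mulrBl addrA subrK.
apply: adem_sub; first exact: adem_mull.
by apply: adem_mulr; rewrite -sub0r; apply: adem_sub => //; apply: adem_zero.
Qed.

Let smulA : associative smul.
Proof.
move=> x; case: (steenrod_surj x) => {}x ->.
move=> y; case: (steenrod_surj y) => {}y ->.
move=> z; case: (steenrod_surj z) => {}z ->.
by rewrite !smulE mulrA.
Qed.

Let smul1 : left_id sone smul.
Proof. by move=> x; case: (steenrod_surj x) => {}x ->; rewrite smulE mul1r. Qed.

Let smulr1 : right_id sone smul.
Proof. by move=> x; case: (steenrod_surj x) => {}x ->; rewrite smulE mulr1. Qed.

Let smulDl : left_distributive smul +%R.
Proof.
move=> x; case: (steenrod_surj x) => {}x ->.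
move=> y; case: (steenrod_surj y) => {}y ->.
move=> z; case: (steenrod_surj z) => {}z ->.
by rewrite -steenrod_piD !smulE mulrDl steenrod_piD.
Qed.

Let smulDr : right_distributive smul +%R.
Proof.
move=> x; case: (steenrod_surj x) => {}x ->.
move=> y; case: (steenrod_surj y) => {}y ->.
move=> z; case: (steenrod_surj z) => {}z ->.
by rewrite -steenrod_piD !smulE mulrDr steenrod_piD.
Qed.

HB.instance Definition _ := GRing.Zmodule_isPzRing.Build steenrod
  smulA smul1 smulr1 smulDl smulDr.

Lemma steenrod_piM x y : pi (x * y) = pi x * pi y.
Proof. exact: esym (smulE x y). Qed.

Lemma steenrod_pi1 : pi 1 = 1.
Proof. by []. Qed.

Definition sq (i : nat) : steenrod := pi (free_sq i).

(* The free algebra and both kinds of relations are graded by |Sq^i| = i. *)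
Definition steenrod_pos (x : steenrod) : Prop :=
  exists2 y : free_steenrod,
    (forall w : fmonom nat, sumn w = 0%N -> monalg.mcoeff w y = 0) & x = pi y.

End SteenrodRing.

Section Action.
Variable m : nat.
Local Notation P := {mpoly 'F_2[m]}.
Local Notation pi := steenrod_pi.

Let wact (w : fmonom nat) (f : P) : P := foldr (@Sq m) f w.

Definition free_act (x : free_steenrod) (f : P) : P :=
  \sum_(w <- enum_fset (monalg.msupp x))
    monalg.mcoeff w x *: foldr (@Sq m) f (fmonom_val w).

Let free_actEw (d : {fset (fmonom nat)}) x f : (monalg.msupp x `<=` d)%fset ->
  free_act x f = \sum_(w <- enum_fset d) monalg.mcoeff w x *: wact w f.
Proof.
move=> le; rewrite /free_act (big_fset_incl _ le) //= => w _.
by move/monalg.mcoeff_outdom ->; rewrite scale0r.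
Qed.

Let wactD w f g : wact w (f + g) = wact w f + wact w g.
Proof. by case: w; elim=> //= i w IH; rewrite /wact /= in IH *; rewrite IH linearD. Qed.

Let wactZ w c f : wact w (c *: f) = c *: wact w f.
Proof. by case: w; elim=> //= i w IH; rewrite /wact /= in IH *; rewrite IH linearZ. Qed.

Let wactM w v f : wact (mmul w v) f = wact w (wact v f).
Proof. by rewrite /wact fmM foldr_cat. Qed.

Let free_actDr x f g : free_act x (f + g) = free_act x f + free_act x g.
Proof.
rewrite /free_act -big_split /=; apply: eq_bigr => w _.
by rewrite -scalerDr; congr (_ *: _); apply: wactD.
Qed.

Let free_actZr x c f : free_act x (c *: f) = c *: free_act x f.
Proof.
rewrite /free_act scaler_sumr; apply: eq_bigr => w _.
by rewrite scalerA [c * _]mulrC -scalerA; congr (_ *: _); apply: wactZ.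
Qed.

Let free_actDl x y f : free_act (x + y) f = free_act x f + free_act y f.
Proof.
pose d := (monalg.msupp x `|` monalg.msupp y)%fset.
rewrite (@free_actEw d (x + y)) ?monalg.msuppD_le //.
rewrite (@free_actEw d x) ?fsubsetUl // (@free_actEw d y) ?fsubsetUr //.
rewrite -big_split /=.
by apply: eq_bigr => w _; rewrite monalg.mcoeffD scalerDl.
Qed.

Let free_actZl c x f : free_act (c *: x) f = c *: free_act x f.
Proof.
rewrite (@free_actEw (monalg.msupp x)) ?monalg.msuppZ_le // scaler_sumr.
by apply: eq_bigr => w _; rewrite monalg.mcoeffZ scalerA.
Qed.

Let free_act0l f : free_act 0 f = 0.
Proof. by have := free_actZl 0 0 f; rewrite !scale0r. Qed.

Let free_act0r x : free_act x 0 = 0.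
Proof. by have := free_actZr x 0 0; rewrite !scale0r. Qed.

Let free_actNl x f : free_act (- x) f = - free_act x f.
Proof. by rewrite -scaleN1r free_actZl scaleN1r. Qed.

Let free_act_sum (I : Type) (r : seq I) (F : I -> free_steenrod) f :
  free_act (\sum_(i <- r) F i) f = \sum_(i <- r) free_act (F i) f.
Proof.
elim: r => [|i r IH]; last by rewrite !big_cons free_actDl IH.
by rewrite !big_nil free_act0l.
Qed.

Let free_actU c w f : free_act (mkmalgU w c) f = c *: wact w f.
Proof.
by rewrite (free_actEw _ msuppU_le) big_seq_fset1 mcoeffUU.
Qed.

Let free_actM x y f : free_act (x * y) f = free_act x (free_act y f).
Proof.
rewrite malgME free_act_sum; apply: eq_bigr => w _.
rewrite free_act_sum -/(wact w _).
have -> : wact w (free_act y f) =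
    \sum_(v <- enum_fset (monalg.msupp y)) monalg.mcoeff v y *: wact w (wact v f).
  rewrite /free_act; elim: (enum_fset _) => [|v r IH].
    by rewrite !big_nil; have := wactZ w 0 0; rewrite !scale0r.
  by rewrite !big_cons wactD wactZ IH.
rewrite scaler_sumr; apply: eq_bigr => v _.
by rewrite free_actU wactM scalerA.
Qed.

Let free_act1 f : free_act 1 f = f.
Proof. by rewrite free_actU scale1r /wact fm1. Qed.

Let free_act_sq i f : free_act (free_sq i) f = Sq i f.
Proof. by rewrite free_actU scale1r /wact fmU. Qed.

Lemma adem_act0 x f : adem_ideal x -> free_act x f = 0.
Proof.
move=> xI; elim: xI f => {x} [|a b ab||x y _ IHx _ IHy|z x _ IH|z x _ IH] f.
- by rewrite free_actDl free_actNl free_act1 free_act_sq Sq0 subrr.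
- rewrite free_actDl free_actNl free_actM !free_act_sq Sq_adem //.
  rewrite free_act_sum -sumrB big1 // => c _.
  by rewrite free_actZl free_actM !free_act_sq subrr.
- exact: free_act0l.
- by rewrite free_actDl free_actNl IHx IHy subrr.
- by rewrite free_actM IH free_act0r.
- by rewrite free_actM IH.
Qed.

Definition steenrod_act (x : steenrod) (f : P) : P := free_act (repr x) f.

Lemma steenrod_act_pi x f : steenrod_act (pi x) f = free_act x f.
Proof.
apply/eqP; rewrite -subr_eq0 -free_actNl -free_actDl; apply/eqP/adem_act0.
by apply/steenrod_pi_eq; exact: reprK.
Qed.

Lemma steenrod_act_sq i f : steenrod_act (sq i) f = Sq i f.
Proof. by rewrite steenrod_act_pi. Qed.

Lemma steenrod_act1 f : steenrod_act 1 f = f.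
Proof. by rewrite -steenrod_pi1 steenrod_act_pi. Qed.

Lemma steenrod_actM x y f :
  steenrod_act (x * y) f = steenrod_act x (steenrod_act y f).
Proof.
case: (steenrod_surj x) => {}x ->; case: (steenrod_surj y) => {}y ->.
by rewrite -steenrod_piM !steenrod_act_pi.
Qed.

Lemma steenrod_actDl x y f :
  steenrod_act (x + y) f = steenrod_act x f + steenrod_act y f.
Proof.
case: (steenrod_surj x) => {}x ->; case: (steenrod_surj y) => {}y ->.
by rewrite -steenrod_piD !steenrod_act_pi.
Qed.

Lemma steenrod_actDr x f g :
  steenrod_act x (f + g) = steenrod_act x f + steenrod_act x g.
Proof. exact: free_actDr. Qed.

Lemma steenrod_actZr x c f : steenrod_act x (c *: f) = c *: steenrod_act x f.
Proof. exact: free_actZr. Qed.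

End Action.

Section Hits.
Variable m : nat.
Local Notation P := {mpoly 'F_2[m]}.

Definition hit (f : P) : Prop :=
  exists2 s : seq (steenrod * P),
    (forall u, u \in s -> steenrod_pos u.1)
    & f = \sum_(u <- s) steenrod_act u.1 u.2.

Lemma hit_Sq k f : (0 < k)%N -> hit (Sq k f).
Proof.
move=> k0; exists [:: (sq k, f)]; last first.
  by rewrite big_seq1 /= steenrod_act_sq.
move=> u; rewrite inE => /eqP -> /=; exists (free_sq k) => // w w0.
rewrite /free_sq monalg.mcoeffU; case: eqP => // wE.
by move: w0 k0; rewrite -wE fmU /= addn0 => ->.
Qed.

Lemma hitD f g : hit f -> hit g -> hit (f + g).
Proof.
move=> [s sP ->] [r rP ->]; exists (s ++ r); last by rewrite big_cat.
by move=> u; rewrite mem_cat => /orP[/sP|/rP].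
Qed.

Lemma hitP f : hit f <->
  exists2 s : seq (nat * P), all (fun u => 0 < u.1)%N s
    & f = \sum_(u <- s) Sq u.1 u.2.
Proof.
split=> [[s sP ->]|[s sP ->]]; last first.
  elim: s sP => [_|u s IH /= /andP[u0 /IH sP]].
    by rewrite big_nil; exists [::] => //; rewrite big_nil.
  by rewrite big_cons; apply: hitD => //; apply: hit_Sq.
pose H f := exists2 s : seq (nat * P), all (fun u => 0 < u.1)%N s
    & f = \sum_(u <- s) Sq u.1 u.2.
have H0 : H 0 by exists [::] => //; rewrite big_nil.
have HD f1 f2 : H f1 -> H f2 -> H (f1 + f2).
  by move=> [r rP ->] [l lP ->]; exists (r ++ l); rewrite ?all_cat ?rP ?big_cat.
rewrite -/(H _) big_seq; elim/big_rec: _ => // -[x g] h /sP/= [y yP ->] hH.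
apply: (HD _ _ _ hH); rewrite steenrod_act_pi /free_act; elim/big_rec: _ => // w h' _.
move=> hH'; apply: (HD _ _ _ hH'); have [w0|w0] := posnP (sumn w).
  by rewrite yP // scale0r.
suff [k [l [k0 ->]]] : exists k l, (0 < k)%N /\ foldr (@Sq m) g w = Sq k l.
  by exists [:: (k, monalg.mcoeff w y *: l)]; rewrite /= ?k0 // big_seq1 /= linearZ.
case: w w0 => /=; elim=> // -[|k] w IH /=; last first.
  by move=> _; exists k.+1, (foldr (@Sq m) g w).
by rewrite Sq0.
Qed.

Definition hit_pred : {pred P} := fun f => `[< hit f >].

Lemma hit_predP f : reflect (hit f) (f \in hit_pred).
Proof. exact: asboolP. Qed.

Lemma hitZ c f : hit f -> hit (c *: f).
Proof.
move=> [s sP ->]; exists [seq (u.1, c *: u.2) | u <- s].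
  by move=> _ /mapP[v /sP vP ->].
rewrite big_map scaler_sumr; apply: eq_bigr => u _ /=.
by rewrite steenrod_actZr.
Qed.

Lemma hit_zmod_closed : zmod_closed hit_pred.
Proof.
split=> [|f g /hit_predP fH /hit_predP gH]; apply/hit_predP.
  by exists [::] => //; rewrite big_nil.
by rewrite -scaleN1r; apply/hitD/hitZ.
Qed.

HB.instance Definition _ := GRing.isZmodClosed.Build P hit_pred hit_zmod_closed.

(* F_2 (x)_A P, that is, the quotient of P by its hit elements. *)
Definition cohit : Type := {ideal_quot hit_pred}.

HB.instance Definition _ := GRing.Zmodule.on cohit.
HB.instance Definition _ := Quotient.on cohit.

Definition cohit_pi (f : P) : cohit := (\pi_cohit f)%qT.

Local Notation pi := cohit_pi.

Let reprK' q : pi (repr q) = q.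
Proof. exact: reprK. Qed.

Lemma cohit_surj q : exists f, q = pi f.
Proof. by exists (repr q); rewrite reprK'. Qed.

Lemma cohit_pi_eq f g : pi f = pi g <-> hit (f - g).
Proof.
split=> [E|fg].
  by apply/hit_predP; rewrite Quotient.idealrBE; apply/eqP.
by apply/eqP; rewrite -Quotient.idealrBE; apply/hit_predP.
Qed.

Lemma cohit_piD f g : pi (f + g) = pi f + pi g.
Proof. exact: Quotient.pi_add. Qed.

Let scale (c : 'F_2) (q : cohit) : cohit := pi (c *: repr q).

Let scaleE c f : scale c (pi f) = pi (c *: f).
Proof.
apply/cohit_pi_eq; rewrite -scalerBr; apply: hitZ.
by apply/cohit_pi_eq; rewrite reprK'.
Qed.

Let scaleA a b q : scale a (scale b q) = scale (a * b) q.
Proof. by case: (cohit_surj q) => {}f ->; rewrite !scaleE scalerA. Qed.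

Let scale1 : left_id 1 scale.
Proof. by move=> f; case: (cohit_surj f) => {}f ->; rewrite scaleE scale1r. Qed.

Let scaleDr : right_distributive scale +%R.
Proof.
move=> c.
move=> f; case: (cohit_surj f) => {}f ->.
move=> g; case: (cohit_surj g) => {}g ->.
by rewrite -cohit_piD !scaleE scalerDr cohit_piD.
Qed.

Let scaleDl q : {morph scale^~ q : a b / a + b}.
Proof.
move=> a b; case: (cohit_surj q) => {}f ->.
by rewrite !scaleE scalerDl cohit_piD.
Qed.

HB.instance Definition _ := GRing.Zmodule_isLmodule.Build 'F_2 cohit
  scaleA scale1 scaleDr scaleDl.

Lemma cohit_piZ c f : pi (c *: f) = c *: pi f.
Proof. by rewrite -scaleE. Qed.

Definition cohit_deg (n : nat) (q : cohit) : Prop :=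
  exists2 f : P, f \is n.-homog & q = pi f.

Lemma cohit_deg_closed n (c : 'F_2) p q :
  cohit_deg n p -> cohit_deg n q -> cohit_deg n (c *: p + q).
Proof.
move=> [f fn ->] [g gn ->]; exists (c *: f + g).
  by apply: rpredD => //; apply: rpredZ.
by rewrite cohit_piD cohit_piZ.
Qed.

End Hits.

(* U, assumed to be a subspace of V, has a basis of d elements. *)
Definition has_dimension (F : fieldType) (V : lmodType F) (U : V -> Prop)
    (d : nat) : Prop :=
  exists2 b : 'I_d -> V, (forall i, U (b i)) &
    forall v, U v -> exists! c : {ffun 'I_d -> F}, v = \sum_i c i *: b i.

Arguments has_dimension F {V} U d.

(* Main.v *)
(* Write P(n) for the polynomial ring in n variables.  In degree 46 * 2^d - 5,
   with d >= 5, a polynomial in six variables is modulo hits a sum of towers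
   (e / x_a) (tower)^2, with e = x_1 ... x_6, ending in a polynomial g of degree
   41, since a monomial with at most three odd exponents is hit.  The class of a
   tower depends only on g and on the nonempty set of the indices a.  Restricting
   to the hyperplane of equation sum_(i in S) x_i = 0 and applying d times the
   dual Kameko map x^a |-> x^((a-1)/2) detects these classes and gives, after a
   Moebius inversion over the subsets of the six indices, an isomorphism with the
   sum over the 63 nonempty sets S of the cohits of P(5) in degree 41.

   The latter have dimension 2630 = 730 + 1900.  Monomials x_J h^2 with #|J| = 1
   are hit.  Those with #|J| = 5 reduce to the cohits of P(5) in degree 18, whose
   dimension 730 is computed by elimination.  For #|J| = 3, elimination with the
   hits Sq^1(x_K w^2), #|K| = 4, leaves 1900 generators, and 1900 classes are
   shown to be independent by the functionals f |-> sum of the coefficients of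
   f o A over a set of monomials, where A is a linear substitution by three
   variables and the set of monomials is annihilated by all squares, and by ten
   more functionals, which are sums of 302 coefficients.  As functions of A the
   former are Boolean polynomials in the entries of A, and it suffices to
   eliminate on their algebraic normal forms. *)
From HB Require Import structures.
Require Import Defs.
From Stdlib Require Import PArith NArith FMapPositive.
From mathcomp Require Import all_boot all_order all_algebra.
From mathcomp Require Import ssrcomplements mpoly.
From mathcomp Require Import zify ring.

Set Implicit Arguments.
Unset Strict Implicit.
Unset Printing Implicit Defensive.

Import GRing.Theory.

(** In six variables the dual Kameko map is useless here: it lives on the monomials x_1 ... x_6 h^2,
    of even degree, while 46 * 2^d - 5 is odd. In five variables it carries degree 46 * 2^d - 5 to
    degree 46 * 2^(d-1) - 5, which is why one first restricts to hyperplanes. The relations between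
    the classes of towers mix subsets: they read sum_i [T + i](x_i u) = 0, where [T] is the class
    with set of indices T. Summing over the sets T that contain S makes every i outside S cancel in
    pairs and leaves the relation that l_S u = 0, with l_S the sum of the x_i for i in S. So the
    component of S depends only on the restriction to its own hyperplane. The obstacle is d = 5,
    reached for t = 1: no word of length five has six letters, and the class of the full set must be
    built from the five-letter ones, with a proof that it is well defined. In degree 41 the upper
    bound uses only valid relations and the lower bound only functionals that vanish on hits, so the
    choice of relations, functionals and candidate monomials needs no justification beyond the
    equality of the two counts. *)

Section Foundations.
Local Open Scope ring_scope.

(** * Steenrod squares on monomials and on blocks x_S h^2 *)

Lemma addxx (V : lmodType 'F_2) (x : V) : x + x = 0.
Proof. by rewrite -mulr2n -scaler_nat (_ : 2%:R = 0 :> 'F_2) ?scale0r //; apply/val_inj. Qed.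

Lemma F2_idem (c : 'F_2) : c ^+ 2 = c.
Proof. by case: c => -[|[|//]] i; apply/val_inj. Qed.

Lemma polyC_mulAC (R : comNzRingType) (a b : R) (p : {poly R}) :
  b%:P * p * a%:P = (a * b) *: p.
Proof. by rewrite -mul_polyC polyCM mulrC mulrA. Qed.

Variable m : nat.
Local Notation P := {mpoly 'F_2[m]}.
Implicit Types (f g h u v : P) (S R T : {set 'I_m}) (w : 'X_{1..m}).

Lemma sqrDxx f g : (f + g) ^+ 2 = f ^+ 2 + g ^+ 2.
Proof. by rewrite sqrrD mulr2n addxx addr0. Qed.

Lemma sqr_sum (I : Type) (r : seq I) (p : pred I) (F : I -> P) :
  (\sum_(i <- r | p i) F i) ^+ 2 = \sum_(i <- r | p i) F i ^+ 2.
Proof.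
elim/big_rec2: _ => [|i x y _ <-]; first by rewrite expr0n.
exact: sqrDxx.
Qed.

Lemma sqrZ (c : 'F_2) f : (c *: f) ^+ 2 = c *: f ^+ 2.
Proof. by rewrite exprZn F2_idem. Qed.

Lemma SqD k f g : Sq k (f + g) = Sq k f + Sq k g.
Proof. exact: linearD. Qed.

Lemma SqZ k (c : 'F_2) f : Sq k (c *: f) = c *: Sq k f.
Proof. exact: linearZ. Qed.

Lemma Sq_sum (I : Type) (r : seq I) (p : pred I) (F : I -> P) k :
  Sq k (\sum_(i <- r | p i) F i) = \sum_(i <- r | p i) Sq k (F i).
Proof. exact: linear_sum. Qed.

Lemma Sq_mulX k i f :
  Sq k.+1 ('X_i * f) = 'X_i * Sq k.+1 f + 'X_i ^+ 2 * Sq k f.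
Proof.
rewrite Sq_cartan 2!big_ord_recl /= big1 ?addr0 => [|l _]; last by rewrite SqX /= mul0r.
by rewrite !SqX /= !subn0 /bump /= subn1.
Qed.

(** The total square is multiplicative, so that of f^2 is the square of a polynomial in t, and
    squaring over F_2 leaves only even powers of t. *)
Lemma Sq_sqr k f : Sq k (f ^+ 2) = if odd k then 0 else Sq k./2 f ^+ 2.
Proof.
elim/mpoly_mulX_ind: f k => [|c f g IHf IHg|i f IH] k.
- rewrite expr1n !Sq1; case: k => [|[|k]] //=; first by rewrite expr1n.
  by case: (odd k); rewrite ?expr0n.
- rewrite sqrDxx sqrZ !(SqD, SqZ) IHf IHg.
  by case: (odd k); [rewrite scaler0 addr0 | rewrite sqrDxx sqrZ].
rewrite exprMn (_ : 'X_i ^+ 2 * f ^+ 2 = 'X_i * ('X_i * f ^+ 2)); last by rewrite mulrA.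
case: k => [|[|k]].
- by rewrite !Sq0 !exprMn mulrA.
- rewrite !Sq_mulX !Sq0 IH /= mulr0 add0r -[RHS](addxx ('X_i ^+ 3 * f ^+ 2)).
  by congr (_ + _); ring.
rewrite -[k.+2./2]/(k./2.+1) !Sq_mulX !IH !oddS negbK; case: (odd k); rewrite /negb.
  rewrite !(mulr0, add0r, addr0) -[RHS](addxx ('X_i ^+ 3 * Sq k.+1./2 f ^+ 2)).
  by congr (_ + _); ring.
by rewrite -[k.+2./2]/(k./2.+1) sqrDxx !(mulr0, add0r, addr0); ring.
Qed.

Lemma homog_supp d f (w : 'X_{1..m}) : f \is d.-homog -> w \in msupp f -> mdeg w = d.
Proof. by move=> /dhomogP H /H. Qed.

Lemma Sq_homog k d f : f \is d.-homog -> Sq k f \is (d + k).-homog.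
Proof.
move=> fd; rewrite (mpolyE f) Sq_sum big_seq rpred_sum // => w /(homog_supp fd) wd.
rewrite SqZ rpredZ //= {f fd}.
have E : w = w by [].
have [n] := ubnP (mdeg w); elim: n w d k wd {E} => // n IH w d k <-.
have [/eqP|nz] := eqVneq w 0%MM.
  move=> /eqP-> _; rewrite mpolyX0 Sq1 mdeg0.
  by case: k => [|k]; rewrite ?dhomog1 ?dhomog0.
have [i wi] : exists i, w i != 0%N.
  apply/existsP; apply: contraR nz => /existsPn H.
  by apply/eqP/mnmP=> i; rewrite mnm0E; apply/eqP; move: (H i); rewrite negbK.
have -> : w = (U_(i) + (w - U_(i)))%MM by rewrite addmC submK // lep1mP.
set w' := (w - _)%MM; rewrite mpolyXD mdegD mdeg1 add1n ltnS => lt.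
have X1 : ('X_i : P) \is 1.-homog by rewrite dhomogX /= mdeg1.
have X2 : ('X_i ^+ 2 : P) \is 2.-homog.
  by rewrite expr2; apply: (dhomogM X1 X1).
case: k => [|k].
  rewrite Sq0 addn0 -[(mdeg w').+1]add1n; apply: dhomogM => //.
  by rewrite dhomogX.
rewrite Sq_mulX rpredD //.
  have := dhomogM X1 (IH w' _ k.+1 erefl lt).
  by rewrite (_ : (1 + _ = (mdeg w').+1 + k.+1)%N) //; lia.
have := dhomogM X2 (IH w' _ k erefl lt).
by rewrite (_ : (2 + _ = (mdeg w').+1 + k.+1)%N) //; lia.
Qed.

Definition xs S : P := \prod_(i in S) 'X_i.

Lemma xs_mon S : xs S = 'X_[[multinom (i \in S : nat) | i < m]].
Proof.
rewrite /xs mpolyXE_id [LHS]big_mkcond; apply: eq_bigr => i _.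
by rewrite mnmE; case: (i \in S).
Qed.

Lemma xs_homog S : xs S \is #|S|.-homog.
Proof.
rewrite xs_mon dhomogX /= mdegE -sum1_card [X in _ == X]big_mkcond.
by apply/eqP/eq_bigr => i _; rewrite mnmE; case: (i \in S).
Qed.

Lemma xs1 i : xs [set i] = 'X_i.
Proof. by rewrite /xs big_set1. Qed.

Lemma xs_setD1 S i : i \in S -> xs S = 'X_i * xs (S :\ i).
Proof. by move=> iS; rewrite /xs (big_setD1 i). Qed.

(** The total square of x_S is the product of the x_i + x_i^2 t; the set R records the factors that
    contribute x_i^2 t. *)
Lemma Sq_xs k S :
  Sq k (xs S) = \sum_(R : {set 'I_m} | (R \subset S) && (#|R| == k)) xs (S :\: R) * xs R ^+ 2.
Proof.
rewrite /Sq /xs total_sqE rmorph_prod /=.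
pose F i : {poly P} := if i \in S then ('X_i ^+ 2 : P) *: 'X else 0.
pose G i : {poly P} := if i \in S then ('X_i : P)%:P else 1.
have -> : \prod_(i in S) mpoly.mmap (polyC \o @mpolyC m 'F_2)
   (fun j => ('X_j : P)%:P + ('X_j ^+ 2 : P) *: 'X) 'X_i = \prod_i (F i + G i).
  rewrite big_mkcond; apply: eq_bigr => i _; rewrite /F /G.
  by case: (i \in S); rewrite ?add0r // mpoly.mmapX mmap1U addrC.
rewrite bigA_distr coef_sum [RHS]big_mkcond /=; apply: eq_bigr => R _.
have [sRS|nRS] /= := boolP (R \subset S); last first.
  have [i iR iS] := subsetPn nRS.
  by rewrite (bigD1 i) //= iR /F (negbTE iS) mul0r coef0.
have EG : \prod_(i | i \notin R) G i = (\prod_(i in S :\: R) 'X_i : P)%:P.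
  rewrite (rmorph_prod (@polyC P)) [RHS]big_mkcond [LHS]big_mkcond; apply: eq_bigr => i _.
  by rewrite inE /G; case: (i \in R); case: (i \in S).
have EF : \prod_(i in R) F i = ((\prod_(i in R) 'X_i) ^+ 2 : P)%:P * 'X^#|R|.
  rewrite -prodrXl -(prodr_const (mem R) ('X : {poly P})).
  rewrite (rmorph_prod (@polyC P)) -big_split; apply: eq_bigr => i iR.
  by rewrite /F (subsetP sRS) // -mul_polyC.
have -> : \prod_i (if i \in R then F i else G i) =
  (\prod_(i in S :\: R) 'X_i * (\prod_(i in R) 'X_i) ^+ 2 : P) *: 'X^#|R|.
  transitivity ((\prod_(i in R) F i) * \prod_(i | i \notin R) G i).
    rewrite (bigID (mem R)); congr (_ * _); apply: eq_bigr => i iR.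
      by rewrite (iR : i \in R).
    by rewrite (negbTE (iR : i \notin R)).
  transitivity (((\prod_(i in R) 'X_i) ^+ 2 : P)%:P * 'X^#|R| * (\prod_(i in S :\: R) 'X_i : P)%:P).
    by congr (_ * _).
  exact: polyC_mulAC.
rewrite coefZ coefXn eq_sym; case: eqP => _; by rewrite ?mulr1 ?mulr0.
Qed.

(* [x_S h^2] is the block of monomials whose set of odd exponents is [S]. *)
Lemma Sq_block k S h :
  Sq k (xs S * h ^+ 2) =
  \sum_(R : {set 'I_m} | [&& R \subset S, #|R| <= k & ~~ odd (k - #|R|)]%N)
     xs (S :\: R) * (xs R * Sq (k - #|R|)./2 h) ^+ 2.
Proof.
rewrite Sq_cartan.
under eq_bigr => i _.
  rewrite Sq_xs mulr_suml; under eq_bigr => R /andP[_ /eqP Ri] do rewrite -Ri.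
  over.
rewrite (exchange_big_dep (fun R : {set 'I_m} => R \subset S)) /=; last by move=> i R _ /andP[].
rewrite [RHS](eq_bigl (fun R : {set 'I_m} => (R \subset S) && ((#|R| <= k)%N && ~~ odd (k - #|R|)))) //.
rewrite [RHS]big_mkcondr; apply: eq_bigr => R RS.
have [le|lt] := leqP #|R| k; last first.
  rewrite big1 => [|i /andP[_ /eqP E]]; first by [].
  by have := ltn_ord i; rewrite -E ltnS leqNgt lt.
rewrite (big_pred1 (Ordinal (le : (#|R| < k.+1)%N))) => [|i].
  2: by rewrite RS /= -val_eqE /= eq_sym.
rewrite Sq_sqr andTb; case: (odd _); rewrite /negb.
  by rewrite mulr0.
by rewrite -mulrA -exprMn.
Qed.

Definition oddset (w : 'X_{1..m}) : {set 'I_m} := [set i | odd (w i)].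
Definition halfm (w : 'X_{1..m}) : 'X_{1..m} := [multinom (w i)./2 | i < m].

Lemma monomial_block (w : 'X_{1..m}) :
  'X_[w] = xs (oddset w) * 'X_[halfm w] ^+ 2 :> P.
Proof.
rewrite xs_mon mpolyXn -mpolyXD; congr 'X_[_]; apply/mnmP=> i.
by rewrite mnmDE mulmnE !mnmE inE -{1}(odd_double_half (w i)) -muln2.
Qed.

Lemma mdeg_block (w : 'X_{1..m}) : mdeg w = (#|oddset w| + (mdeg (halfm w)).*2)%N.
Proof.
rewrite !mdegE -sum1_card [\sum_(i in oddset w) 1]big_mkcond /= -muln2 big_distrl -big_split /=.
apply: eq_bigr => i _; rewrite mnmE inE -{1}(odd_double_half (w i)) -muln2.
by case: (odd _).
Qed.

Lemma homog_closed_ind (p : P -> Prop) d :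
  p 0 -> (forall f g, p f -> p g -> p (f + g)) ->
  (forall w, mdeg w = d -> p 'X_[w]) -> forall f, f \is d.-homog -> p f.
Proof.
move=> p0 pD H f fd; rewrite (mpolyE f) big_seq.
apply: big_ind => // w /(homog_supp fd) wd.
have [->|->] : f@_w = 0 \/ f@_w = 1.
  by case: (f@_w) => -[|[|//]] i; [left|right]; apply/val_inj.
  by rewrite scale0r.
by rewrite scale1r; apply: H.
Qed.

Lemma Sq_big k d f : f \is d.-homog -> (d < k)%N -> Sq k f = 0.
Proof.
have aux w j : (mdeg w < j)%N -> Sq j 'X_[w] = 0 :> P.
  have [n] := ubnP (mdeg w); elim: n w j => // n IH w j.
  have [/eqP|nz] := eqVneq w 0%MM.
    by move=> /eqP-> _; rewrite mpolyX0 Sq1 mdeg0; case: j.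
  have [i wi] : exists i, w i != 0%N.
    apply/existsP; apply: contraR nz => /existsPn H.
    by apply/eqP/mnmP=> i; rewrite mnm0E; apply/eqP; move: (H i); rewrite negbK.
  have -> : w = (U_(i) + (w - U_(i)))%MM by rewrite addmC submK // lep1mP.
  set w' := (w - _)%MM; rewrite mpolyXD mdegD mdeg1 add1n ltnS => lt.
  case: j => // j; rewrite ltnS => lt'.
  by rewrite Sq_mulX !IH ?mulr0 ?addr0 // ltnW.
move=> fd dk; apply: (@homog_closed_ind (fun f => Sq k f = 0) d _ _ _ f fd) => [|f' g Hf Hg|w wd].
- exact: linear0.
- by rewrite SqD Hf Hg addr0.
by rewrite aux // wd.
Qed.

Lemma Sq_top d f : f \is d.-homog -> Sq d f = f ^+ 2.
Proof.
have aux w : Sq (mdeg w) 'X_[w] = 'X_[w] ^+ 2 :> P.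
  have [n] := ubnP (mdeg w); elim: n w => // n IH w.
  have [/eqP|nz] := eqVneq w 0%MM.
    by move=> /eqP-> _; rewrite mpolyX0 mdeg0 Sq0 expr1n.
  have [i wi] : exists i, w i != 0%N.
    apply/existsP; apply: contraR nz => /existsPn H.
    by apply/eqP/mnmP=> i; rewrite mnm0E; apply/eqP; move: (H i); rewrite negbK.
  have -> : w = (U_(i) + (w - U_(i)))%MM by rewrite addmC submK // lep1mP.
  set w' := (w - _)%MM; rewrite mpolyXD mdegD mdeg1 add1n ltnS => lt.
  rewrite Sq_mulX IH // (@Sq_big _ (mdeg w')) ?dhomogX // mulr0 add0r.
  by rewrite exprMn.
move=> fd; apply: (@homog_closed_ind (fun f => Sq d f = f ^+ 2) d _ _ _ f fd) => [|f' g Hf Hg|w <-].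
- by rewrite expr0n; apply: linear0.
- by rewrite SqD Hf Hg sqrDxx.
exact: aux.
Qed.

End Foundations.

(** * Sums of few powers of two *)

Section PowerSums.

(** Repetitions are allowed, but two equal powers merge into one: the condition says that n has at
    most r binary digits equal to 1. *)
Definition pow2le r n := exists2 s : seq nat, size s <= r & \sum_(i <- s) 2 ^ i = n.

Lemma pow2le0 n : pow2le 0 n -> n = 0.
Proof. by case=> -[|//] _ <-; rewrite big_nil. Qed.

(** If 2^0 occurs in an even sum it occurs twice, and two copies are merged into 2^1, which shortens
    the list; without 2^0 every exponent can be lowered by one. *)
Lemma pow2le_even r n : pow2le r n.*2 -> pow2le r n.
Proof.
case=> s; have [k] := ubnP (size s); elim: k s => // k IH s lt sr E.
have [z|nz] := boolP (0 \in s); last first.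
  exists [seq i.-1 | i <- s]; rewrite ?size_map // big_map.
  apply: double_inj; rewrite -E -muln2 big_distrl; apply: eq_big_seq => i si.
  by case: i si => [|i] si; [rewrite si in nz | rewrite /= expnS mulnC].
have E1 : \sum_(i <- s) 2 ^ i = (\sum_(i <- rem 0 s) 2 ^ i).+1.
  by rewrite (big_rem 0).
have sz := size_rem z; have s0 : 0 < size s by case: (s) z.
have [z'|nz'] := boolP (0 \in rem 0 s); last first.
  exfalso; suff : ~~ odd (\sum_(i <- rem 0 s) 2 ^ i).
    by move=> /negbTE H; have := congr1 odd E; rewrite E1 /= H odd_double.
  rewrite big_seq; elim/big_ind: _ => // [x y|i si]; first by rewrite oddD => /negbTE-> /negbTE->.
  by case: i si => [|i] si; [rewrite si in nz' | rewrite oddX].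
have s1 : 0 < size (rem 0 s) by case: (rem 0 s) z'.
have sz' := size_rem z'; rewrite sz in s1 sz'.
apply: (IH (1 :: rem 0 (rem 0 s))).
- by rewrite /= sz'; move: lt s1; clear; case: (size s) => [|[|a]].
- by rewrite /= sz'; move: sr s1; clear; case: (size s) => [|[|a]] //= /ltnW.
by rewrite big_cons -E E1 (big_rem 0 z').
Qed.

Lemma pow2le_odd r n : pow2le r n.*2.+1 -> 0 < r /\ pow2le r.-1 n.
Proof.
case=> s sr E; have z : 0 \in s.
  apply/negP => /negP nz; suff : ~~ odd (\sum_(i <- s) 2 ^ i) by rewrite E /= odd_double.
  rewrite big_seq; elim/big_ind: _ => // [x y|i si]; first by rewrite oddD => /negbTE-> /negbTE->.
  by case: i si => [|i] si; [rewrite si in nz | rewrite oddX].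
have s0 : 0 < size s by case: (s) z.
split; first lia.
apply: pow2le_even; exists (rem 0 s).
  by rewrite size_rem //; move: sr s0; clear; case: (size s) r => [|a] [|b].
by move: E; rewrite (big_rem 0 z) /= add1n => -[].
Qed.

(** In binary the number is 22 = 10110, which has three digits 1, followed by d further digits 1. *)
Lemma pow2le3_gap d : 0 < d -> ~ pow2le 3 (23 * 2 ^ d - 1).
Proof.
have D k : 23 * 2 ^ k.+1 - 1 = (23 * 2 ^ k - 1).*2.+1.
  by have := expn_gt0 2 k; rewrite expnS; lia.
case: d => // -[|[|d]] _.
- move=> /(@pow2le_odd 3 22)[_] /(@pow2le_even 2 11) /(@pow2le_odd 2 5)[_].
  by move=> /(@pow2le_odd 1 2)[_] /pow2le0.
- move=> /(@pow2le_odd 3 45)[_] /(@pow2le_odd 2 22)[_] /(@pow2le_even 1 11).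
  by move=> /(@pow2le_odd 1 5)[_] /pow2le0.
rewrite D => /pow2le_odd[_]; rewrite D => /pow2le_odd[_]; rewrite D => /pow2le_odd[_] /pow2le0.
by have := expn_gt0 2 d; lia.
Qed.

(** This is twice 23 * 2^(d-1) - 1, so it has d + 2 binary digits equal to 1. *)
Lemma pow2le1_gap d : 0 < d -> ~ pow2le 1 (23 * 2 ^ d - 2).
Proof.
case: d => // d _; have -> : 23 * 2 ^ d.+1 - 2 = (23 * 2 ^ d - 1).*2.
  by have := expn_gt0 2 d; rewrite expnS; lia.
move/pow2le_even; case: d => [|d].
  by move=> /(@pow2le_even 1 11) /(@pow2le_odd 1 5)[_] /pow2le0.
have -> : 23 * 2 ^ d.+1 - 1 = (23 * 2 ^ d - 1).*2.+1.
  by have := expn_gt0 2 d; rewrite expnS; lia.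
by move=> /pow2le_odd[_] /pow2le0; have := expn_gt0 2 d; lia.
Qed.

Lemma pow2le1_21 : ~ pow2le 1 21.
Proof. by move=> /(@pow2le_odd 1 10)[_] /pow2le0. Qed.

End PowerSums.

Local Open Scope ring_scope.

Section PiLinear.
Variable m : nat.
Lemma cohit_pi_is_linear : linear (@cohit_pi m).
Proof. by move=> c f g; rewrite cohit_piD cohit_piZ. Qed.
HB.instance Definition _ := GRing.isLinear.Build 'F_2 {mpoly 'F_2[m]} (cohit m) *:%R
  (@cohit_pi m) cohit_pi_is_linear.
End PiLinear.

(** * Hits, and moving squares across a product with the conjugate squares *)

Section HitTheory.
Variable m : nat.
Local Notation P := {mpoly 'F_2[m]}.
Local Notation pi := (@cohit_pi m).
Implicit Types (f g h u v : P) (S R T : {set 'I_m}) (w : 'X_{1..m}).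

Lemma pi_eq0 f : pi f = 0 <-> hit f.
Proof. by rewrite -(linear0 pi) cohit_pi_eq subr0. Qed.

Lemma pi_Sq k f : (0 < k)%N -> pi (Sq k f) = 0.
Proof. by move=> k0; apply/pi_eq0/hit_Sq. Qed.

Lemma hit0 : hit (0 : P).
Proof. by apply/pi_eq0; rewrite linear0. Qed.

Lemma hit_linear (V : lmodType 'F_2) (L : {linear P -> V}) f :
  (forall k g, (0 < k)%N -> L (Sq k g) = 0) -> hit f -> L f = 0.
Proof.
move=> LS /hitP[s sP ->]; rewrite linear_sum big_seq big1 // => u us.
by apply: LS; apply: (allP sP).
Qed.

Lemma pihomog_Sq d k f :
  pihomog mdeg d (Sq k f) = if (k <= d)%N then Sq k (pihomog mdeg (d - k) f) else 0.
Proof.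
rewrite {1}(mpolyE f) Sq_sum [LHS]linear_sum.
have -> : (if (k <= d)%N then Sq k (pihomog mdeg (d - k) f) else 0) =
   \sum_(w <- msupp f) (if (k <= d)%N then Sq k (pihomog mdeg (d - k) (f@_w *: 'X_[w])) else 0) :> P.
  case: (k <= d)%N; last by rewrite big1.
  by rewrite {1}(mpolyE f) [pihomog _ _ _]linear_sum Sq_sum.
apply: eq_bigr => w _; rewrite SqZ [LHS]linearZ [pihomog mdeg (d - k) _]linearZ /= SqZ pihomogX.
have Sw : Sq k ('X_[w] : P) \is (mdeg w + k).-homog by apply: Sq_homog; rewrite dhomogX.
have [E|N] := eqVneq (mdeg w + k)%N d.
  by rewrite -E leq_addl addnK eqxx (pihomog_dE Sw).
rewrite (pihomog_ne0 N Sw) scaler0; case: leqP => // kd.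
rewrite ifF; last by apply: contraNF N => /eqP->; rewrite subnK.
by rewrite [Sq _ _]linear0 scaler0.
Qed.

(** Projecting an expression of f as a sum of squares to degree d makes all the sources
    homogeneous. *)
Lemma hit_homog_ind (p : P -> Prop) d :
  p 0 -> (forall f g, p f -> p g -> p (f + g)) ->
  (forall k v, (0 < k <= d)%N -> v \is (d - k).-homog -> p (Sq k v)) ->
  forall f, f \is d.-homog -> hit f -> p f.
Proof.
move=> p0 pD pS f fd /hitP[s sP E]; rewrite -(pihomog_dE fd) E linear_sum big_seq /=.
apply: big_ind => // u /(allP sP) u0; rewrite pihomog_Sq.
by case: leqP => // le; apply: pS; rewrite ?u0 ?le ?pihomogP.
Qed.

Let h (i : 'I_m) : {poly P} := ('X_i : P)%:P + ('X_i ^+ 2 : P) *: 'X.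
Let c0 : {rmorphism 'F_2 -> {poly P}} := (@polyC P \o @mpolyC m 'F_2).
Let T : {rmorphism P -> {poly P}} := mpoly.mmap c0 h.

Let TE f : T f = total_sq f. Proof. by []. Qed.
(** The extension of the total square to P[t] that fixes t. Its coefficient of index e is the
    coefficient of F of the same index plus squares of positive degree, that is, plus hits. *)
Let shat (F : {poly P}) : {poly P} := (map_poly T F).['X].

Let shatM F G : shat (F * G) = shat F * shat G.
Proof. by rewrite /shat rmorphM hornerM. Qed.

Let shatC f : shat f%:P = total_sq f.
Proof. by rewrite /shat map_polyC hornerC. Qed.

Let shat_coef F e : (shat F)`_e = \sum_(j < e.+1) Sq (e - j) F`_j.
Proof.
pose n := maxn (size F) e.+1.
rewrite /shat (@horner_coef_wide _ n); last first.
  by rewrite (leq_trans (size_poly _ _)) // leq_maxl.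
rewrite coef_sum (big_ord_widen n (fun j => Sq (e - j) F`_j)) ?leq_maxr //.
rewrite [RHS]big_mkcond; apply: eq_bigr => j _.
by rewrite coefMXn coef_map ltnS ltnNge; case: (j <= e)%N.
Qed.

Let sqrD2 (F G : {poly P}) : (F + G) ^+ 2 = F ^+ 2 + G ^+ 2.
Proof.
rewrite sqrrD mulr2n (_ : F * G + F * G = 0) ?addr0 //.
by apply/polyP => j; rewrite coefD addxx coef0.
Qed.

Let exprD2 (F G : {poly P}) k : (F + G) ^+ (2 ^ k) = F ^+ (2 ^ k) + G ^+ (2 ^ k).
Proof. by elim: k => [|k IH]; rewrite ?expr1 // expnSr !exprM IH sqrD2. Qed.

Let shatD F G : shat (F + G) = shat F + shat G.
Proof. by rewrite /shat rmorphD hornerD. Qed.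

Let shatX k : shat 'X^k = 'X^k.
Proof. by rewrite /shat map_polyXn hornerXn. Qed.

Let TX i : total_sq 'X_i = ('X_i : P)%:P + ('X_i : P)%:P ^+ 2 * 'X.
Proof. by rewrite total_sqE mpoly.mmapX mmap1U -mul_polyC rmorphXn. Qed.

(* The series [sum_k x^(2^k) t^(2^k - 1)] inverts the total square on [x]; its
   products give the conjugate squares of products of variables. *)
Let chi_var i n : exists2 D : {poly P},
  shat D = ('X_i : P)%:P + ('X_i : P)%:P ^+ (2 ^ n.+1) * 'X^(2 ^ n.+1 - 1) &
  forall j, D`_j != 0 -> exists k, j.+1 = (2 ^ k)%N.
Proof.
elim: n => [|n [D DE Ds]].
  exists ('X_i : P)%:P; first by rewrite shatC TX.
  by move=> j; rewrite coefC; case: j => [|j]; [exists 0%N | rewrite eqxx].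
exists (D + (('X_i : P) ^+ (2 ^ n.+1))%:P * 'X^(2 ^ n.+1 - 1)).
  have E : total_sq (('X_i : P) ^+ (2 ^ n.+1)) =
      ('X_i : P)%:P ^+ (2 ^ n.+1) + ('X_i : P)%:P ^+ (2 ^ n.+2) * 'X^(2 ^ n.+1).
    by rewrite -TE rmorphXn TE TX exprD2 exprMn -exprM -expnS.
  have E2 : (2 ^ n.+2 - 1 = 2 ^ n.+1 + (2 ^ n.+1 - 1))%N.
    by have := expn_gt0 2 n.+1; rewrite [(2 ^ n.+2)%N]expnS; lia.
  rewrite shatD shatM shatC shatX DE E mulrDl -mulrA -exprD -E2 addrA -[RHS]addr0.
  set A := _ ^+ _ * _; set B := _ ^+ _ * _; set a := _%:P.
  have AA : A + A = 0 by apply/polyP => j; rewrite coefD addxx coef0.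
  by rewrite -(addrA a) AA addr0 addr0.
move=> j; rewrite coefD coefCM coefXn; have [->|ne] := eqVneq j (2 ^ n.+1 - 1)%N.
  by move=> _; exists n.+1; have := expn_gt0 2 n.+1; lia.
by rewrite mulr0 addr0; apply: Ds.
Qed.

(** Multiplying the truncated inverse series of the variables gives C. Each factor contributes an
    exponent 2^k - 1 of t, so an exponent occurring in C plus the number of factors is a sum of that
    many powers of two. The remainder starts at t^N. *)
Let chi_exists N (s : seq 'I_m) : exists C R : {poly P},
  shat C = (\prod_(i <- s) 'X_i : P)%:P + 'X^N * R /\
  forall j, C`_j != 0 -> pow2le (size s) (j + size s).
Proof.
elim: s => [|i s [C [R [CE Cs]]]].
  exists 1, 0; rewrite big_nil mulr0 addr0; split.
    by rewrite -[1]/(1%:P) shatC total_sq1.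
  move=> [|j]; rewrite coef1 ?eqxx // => _.
  by exists [::]; rewrite ?big_nil.
have [D DE Ds] := chi_var i N.
have [R' RE] : exists R' : {poly P}, 'X^(2 ^ N.+1 - 1) = 'X^N * R'.
  exists 'X^(2 ^ N.+1 - 1 - N); rewrite -exprD subnKC //.
  by have := ltn_expl N (isT : 1 < 2)%N; rewrite expnS; lia.
exists (D * C); rewrite shatM CE DE RE big_cons.
set a := ('X_i : P)%:P; set b := _%:P.
exists (a * R + a ^+ (2 ^ N.+1) * R' * b + a ^+ (2 ^ N.+1) * R' * ('X^N * R)); split.
  by rewrite rmorphM -/a -/b; ring.
move=> j; rewrite coefM => nz.
have [l] : exists l : 'I_j.+1, D`_l * C`_(j - l) != 0.
  by apply/existsP; apply: contraR nz => /existsPn H; rewrite big1 // => l _; apply/eqP; move: (H l); rewrite negbK.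
have [->|/Ds [k kE]] := eqVneq D`_l 0; first by rewrite mul0r eqxx.
have [->|/Cs [r rs rE] _] := eqVneq C`_(j - l) 0; first by rewrite mulr0 eqxx.
exists (k :: r) => //=; rewrite big_cons rE -kE; have := ltn_ord l; lia.
Qed.

(* Moving a square across the product: [x_S h^2 = x_S Sq^e h] is congruent to
   [chi(Sq^e)(x_S) h], which vanishes for degree reasons. *)
Lemma pi_block_gap S v e : v \is e.-homog -> ~ pow2le #|S| (e + #|S|) ->
  pi (xs S * v ^+ 2) = 0.
Proof.
(* With N = e + 1 the remainder does not reach the coefficient of t^e, which is therefore x_S Sq^e v
   = x_S v^2. *)
move=> he np; have [C [R [CE Cs]]] := chi_exists e.+1 (enum S).
have : (shat (C * v%:P))`_e = xs S * v ^+ 2.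
  rewrite shatM shatC CE mulrDl coefD -(mulrA 'X^_) coefXnM ltnSn addr0 coefCM.
  by rewrite big_enum -[(total_sq v)`_e]/(Sq e v) (Sq_top he).
(* The terms of index j < e are hits; the last one is C_e v, and C_e = 0 by the condition on binary
   digits. *)
rewrite shat_coef => <-; rewrite big_ord_recr /= subnn Sq0 coefMC.
have -> : C`_e = 0.
  by apply/eqP/negP => /negP /Cs; rewrite -cardE.
rewrite mul0r addr0 linear_sum big1 // => j _.
by apply: pi_Sq; rewrite subn_gt0.
Qed.

End HitTheory.

(** * Linear maps prescribed on monomials *)

Section LinearExtension.
Variables (m : nat) (V : lmodType 'F_2) (phi : 'X_{1..m} -> V).
Local Notation P := {mpoly 'F_2[m]}.

Definition mlin (f : P) : V := \sum_(w <- msupp f) f@_w *: phi w.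

Lemma mlinEw (f : P) k : (msize f <= k)%N ->
  mlin f = \sum_(w : 'X_{1..m < k}) f@_w *: phi w.
Proof.
move=> fk; pose I : subFinType _ := 'X_{1..m < k}; rewrite /mlin (big_mksub I) /=; first last.
- by move=> w /msize_mdeg_lt /leq_trans; apply.
- exact: msupp_uniq.
rewrite big_rmcond // => i; by move/memN_msupp_eq0->; rewrite scale0r.
Qed.

Lemma mlin_is_linear : linear mlin.
Proof.
move=> c f g; pose k := maxn (msize (c *: f + g)) (maxn (msize f) (msize g)).
rewrite (@mlinEw (c *: f + g) k) ?leq_maxl // (@mlinEw f k) ?(@mlinEw g k); first last.
- by rewrite /k !leq_max leqnn !orbT.
- by rewrite /k !leq_max leqnn !orbT.
rewrite scaler_sumr -big_split; apply: eq_bigr => w _.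
by rewrite mcoeffD mcoeffZ scalerDl scalerA.
Qed.

HB.instance Definition _ := GRing.isLinear.Build 'F_2 P V *:%R mlin mlin_is_linear.

Lemma mlinX w : mlin 'X_[w] = phi w.
Proof. by rewrite /mlin msuppX big_seq1 mcoeffX eqxx scale1r. Qed.

End LinearExtension.

(** * Blocks of monomials and the dual Kameko map *)

Section Monomials.
Variable m : nat.
Local Notation P := {mpoly 'F_2[m]}.
Implicit Types (f g h u v : P) (S R T : {set 'I_m}) (w : 'X_{1..m}).

Lemma mono_ind (p : 'X_{1..m} -> Prop) :
  p 0%MM -> (forall i w, p w -> p (U_(i) + w)%MM) -> forall w, p w.
Proof.
move=> p0 pS w; have [n] := ubnP (mdeg w); elim: n w => // n IH w.
have [/eqP|nz] := eqVneq w 0%MM; first by move=> /eqP->.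
have [i wi] : exists i, w i != 0%N.
  apply/existsP; apply: contraR nz => /existsPn H.
  by apply/eqP/mnmP=> i; rewrite mnm0E; apply/eqP; move: (H i); rewrite negbK.
have -> : w = (U_(i) + (w - U_(i)))%MM by rewrite addmC submK // lep1mP.
by rewrite mdegD mdeg1 add1n ltnS => lt; apply/pS/IH.
Qed.

Definition blockm S w : 'X_{1..m} := [multinom ((i \in S) + (w i).*2)%N | i < m].

Lemma blockmE S w : xs S * 'X_[w] ^+ 2 = 'X_[blockm S w] :> P.
Proof.
rewrite xs_mon mpolyXn -mpolyXD; congr 'X_[_]; apply/mnmP=> i.
by rewrite mnmDE mulmnE !mnmE muln2.
Qed.

Lemma oddset_blockm S w : oddset (blockm S w) = S.
Proof. by apply/setP=> i; rewrite inE mnmE oddD odd_double addbF; case: (i \in S). Qed.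

Lemma halfm_blockm S w : halfm (blockm S w) = w.
Proof. by apply/mnmP=> i; rewrite !mnmE half_bit_double. Qed.

(* The dual of the up-Kameko map [h |-> x_1 ... x_m h^2]. *)
Definition kameko : P -> P :=
  mlin (fun w => if oddset w == setT then 'X_[halfm w] else 0).

HB.instance Definition _ := GRing.Linear.on kameko.

Lemma kamekoD f g : kameko (f + g) = kameko f + kameko g.
Proof. exact: linearD. Qed.

Lemma kamekoZ (c : 'F_2) f : kameko (c *: f) = c *: kameko f.
Proof. exact: linearZ. Qed.

Lemma kameko_sum (I : Type) (r : seq I) (p : pred I) (F : I -> P) :
  kameko (\sum_(i <- r | p i) F i) = \sum_(i <- r | p i) kameko (F i).
Proof. exact: linear_sum. Qed.

Lemma kameko_block S h : kameko (xs S * h ^+ 2) = if S == setT then h else 0.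
Proof.
rewrite (mpolyE h) sqr_sum mulr_sumr kameko_sum.
have -> : (if S == setT then \sum_(w <- msupp h) h@_w *: 'X_[w] else 0) =
  \sum_(w <- msupp h) h@_w *: (if S == setT then 'X_[w] else 0) :> P.
  by case: (S == setT) => //; rewrite big1 // => i _; rewrite scaler0.
apply: eq_bigr => w _; rewrite sqrZ -scalerAr kamekoZ blockmE.
by rewrite /kameko mlinX oddset_blockm halfm_blockm.
Qed.

(** A square replaces the set S of odd exponents by S minus R, which is the full set only if S is
    full and R is empty. Hence the map turns Sq^(2k) into Sq^k and kills odd squares, so it
    preserves hits. *)
Lemma kameko_Sq_block k S h :
  kameko (Sq k (xs S * h ^+ 2)) = if (S == setT) && ~~ odd k then Sq k./2 h else 0.
Proof.
rewrite Sq_block kameko_sum.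
have E R : R \subset S -> (S :\: R == setT) = (S == setT) && (R == set0).
  move=> RS; apply/eqP/andP => [H|[/eqP-> /eqP->]]; last by rewrite setD0.
  have ST : S == setT by rewrite eqEsubset subsetT -H subsetDl.
  split=> //; apply/eqP/setP=> i; rewrite inE; have := in_setT i; rewrite -H inE.
  by case: (i \in R).
have [ST|nST] := boolP (S == setT); last first.
  by rewrite big1 // => R /and3P[RS _ _]; rewrite kameko_block E // (negbTE nST).
have [ok|ok] := boolP (odd k).
  rewrite big1 // => R /and3P[RS _ oR]; rewrite kameko_block E // ST.
  have [R0|//] := boolP (R == set0); move: oR.
  by rewrite (eqP R0) cards0 subn0 ok.
rewrite (bigD1 set0) /=; last by rewrite sub0set cards0 subn0 ok.
rewrite big1 => [|R /andP[/and3P[RS _ _] R0]]; last by rewrite kameko_block E // (negbTE R0) andbF.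
by rewrite addr0 kameko_block setD0 ST cards0 subn0 /xs big_set0 mul1r.
Qed.

Lemma hit_kameko f : hit f -> hit (kameko f).
Proof.
move=> hf; apply/pi_eq0.
apply: (@hit_linear _ _ (@cohit_pi m \o kameko : {linear P -> cohit m})) hf => k g k0.
rewrite (mpolyE g) Sq_sum linear_sum big1 // => w _; rewrite SqZ linearZ /=.
rewrite monomial_block kameko_Sq_block.
have [/andP[_ ok]|_] := boolP (_ && _); last by rewrite [cohit_pi _]linear0 scaler0.
by rewrite pi_Sq ?scaler0 // half_gt0; case: k k0 ok => [|[]].
Qed.

End Monomials.

(** * Linear substitutions commute with the squares *)

Section Substitution.
Variables (m n : nat).

(** The second condition is the Cartan formula for a linear form; stated on products, it is additive
    in l because squaring is. *)
Definition linform (l : {mpoly 'F_2[n]}) :=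
  l \is 1.-homog /\ forall k g, Sq k.+1 (l * g) = l * Sq k.+1 g + l ^+ 2 * Sq k g.

Lemma linformX i : linform 'X_i.
Proof. by split=> [|k g]; [rewrite dhomogX /= mdeg1 | apply: Sq_mulX]. Qed.

Lemma linform_sum (I : Type) (r : seq I) (p : pred I) F :
  (forall i, p i -> linform (F i)) -> linform (\sum_(i <- r | p i) F i).
Proof.
move=> H; elim/big_rec: _ => [|i l pi [l1 lS]].
  split; first exact: dhomog0.
  by move=> k g; rewrite expr0n !mul0r [Sq _ _]linear0 addr0.
have [f1 fS] := H i pi; split; first exact: rpredD.
by move=> k g; rewrite sqrDxx !mulrDl SqD fS lS addrACA.
Qed.

Variable (lq : m.-tuple {mpoly 'F_2[n]}).
Hypothesis lqP : forall i, linform (tnth lq i).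

Lemma comp_mpolyM (f g : {mpoly 'F_2[m]}) : (f * g) \mPo lq = (f \mPo lq) * (g \mPo lq).
Proof. exact: rmorphM. Qed.

Let compD (f g : {mpoly 'F_2[m]}) : (f + g) \mPo lq = (f \mPo lq) + (g \mPo lq).
Proof. exact: linearD. Qed.

Let compZ (c : 'F_2) (f : {mpoly 'F_2[m]}) : (c *: f) \mPo lq = c *: (f \mPo lq).
Proof. exact: linearZ. Qed.

Lemma Sq_comp k f : Sq k (f \mPo lq) = Sq k f \mPo lq.
Proof.
elim/mpoly_mulX_ind: f k => [|c f g IHf IHg|i f IH] k.
- by rewrite comp_mpoly1 !Sq1; case: k => [|k]; rewrite ?comp_mpoly1 ?comp_mpoly0.
- rewrite (compD (c *: f) g) (compZ c f) (SqD k (c *: (f \mPo lq)) (g \mPo lq)).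
  rewrite (SqZ k c (f \mPo lq)) (SqD k (c *: f) g) (SqZ k c f).
  rewrite (compD (c *: Sq k f) (Sq k g)) (compZ c (Sq k f)).
  by congr (c *: _ + _); [apply: IHf | apply: IHg].
have Xi : 'X_i \mPo lq = tnth lq i by rewrite comp_mpolyXU (tnth_nth 0).
have X2 : 'X_i ^+ 2 \mPo lq = tnth lq i ^+ 2 by rewrite !expr2 (comp_mpolyM 'X_i 'X_i) Xi.
case: k => [|k]; first by rewrite !Sq0.
have [_ lS] := lqP i.
rewrite (comp_mpolyM 'X_i f) Xi lS (IH k.+1) (IH k) Sq_mulX (compD ('X_i * _) _).
by rewrite (comp_mpolyM 'X_i (Sq k.+1 f)) (comp_mpolyM ('X_i ^+ 2) (Sq k f)) Xi X2.
Qed.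

Lemma hit_comp f : hit f -> hit (f \mPo lq).
Proof.
move=> hf; apply/pi_eq0.
apply: (@hit_linear _ _ (@cohit_pi n \o comp_mpoly lq : {linear _ -> cohit n})) hf => k g k0.
by rewrite /= -Sq_comp pi_Sq.
Qed.

Lemma homog_comp d f : f \is d.-homog -> f \mPo lq \is d.-homog.
Proof.
move=> fd; rewrite comp_mpolyEX big_seq; apply: rpred_sum => w /(homog_supp fd) <-.
apply: rpredZ; elim/mono_ind: w => [|i w IH].
  by rewrite mpolyX0 mdeg0 comp_mpoly1 dhomog1.
rewrite mpolyXD mdegD mdeg1 comp_mpolyM; apply: dhomogM => //.
by rewrite comp_mpolyXU -tnth_nth; case: (lqP i).
Qed.

End Substitution.

(** The degree of a tower of d floors over a polynomial of degree 41: each floor sends degree s to 5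
    + 2s. *)
Definition stage (d : nat) : nat := (46 * 2 ^ d - 5)%N.

Lemma stageS d : stage d.+1 = (5 + (stage d).*2)%N.
Proof. by rewrite /stage; have := expn_gt0 2 d; rewrite expnS; lia. Qed.

Lemma stage_gt d : (40 < stage d)%N.
Proof. by rewrite /stage; have := expn_gt0 2 d; lia. Qed.

Lemma addxx_eq (V : lmodType 'F_2) (x y : V) : x + y = 0 -> x = y.
Proof. by move=> E; rewrite -[LHS]addr0 -(addxx y) addrA E add0r. Qed.

Lemma mulX_homog n (i : 'I_n) (v : {mpoly 'F_2[n]}) e : v \is e.-homog -> 'X_i * v \is e.+1.-homog.
Proof.
have Xi : ('X_i : {mpoly 'F_2[n]}) \is 1.-homog by rewrite dhomogX /= mdeg1.
by move=> /(dhomogM Xi).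
Qed.

(** * Towers and the relations between their classes *)

Section Generators.
Local Notation P := {mpoly 'F_2[6]}.
Local Notation pi := (@cohit_pi 6).
Local Notation I := 'I_6.
Implicit Types (f g h u v : P) (S R T : {set I}) (w : 'X_{1..6}) (o p : seq I) (a b i : I).

Lemma piD f g : pi (f + g) = pi f + pi g.
Proof. exact: linearD. Qed.

Lemma pi0 : pi 0 = 0.
Proof. exact: linear0. Qed.

Lemma pi_sum (J : Type) (r : seq J) (p : pred J) (F : J -> P) :
  pi (\sum_(i <- r | p i) F i) = \sum_(i <- r | p i) pi (F i).
Proof. exact: linear_sum. Qed.

(** The degree is odd, so S has one or three elements, and e + #|S| is 23 * 2^(d+1) minus 2 or minus
    1: too many binary digits equal to 1 for [pi_block_gap] to fail. *)
Lemma pi_weight d S h e : (#|S| < 5)%N -> h \is e.-homog ->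
  (#|S| + e.*2 = stage d.+1)%N -> pi (xs S * h ^+ 2) = 0.
Proof.
move=> S5 he E; apply: (pi_block_gap he).
have := expn_gt0 2 d; move: E; rewrite /stage expnS.
move=> E d0; have [c|c] : #|S| = 1%N \/ #|S| = 3%N by lia.
  have -> : (e + #|S| = 23 * 2 ^ d.+1 - 2)%N by rewrite expnS; lia.
  by rewrite c; apply: pow2le1_gap.
have -> : (e + #|S| = 23 * 2 ^ d.+1 - 1)%N by rewrite expnS; lia.
by rewrite c; apply: pow2le3_gap.
Qed.

Definition omit (a : I) : P := xs [set~ a].

Lemma card_omit (a : I) : #|[set~ a]| = 5%N.
Proof. by rewrite cardsC1 card_ord. Qed.

Lemma omit_homog a : omit a \is 5.-homog.
Proof. by have := xs_homog [set~ a]; rewrite card_omit. Qed.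

Lemma sqr_homog h e : h \is e.-homog -> h ^+ 2 \is e.*2.-homog.
Proof. by move=> he; rewrite -addnn expr2; apply: dhomogM. Qed.

Let weight_count x y k s : (x + y = 5 -> y <= k.*2 -> k <= s -> ~~ odd (k.*2 - y) ->
  x + (y + (s - k + (k.*2 - y)./2)).*2 = 5 + s.*2)%N.
Proof. by move=> E yk ks /negbTE o; have := odd_double_half (k.*2 - y); rewrite o; lia. Qed.

(** Expand Sq^(2k) of omit(a) v^2: the empty set R gives omit(a) (Sq^k v)^2, and every other R
    leaves fewer than five odd exponents, hence a hit. *)
Lemma pi_omit_hit d a h : h \is (stage d).-homog -> hit h -> pi (omit a * h ^+ 2) = 0.
Proof.
move=> hd hh; apply: (@hit_homog_ind _ (fun h => pi (omit a * h ^+ 2) = 0) (stage d) _ _ _ h hd hh).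
- by rewrite expr0n mulr0 pi0.
- by move=> f g pf pg; rewrite sqrDxx mulrDr piD pf pg addr0.
move=> k v /andP[k0 kd] vd.
have := @pi_Sq _ k.*2 (omit a * v ^+ 2); rewrite double_gt0 => /(_ k0).
rewrite Sq_block pi_sum (bigD1 set0) /=; last by rewrite sub0set cards0 subn0 odd_double.
rewrite big1 => [|R /andP[/and3P[RS Rk oR] R0]].
  by rewrite addr0 setD0 cards0 subn0 doubleK /xs big_set0 mul1r.
have cR : (#|[set~ a] :\: R| + #|R| = 5)%N.
  by have := cardsID R [set~ a]; rewrite (setIidPr RS) card_omit addnC.
have R1 : (0 < #|R|)%N by rewrite card_gt0.
apply: (@pi_weight d _ _ (#|R| + (stage d - k + (k.*2 - #|R|)./2))%N).
- by rewrite -(ltn_add2r #|R|) cR -[X in (X < _)%N]addn0 ltn_add2l.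
- by apply: dhomogM; [apply: xs_homog | apply: Sq_homog].
by rewrite stageS; apply: weight_count cR Rk kd oR.
Qed.

Lemma Sq1_xs S : Sq 1 (xs S) = \sum_(i in S) 'X_i * xs S.
Proof.
rewrite Sq_xs (eq_bigl (mem [set [set i] | i in S])).
  rewrite big_imset; last by move=> i j _ _ /set1_inj.
  by apply: eq_bigr => i iS; rewrite xs1 [xs S](xs_setD1 iS); ring.
move=> R; apply/andP/imsetP => [[RS /cards1P[i E]]|[i iS ->]].
  by exists i; rewrite // -sub1set -E.
by rewrite sub1set cards1.
Qed.

Lemma Sq1_block S h : Sq 1 (xs S * h ^+ 2) = \sum_(i in S) 'X_i * xs S * h ^+ 2.
Proof.
by rewrite Sq_cartan !big_ord_recl big_ord0 addr0 subn0 Sq0 Sq_sqr mulr0 add0r Sq0 Sq1_xs mulr_suml.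
Qed.

Lemma omit_mulX i v : omit i * ('X_i * v) ^+ 2 = 'X_i * xs [set: I] * v ^+ 2.
Proof.
rewrite /omit (xs_setD1 (in_setT i)) (_ : [set: I] :\ i = [set~ i]); first by ring.
by apply/setP=> j; rewrite !inE andbT.
Qed.

Lemma pi_omit_sum v : \sum_i pi (omit i * ('X_i * v) ^+ 2) = 0.
Proof.
transitivity (pi (Sq 1 (xs [set: I] * v ^+ 2))); last exact: pi_Sq.
rewrite Sq1_block pi_sum; apply: eq_big => [i|i _]; first by rewrite inE.
by rewrite omit_mulX.
Qed.

Fixpoint tower o g : P := if o is a :: o' then omit a * tower o' g ^+ 2 else g.

Lemma tower_cat o p g : tower (o ++ p) g = tower o (tower p g).
Proof. by elim: o => //= a o ->. Qed.

Lemma towerD o f g : tower o (f + g) = tower o f + tower o g.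
Proof. by elim: o => //= a o ->; rewrite sqrDxx mulrDr. Qed.

Lemma tower0 o : tower o 0 = 0.
Proof. by elim: o => //= a o ->; rewrite expr0n mulr0. Qed.

Lemma tower_sum o (J : Type) (r : seq J) (p : pred J) (F : J -> P) :
  tower o (\sum_(i <- r | p i) F i) = \sum_(i <- r | p i) tower o (F i).
Proof. by elim/big_rec2: _ => [|i x y _ <-]; rewrite ?tower0 ?towerD. Qed.

Lemma tower_homog s o g : g \is (stage s).-homog -> tower o g \is (stage (size o + s)).-homog.
Proof.
move=> gs; elim: o => //= a o IH; rewrite stageS; apply: dhomogM; first exact: omit_homog.
exact: sqr_homog.
Qed.

Lemma pi_tower_hit s o g : g \is (stage s).-homog -> hit g -> pi (tower o g) = 0.
Proof.
move=> gs gh; elim: o => [|a o IH]; first exact/pi_eq0.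
by apply: (pi_omit_hit a (tower_homog o gs)); apply/pi_eq0.
Qed.

Lemma pi_tower_eq s o f g : f \is (stage s).-homog -> g \is (stage s).-homog ->
  pi f = pi g -> pi (tower o f) = pi (tower o g).
Proof.
move=> fs gs E; apply: addxx_eq; rewrite -piD -towerD.
by apply: (@pi_tower_hit s); [apply: rpredD | apply/pi_eq0; rewrite piD E addxx].
Qed.

(** The innermost floor omit(i) (x_i v)^2 equals x_i times x_1 ... x_6 v^2, whose second factor does
    not depend on i and becomes the new v. With one floor left, the sum is Sq^1 of x_1 ... x_6
    v^2. *)
Lemma pi_tower_nseq_sum j s v : v \is (stage s - 1).-homog ->
  \sum_i pi (tower (nseq j.+1 i) ('X_i * v)) = 0.
Proof.
elim: j s v => [|j IH] s v vs; first exact: pi_omit_sum.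
rewrite -[RHS](IH s.+1 (xs [set: I] * v ^+ 2)).
  apply: eq_bigr => i _; rewrite -[j.+2]addn1 nseqD tower_cat /= omit_mulX.
  by rewrite mulrA.
have -> : (stage s.+1 - 1 = 6 + (stage s - 1).*2)%N.
  by rewrite stageS; have := stage_gt s; lia.
by apply: dhomogM; [have := xs_homog [set: I]; rewrite cardsT card_ord | apply: sqr_homog].
Qed.

Lemma pi_tower_sum p j s v : v \is (stage s - 1).-homog ->
  \sum_i pi (tower (p ++ nseq j.+1 i) ('X_i * v)) = 0.
Proof.
move=> vs; have Xv i : 'X_i * v \is (stage s).-homog.
  have -> : stage s = (stage s - 1).+1 by have := stage_gt s; lia.
  exact: mulX_homog.
under eq_bigr => i _ do rewrite tower_cat.
rewrite -pi_sum -tower_sum; apply: (@pi_tower_hit (j.+1 + s)).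
  apply: rpred_sum => i _; have := tower_homog (nseq j.+1 i) (Xv i).
  by rewrite size_nseq.
by apply/pi_eq0; rewrite pi_sum (pi_tower_nseq_sum _ vs).
Qed.

(* Relations between towers coming from [v = x_K u^2] with [K] of size four. *)
Lemma pi_tower_exchange j a b s u : a != b -> u \is (stage s).-homog ->
  pi (tower (nseq j.+1 a ++ [:: b]) u) = pi (tower (nseq j.+1 b ++ [:: a]) u).
Proof.
move=> ab us; pose K := ~: [set a; b].
have cK : #|K| = 4%N by have := cardsC [set a; b]; rewrite cards2 ab card_ord -/K => -[].
pose v := xs K * u ^+ 2.
have vs : v \is (stage s.+1 - 1).-homog.
  have -> : (stage s.+1 - 1 = 4 + (stage s).*2)%N by rewrite stageS; lia.
  by apply: dhomogM; [have := xs_homog K; rewrite cK | apply: sqr_homog].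
have XK c d : c != d -> [set c; d] = [set a; b] -> 'X_c * v = omit d * u ^+ 2.
  move=> cd E; rewrite /v /omit (@xs_setD1 _ [set~ d] c) ?inE // mulrA.
  congr ('X_c * xs _ * _); apply/setP=> i; rewrite /K -E !inE negb_or.
  by rewrite andbC.
have ba : b != a by rewrite eq_sym.
pose F i := pi (tower (nseq j.+1 i) ('X_i * v)).
have : \sum_i F i = 0 by exact: pi_tower_nseq_sum vs.
have Fa : F a = pi (tower (nseq j.+1 a ++ [:: b]) u) by rewrite /F tower_cat (XK a b).
have Fb : F b = pi (tower (nseq j.+1 b ++ [:: a]) u) by rewrite /F tower_cat (XK b a) // setUC.
move=> S0; have E0 : F a + F b = 0; last by rewrite -Fa -Fb; apply: addxx_eq.
rewrite -[RHS]S0 (bigD1 a) // (bigD1 b) // big1 => [|i /andP[/= ia ib]].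
  by transitivity (F a + (F b + 0)); first by rewrite addr0.
rewrite /F {F Fa Fb S0}.
(* For i in K the product x_i v has only three odd exponents, so its tower is a hit; only the terms
   a and b survive. *)
have iK : i \in K by rewrite !inE negb_or ia.
have E : 'X_i * v = xs (K :\ i) * ('X_i * u) ^+ 2.
  by rewrite /v (xs_setD1 iK); ring.
have Xu : 'X_i * u \is (stage s).+1.-homog by apply: mulX_homog.
have cKi : #|K :\ i| = 3%N by have := cardsD1 i K; rewrite iK cK => -[].
apply: (@pi_tower_hit s.+1 (nseq j.+1 i)).
  have -> : stage s.+1 = (stage s.+1 - 1).+1 by have := stage_gt s.+1; lia.
  exact: mulX_homog.
apply/pi_eq0; rewrite E; apply: (@pi_weight s _ _ (stage s).+1) => //; rewrite cKi //.
by rewrite stageS; lia.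
Qed.

Definition same o p := forall s g, g \is (stage s).-homog -> pi (tower o g) = pi (tower p g).

Lemma same_sym o p : same o p -> same p o.
Proof. by move=> H s g gs; rewrite (H s). Qed.

Lemma same_trans p o q : same o p -> same p q -> same o q.
Proof. by move=> H1 H2 s g gs; rewrite (H1 s) // (H2 s). Qed.

Lemma same_cons a o p : size o = size p -> same o p -> same (a :: o) (a :: p).
Proof.
move=> sz H s g gs; apply: (@pi_tower_eq (size o + s) [:: a]); rewrite ?(H s) //.
  exact: tower_homog.
by rewrite sz; apply: tower_homog.
Qed.

Lemma same_exchange j a b o : same (nseq j.+1 a ++ b :: o) (nseq j.+1 b ++ a :: o).
Proof.
have [-> //|ab] := eqVneq a b; move=> s g gs.
have E c d : tower (nseq j.+1 c ++ d :: o) g = tower (nseq j.+1 c ++ [:: d]) (tower o g).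
  by rewrite -tower_cat -catA.
by rewrite !E; apply: (pi_tower_exchange j ab (tower_homog o gs)).
Qed.

Lemma same_perm o p : perm_eq o p -> same o p.
Proof.
have move1 a q r : same (a :: q ++ r) (q ++ a :: r).
  elim: q => [|b q IH]; first by [].
  apply: (@same_trans (b :: a :: q ++ r)); first exact: (same_exchange 0).
  by apply: same_cons => //; rewrite /= !size_cat /= addnS.
have swap q r t : same (q ++ r ++ t) (r ++ q ++ t).
  elim: q => [|a q IH] /=; first by [].
  apply: (@same_trans (a :: r ++ q ++ t)); last exact: move1.
  by apply: same_cons => //; rewrite !size_cat addnCA.
move=> op; apply: (catCA_perm_ind (P := fun p => same o p)) op _ => // q r t H.
exact: same_trans H _.
Qed.

(** After bringing one a and one b to the front this is the exchange with a repeated letter, aab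
    against bba. *)
Lemma same_replace a b o : a \in o -> b \in o -> same (a :: o) (b :: o).
Proof.
move=> ao bo; have [-> //|ab] := eqVneq a b.
have bo' : b \in rem a o by move: bo; rewrite (perm_mem (perm_to_rem ao)) inE eq_sym (negbTE ab).
pose r := rem b (rem a o).
have pr : perm_eq o [:: a, b & r].
  by apply: perm_trans (perm_to_rem ao) _; rewrite perm_cons perm_to_rem.
apply: (@same_trans [:: a, a, b & r]); first by apply: same_perm; rewrite perm_cons.
apply: (@same_trans [:: b, b, a & r]); first exact: (same_exchange 1).
apply: same_perm; rewrite perm_cons perm_sym; apply: perm_trans pr _.
by apply/permP => q /=; rewrite addnCA.
Qed.

(** Words without repetition are permutations of each other. Otherwise a repeated letter is split
    off each word, which keeps the sets of letters; the remainders agree by induction and the extra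
    letters are interchangeable. *)
Lemma same_set o p : size o = size p -> o =i p -> same o p.
Proof.
have [n] := ubnP (size o); elim: n o p => // n IH o p lt sz E.
have [uo|nuo] := boolP (uniq o).
  by apply: same_perm; apply: uniq_perm => //; rewrite -(eq_uniq sz E).
have nup : ~~ uniq p by rewrite -(eq_uniq sz E).
have split q : ~~ uniq q -> exists a r, a \in r /\ perm_eq q (a :: r).
  elim: q => //= a q IHq; rewrite negb_and negbK => /orP[aq|/IHq[b [r [br pr]]]].
    by exists a, q.
  exists b, (a :: r); split; first by rewrite inE br orbT.
  rewrite (perm_trans (_ : perm_eq (a :: q) (a :: b :: r))) ?perm_cons //.
  by apply/permP => t /=; rewrite addnCA.
have [a [r [ar pr]]] := split _ nuo; have [b [t [bt pt]]] := split _ nup.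
have Er : o =i r.
  by move=> x; rewrite (perm_mem pr) inE; case: eqP => // ->; rewrite ar.
have Et : p =i t.
  by move=> x; rewrite (perm_mem pt) inE; case: eqP => // ->; rewrite bt.
have szr : size r = size t.
  by have := perm_size pr; have := perm_size pt; rewrite sz => -> [].
have Ert : r =i t by move=> x; rewrite -Er E Et.
have ltr : (size r < n)%N by have := perm_size pr => /= E1; move: lt; rewrite E1.
apply: (same_trans (same_perm pr)).
apply: (@same_trans (a :: t)); first by apply: same_cons => //; apply: IH.
apply: (@same_trans (b :: t)); first by apply: same_replace; rewrite // -Ert.
by apply: same_sym; apply: same_perm.
Qed.

End Generators.

(** Adding or removing i is an involution without fixed points on the index sets, and paired terms
    cancel in characteristic 2. *)
Lemma sum_toggle (V : lmodType 'F_2) (I : finType) (i : I) (p : pred {set I}) (F : {set I} -> V) :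
  (forall S : {set I}, i \notin S -> p (i |: S) = p S) ->
  (forall S : {set I}, i \notin S -> F (i |: S) = F S) ->
  \sum_(S : {set I} | p S) F S = 0.
Proof.
move=> pE FE; rewrite (bigID (fun S : {set I} => i \in S)) /=.
rewrite (reindex_onto (fun S => i |: S) (fun S => S :\ i)) /=; last first.
  by move=> S /andP[_ iS]; rewrite setD1K.
rewrite (eq_bigl (fun S => p S && (i \notin S))) => [|S]; last first.
  rewrite setU11 andbT; have [iS|iS] := boolP (i \in S); last by rewrite pE // setU1K // eqxx.
  rewrite andbF; apply/negbTE; rewrite negb_and; apply/orP; right.
  by apply/eqP => /setP/(_ i); rewrite !inE eqxx iS.
rewrite (eq_bigr F); first exact: addxx.
by move=> S /andP[_ iS]; apply: FE.
Qed.

Lemma subset_setU1 (I : finType) (S T : {set I}) i : i \notin S -> (S \subset i |: T) = (S \subset T).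
Proof.
move=> iS; apply/subsetP/subsetP => H x xS; last by rewrite in_setU1 H ?orbT.
by have := H x xS; rewrite in_setU1 => /orP[/eqP xi|//]; rewrite xi (negbTE iS) in xS.
Qed.

(** * Classes indexed by subsets of the six indices, and their components *)

Section Stage.
Local Notation P := {mpoly 'F_2[6]}.
Local Notation Q := (cohit 6).
Local Notation pi := (@cohit_pi 6).
Local Notation I := 'I_6.
Implicit Types (f g h u v : P) (S R T : {set I}) (w : 'X_{1..6}) (o p : seq I) (a b i : I).

Variable d : nat.
Hypothesis d5 : (5 <= d)%N.

Let stage0 : stage 0 = 41%N. Proof. by []. Qed.

(** The padding letter belongs to T, so for T nonempty of at most d elements this is a word of
    length d with set of letters T. *)
Definition word T : seq I := enum T ++ nseq (d - size (enum T)) (head ord0 (enum T)).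

Lemma word_size T : (#|T| <= d)%N -> size (word T) = d.
Proof. by move=> Td; rewrite size_cat size_nseq -cardE subnKC. Qed.

Lemma word_mem T : T != set0 -> word T =i T.
Proof.
move=> T0 x; rewrite mem_cat mem_enum; have [//|xT] := boolP (x \in T).
case: (enum T) (mem_enum T) => [E|y s E].
  by case/set0Pn: T0 => y; rewrite -E.
by apply/negP => /nseqP[xy _]; move: xT; rewrite -E xy inE eqxx.
Qed.

Definition gen T g : Q := pi (tower (word T) g).

Lemma genD T f g : gen T (f + g) = gen T f + gen T g.
Proof. by rewrite /gen towerD piD. Qed.

Lemma gen_sum T (J : Type) (r : seq J) (p : pred J) (F : J -> P) :
  gen T (\sum_(i <- r | p i) F i) = \sum_(i <- r | p i) gen T (F i).
Proof. by rewrite /gen tower_sum pi_sum. Qed.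

Lemma gen_hit T g : g \is 41.-homog -> hit g -> gen T g = 0.
Proof. exact: (@pi_tower_hit 0). Qed.

Lemma gen_word o T g : size o = d -> o =i T -> T != set0 -> g \is 41.-homog ->
  pi (tower o g) = gen T g.
Proof.
move=> so oT T0 g41; apply: (same_set _ _ (s := 0)) => //; last first.
  by move=> x; rewrite oT word_mem.
rewrite so word_size // -so cardE; apply: uniq_leq_size (enum_uniq _) _ => x.
by rewrite mem_enum -oT.
Qed.

(** A word of length d - 1 with letters S is completed by a last letter running over all six
    indices; #|S| < d leaves room for it. For S empty the words i ... i are used. *)
Lemma gen_rel S u : (#|S| < d)%N -> u \is 40.-homog ->
  \sum_i gen (i |: S) ('X_i * u) = 0.
Proof.
move=> Sd u40; have Xu i : 'X_i * u \is 41.-homog by apply: mulX_homog.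
have ne i : i |: S != set0 by apply/set0Pn; exists i; rewrite setU11.
have [->|S0] := eqVneq S set0.
  rewrite -[RHS](@pi_tower_sum [::] d.-1 0 u) //; apply: eq_bigr => i _.
  rewrite -(@gen_word (nseq d.-1.+1 i)) ?setU0 // ?size_nseq; first lia.
    by move=> x; rewrite mem_nseq inE.
  by apply/set0Pn; exists i; rewrite inE.
pose p := enum S ++ nseq (d.-1 - #|S|) (head ord0 (enum S)).
have pm : p =i S.
  move=> x; rewrite mem_cat mem_enum; have [//|xT] := boolP (x \in S).
  case: (enum S) (mem_enum S) => [E|y s E]; first by case/set0Pn: S0 => y; rewrite -E.
  by apply/negP => /nseqP[xy _]; move: xT; rewrite -E xy inE eqxx.
rewrite -[RHS](@pi_tower_sum p 0 0 u) //; apply: eq_bigr => i _.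
rewrite -(@gen_word (p ++ [:: i])) //.
  have d0 : (0 < d)%N by apply: leq_trans d5.
  rewrite !size_cat size_nseq -cardE subnKC /=; first by rewrite addn1 prednK.
  by rewrite -ltnS prednK.
by move=> x; rewrite mem_cat inE pm in_setU1 orbC.
Qed.

Definition lsum S : P := \sum_(i in S) 'X_i.

Lemma lsum_linform S : linform (lsum S).
Proof. by apply: linform_sum => i _; apply: linformX. Qed.

Lemma lsum_homog S : lsum S \is 1.-homog.
Proof. by case: (lsum_linform S). Qed.

Lemma lsum_mul_homog S u e : u \is e.-homog -> lsum S * u \is e.+1.-homog.
Proof. by move=> /(dhomogM (lsum_homog S)). Qed.

Lemma lsumU1 S a : a \notin S -> lsum (a |: S) = 'X_a + lsum S.
Proof. by move=> aS; rewrite /lsum big_setU1. Qed.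

Lemma gen_lsum T S u : gen T (lsum S * u) = \sum_(i in S) gen T ('X_i * u).
Proof. by rewrite /lsum mulr_suml gen_sum. Qed.

Lemma gen_Sq1 T S v : v \is 39.-homog -> gen T (lsum S * (lsum S * v + Sq 1 v)) = 0.
Proof.
move=> v39; have [_ lS] := lsum_linform S.
have E : lsum S * (lsum S * v + Sq 1 v) = Sq 1 (lsum S * v).
  by rewrite lS Sq0; ring.
rewrite E; apply: gen_hit; last exact: hit_Sq.
by have := Sq_homog 1 (lsum_mul_homog S v39).
Qed.

(** For d > 5 the relation of the complement of b would force this value for the class of the full
    set at x_b u. *)
Definition zgen b u := gen [set~ b] (lsum [set~ b] * u).

Lemma zgenD b u v : zgen b (u + v) = zgen b u + zgen b v.
Proof. by rewrite /zgen mulrDr genD. Qed.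

Lemma lsumC1 a b : a != b -> lsum [set~ a] = 'X_b + lsum (~: [set a; b]).
Proof.
move=> ab; rewrite -lsumU1; last by rewrite !inE eqxx orbT.
congr lsum; apply/setP => i; rewrite !inE negb_or; case: (eqVneq i b) => [->|] //=.
by rewrite eq_sym ab.
by rewrite andbT.
Qed.

Lemma gen_rel4 a b u : a != b -> u \is 40.-homog ->
  gen (~: [set a; b]) (lsum (~: [set a; b]) * u) =
  gen [set~ b] ('X_a * u) + gen [set~ a] ('X_b * u).
Proof.
move=> ab u40; set T := ~: [set a; b].
have cT : #|T| = 4%N by have := cardsC [set a; b]; rewrite cards2 ab card_ord -/T => -[].
have TE c e : c != e -> [set c; e] = [set a; b] -> c |: T = [set~ e].
  move=> ce E; rewrite /T -E; apply/setP=> i; rewrite !inE negb_or.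
  by case: (eqVneq i c) => [->|] //=; rewrite ce.
have := @gen_rel T u; rewrite cT => /(_ d5 u40).
rewrite (bigD1 a) // (bigD1 b) ?(eq_sym b) //= (TE a b) // (TE b a) 1?eq_sym 1?setUC // addrA.
move=> E; apply/esym/addxx_eq; rewrite -[RHS]E; congr (_ + _).
rewrite gen_lsum; apply: eq_big => [i|i iT]; first by rewrite !inE negb_or.
by congr gen; apply/esym/setUidPr; rewrite sub1set.
Qed.

(** This makes the class of the full set independent of the variable factored out. All the terms are
    compared through elements l (l v + Sq^1 v) = Sq^1 (l v), which are hits, for three linear forms
    l. *)
Lemma zgen_comm a b v : v \is 39.-homog -> zgen a ('X_b * v) = zgen b ('X_a * v).
Proof.
move=> v39; have [-> //|ab] := eqVneq a b; apply: addxx_eq.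
pose T := ~: [set a; b]; pose l := lsum T; pose la := lsum [set~ a]; pose lb := lsum [set~ b].
have laE : la = 'X_b + l by apply: lsumC1.
have lbE : lb = 'X_a + l by rewrite /l /T setUC; apply: lsumC1; rewrite eq_sym.
(* Here l u = Sq^1 (l v), while x_b v and x_a v differ from u by la v + Sq^1 v and lb v + Sq^1 v,
   which become hits after multiplication by la and lb. *)
pose u := l * v + Sq 1 v.
have u40 : u \is 40.-homog.
  by apply: rpredD; [apply: lsum_mul_homog | have := Sq_homog 1 v39].
have H1 := gen_Sq1 [set~ a] [set~ a] v39; have H2 := gen_Sq1 [set~ b] [set~ b] v39.
have H3 := gen_Sq1 T T v39; have H4 := gen_Sq1 [set~ a] T v39.
have H5 := gen_Sq1 [set~ b] T v39.
rewrite -/l -/u -/la -/lb in H1 H2 H3 H4 H5.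
rewrite (gen_rel4 ab u40) in H3.
have E1 : gen [set~ a] (la * u) + gen [set~ b] (lb * u) = 0.
  by rewrite laE lbE !mulrDl !genD H4 H5 !addr0 addrC H3.
have E2 : la * ('X_b * v) = la * u + la * (la * v + Sq 1 v).
  have c2 : l * v + l * v = 0 by apply: addxx.
  have c3 : Sq 1 v + Sq 1 v = 0 by apply: addxx.
  have X : 'X_b * v = u + (la * v + Sq 1 v).
    by rewrite /u addrACA c3 addr0 laE mulrDl addrCA c2 addr0.
  by rewrite -mulrDr -X.
have E3 : lb * ('X_a * v) = lb * u + lb * (lb * v + Sq 1 v).
  have c2 : l * v + l * v = 0 by apply: addxx.
  have c3 : Sq 1 v + Sq 1 v = 0 by apply: addxx.
  have X : 'X_a * v = u + (lb * v + Sq 1 v).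
    by rewrite /u addrACA c3 addr0 lbE mulrDl addrCA c2 addr0.
  by rewrite -mulrDr -X.
by rewrite /zgen -/la -/lb E2 E3 !genD H1 H2 !addr0 E1.
Qed.

(* The generator attached to the full set: for [d = 5] no tower omits all six
   variables, and [zfull] takes its place. *)
Definition zfull : P -> Q :=
  mlin (fun w => if [pick b | (0 < w b)%N] is Some b then zgen b 'X_[w - U_(b)] else 0).

HB.instance Definition _ := GRing.Linear.on zfull.

Lemma zfullD f g : zfull (f + g) = zfull f + zfull g.
Proof. exact: linearD. Qed.

Lemma zfull_sum (J : Type) (r : seq J) (p : pred J) (F : J -> P) :
  zfull (\sum_(i <- r | p i) F i) = \sum_(i <- r | p i) zfull (F i).
Proof. exact: linear_sum. Qed.

Lemma zgen0 b : zgen b 0 = 0.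
Proof. by rewrite /zgen mulr0 /gen tower0 pi0. Qed.

Lemma zfullX a u : u \is 40.-homog -> zfull ('X_a * u) = zgen a u.
Proof.
move=> u40; apply: (@homog_closed_ind _ (fun u => zfull ('X_a * u) = zgen a u) 40 _ _ _ u u40).
- by rewrite mulr0 zgen0; apply: linear0.
- by move=> f g Hf Hg; rewrite mulrDr zfullD zgenD Hf Hg.
move=> w w40; rewrite -mpolyXD /zfull mlinX.
case: pickP => [b|/(_ a)]; last by rewrite mnmDE mnm1E eqxx.
have [-> _|ba] := eqVneq b a; first by rewrite addmC addmK.
rewrite mnmDE mnm1E eq_sym (negbTE ba) add0n => wb.
have [w' wE] : exists w', w = (U_(b) + w')%MM.
  by exists (w - U_(b))%MM; rewrite addmC submK // lep1mP -lt0n.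
move: w40; rewrite wE mdegD mdeg1 addmA [(U_(a) + _)%MM]addmC -addmA [(U_(b) + (_ + _))%MM]addmC addmK.
rewrite !mpolyXD => -[w40]; apply: zgen_comm; rewrite dhomogX /=.
exact/eqP.
Qed.

Definition cls T g : Q :=
  if T == setT then zfull g else if T == set0 then 0 else gen T g.

Lemma clsD T f g : cls T (f + g) = cls T f + cls T g.
Proof.
by rewrite /cls; case: eqP => _; [exact: zfullD | case: eqP => _; [rewrite addr0 | exact: genD]].
Qed.

Lemma cls_sum T (J : Type) (r : seq J) (p : pred J) (F : J -> P) :
  cls T (\sum_(i <- r | p i) F i) = \sum_(i <- r | p i) cls T (F i).
Proof.
elim/big_rec2: _ => [|i x y _ <-]; last exact: clsD.
rewrite /cls; case: eqP => _; first exact: linear0.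
by case: eqP => _ //; rewrite /gen tower0 pi0.
Qed.

Lemma cls0 T : cls T 0 = 0.
Proof. by have := @cls_sum T void [::] xpredT (fun _ => 0); rewrite !big_nil. Qed.

Lemma setT_cards T : (T == setT) = (5 < #|T|)%N.
Proof.
by have := eqEcard T setT; rewrite subsetT cardsT card_ord.
Qed.

Lemma cards5 S : #|S| = 5%N -> exists b, S = [set~ b].
Proof.
move=> c5; have : #|~: S| == 1%N.
  by have := cardsC S; rewrite c5 card_ord => E; apply/eqP/(@addnI 5); rewrite E.
by move=> /cards1P[b E]; exists b; rewrite -E setCK.
Qed.

Lemma setU1T i S : (i |: S == setT) = (S == setT) || (S == [set~ i]).
Proof.
apply/eqP/orP => [E|[/eqP->|/eqP->]]; last by rewrite setUCr.
  have [iS|iS] := boolP (i \in S); [left|right].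
    by rewrite -E; apply/eqP/esym/setUidPr; rewrite sub1set.
  apply/eqP/setP => j; have := in_setT j; rewrite -E !inE.
  by case: eqP => [->|_] //=; rewrite (negbTE iS).
by rewrite setUT.
Qed.

Lemma cls_rel_lt S u : S != setT -> u \is 40.-homog -> \sum_i cls (i |: S) ('X_i * u) = 0.
Proof.
move=> ST u40; have U0 i : (i |: S == set0) = false.
  by apply/negbTE/set0Pn; exists i; rewrite setU11.
have [b Sb|nS] := pickP (fun b => S == [set~ b]).
  have bS : b \notin S by rewrite (eqP Sb) !inE eqxx.
  have E : \sum_(i | i != b) cls (i |: S) ('X_i * u) = zgen b u.
    rewrite /zgen gen_lsum; apply: eq_big => [i|i ib]; first by rewrite !inE.
    have iS : i \in S by rewrite (eqP Sb) !inE.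
    have iSE : i |: S = S by apply/setUidPr; rewrite sub1set.
    by have := U0 i; rewrite iSE /cls (negbTE ST) => ->; rewrite (eqP Sb).
  by rewrite (bigD1 b) //= E {1}/cls setU1T Sb orbT zfullX // addxx.
rewrite -[RHS](@gen_rel S u) //.
  by apply: eq_bigr => i _; rewrite /cls setU1T (negbTE ST) nS U0.
apply: leq_trans d5; rewrite ltnNge; apply/negP => c4.
have c5 : #|S| = 5%N.
  apply/eqP; rewrite eqn_leq c4 andbT leqNgt -setT_cards; exact: ST.
by have [b E] := cards5 c5; have := nS b; rewrite E eqxx.
Qed.

Lemma sum_setU1 (F : {set I} -> Q) S i : i \notin S ->
  \sum_(T : {set I} | S \subset T) F (i |: T) = 0.
Proof.
move=> iS; apply: (@sum_toggle _ _ i) => T iT; last by rewrite setUA setUid.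
exact: subset_setU1.
Qed.

(** For the full set, add the relations of all subsets: for each i the terms cancel in pairs, so the
    total is zero, and so are all the summands but the one wanted. *)
Lemma cls_rel S u : u \is 40.-homog -> \sum_i cls (i |: S) ('X_i * u) = 0.
Proof.
move=> u40; have [->|ST] := eqVneq S setT; last exact: cls_rel_lt.
have : \sum_(T : {set I}) \sum_i cls (i |: T) ('X_i * u) = 0.
  rewrite exchange_big big1 // => i _.
  rewrite -[RHS](@sum_setU1 (fun T => cls T ('X_i * u)) set0 i) ?inE //.
  by apply: eq_bigl => T; rewrite sub0set.
by rewrite (bigD1 setT) //= [X in _ + X]big1 ?addr0 // => T TT; apply: cls_rel_lt.
Qed.

Lemma zfull_lsum u : u \is 40.-homog -> zfull (lsum setT * u) = 0.
Proof.
move=> u40; rewrite -[RHS](@cls_rel setT u) // /lsum mulr_suml zfull_sum.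
by apply: eq_big => [i|i _]; [rewrite inE | rewrite setUT /cls eqxx].
Qed.

Lemma lsumT a : lsum setT = 'X_a + lsum [set~ a].
Proof. by rewrite -lsumU1 ?setUCr // !inE eqxx. Qed.

(** With A = Sq^(k+1) w' and B = Sq^k w', the square of x_a w' is x_a (A + x_a B). Since multiples
    of the sum of all variables are killed, the inner x_a may be replaced by the sum l of the other
    five, and l (A + l B) = Sq^(k+1) (l w') is a hit. *)
Lemma zfull_hit g : g \is 41.-homog -> hit g -> zfull g = 0.
Proof.
apply: (@hit_homog_ind _ (fun g => zfull g = 0) 41).
- exact: linear0.
- by move=> f h Hf Hh; rewrite zfullD Hf Hh addr0.
move=> k v /andP[k0 kd] vd.
apply: (@homog_closed_ind _ (fun v => zfull (Sq k v) = 0) (41 - k) _ _ _ v vd).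
- by cbv beta; rewrite [Sq _ _]linear0; apply: linear0.
- move=> f h; cbv beta => Hf Hh; rewrite (SqD k f h).
  exact: etrans (zfullD _ _) (etrans (congr2 +%R Hf Hh) (addr0 0)).
move=> w wd; have [w0|/eqP w0] := eqVneq w 0%MM.
  rewrite (@Sq_big _ k 0); first exact: linear0.
    by rewrite w0 mpolyX0 dhomog1.
  by [].
have [a wa] : exists a, (0 < w a)%N.
  apply/existsP; apply: contra_notT w0 => /existsPn H.
  by apply/mnmP=> i; rewrite mnm0E; apply/eqP; have := H i; rewrite lt0n negbK.
have [w' wE] : exists w', w = (U_(a) + w')%MM.
  by exists (w - U_(a))%MM; rewrite addmC submK // lep1mP -lt0n.
case: k k0 kd wd {vd} => // k _ kd; rewrite wE mdegD mdeg1 mpolyXD => wd.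
have w'd : ('X_[w'] : P) \is (mdeg w').-homog by rewrite dhomogX.
set B := Sq k 'X_[w']; set A := Sq k.+1 'X_[w'].
have B39 : B \is 39.-homog.
  by have := Sq_homog k w'd; rewrite (_ : (mdeg w' + k = 39)%N) //; lia.
have A40 : A \is 40.-homog.
  by have := Sq_homog k.+1 w'd; rewrite (_ : (mdeg w' + k.+1 = 40)%N) //; lia.
have E : Sq k.+1 ('X_a * 'X_[w']) = 'X_a * (A + 'X_a * B) by rewrite Sq_mulX /A /B; ring.
have XB : 'X_a * B \is 40.-homog by apply: mulX_homog.
rewrite E zfullX ?rpredD // zgenD.
have lB : zgen a (lsum setT * B) = 0.
  rewrite -zfullX; last exact: lsum_mul_homog.
  by rewrite mulrCA; apply: zfull_lsum.
have -> : zgen a ('X_a * B) = zgen a (lsum [set~ a] * B).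
  by apply: addxx_eq; rewrite -zgenD -mulrDl -lsumT.
rewrite -zgenD /zgen; have [_ lS] := lsum_linform [set~ a].
have -> : lsum [set~ a] * (A + lsum [set~ a] * B) = Sq k.+1 (lsum [set~ a] * 'X_[w']).
  by rewrite lS /A /B; ring.
apply: gen_hit; last exact: hit_Sq.
have := Sq_homog k.+1 (lsum_mul_homog [set~ a] w'd).
by rewrite (_ : ((mdeg w').+1 + k.+1 = 41)%N) //; lia.
Qed.

Lemma cls_hit T g : g \is 41.-homog -> hit g -> cls T g = 0.
Proof.
move=> g41 gh; rewrite /cls; case: eqP => _; first exact: zfull_hit.
by case: eqP => _ //; apply: gen_hit.
Qed.

(* The component of the quotient carried by the hyperplane [lsum S = 0]. *)
Definition comp S g : Q := \sum_(T : {set I} | S \subset T) cls T g.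

Lemma compD S f g : comp S (f + g) = comp S f + comp S g.
Proof. by rewrite /comp -big_split; apply: eq_bigr => T _; apply: clsD. Qed.

Lemma comp0 S : comp S 0 = 0.
Proof. by rewrite /comp big1 // => T _; apply: cls0. Qed.

Lemma comp_hit S g : g \is 41.-homog -> hit g -> comp S g = 0.
Proof. by move=> g41 gh; rewrite /comp big1 // => T _; apply: cls_hit. Qed.

(** Sum [cls_rel] over the sets T containing S. If i is outside S, toggling i pairs the terms; if i
    is in S, then T already contains it and the term is the class of T at x_i u. *)
Lemma comp_lsum S u : u \is 40.-homog -> comp S (lsum S * u) = 0.
Proof.
move=> u40.
have : \sum_(T : {set I} | S \subset T) \sum_i cls (i |: T) ('X_i * u) = 0.
  by rewrite big1 // => T _; apply: cls_rel.
rewrite exchange_big (bigID (mem S)) /= [X in _ + X]big1 ?addr0 => [|i iS]; last first.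
  exact: sum_setU1 (fun T => cls T ('X_i * u)) _ _ iS.
rewrite exchange_big => E; rewrite -[RHS]E; apply: eq_bigr => T ST.
rewrite /lsum mulr_suml cls_sum; apply: eq_bigr => i iS.
by congr cls; apply/esym/setUidPr; rewrite sub1set (subsetP ST).
Qed.

(** Moebius inversion modulo 2: the number of sets between T and a strictly larger R is even. *)
Lemma cls_comp T g : cls T g = \sum_(S : {set I} | T \subset S) comp S g.
Proof.
rewrite /comp (exchange_big_dep (fun R : {set I} => T \subset R)) /=; last first.
  by move=> S R TS SR; apply: subset_trans SR.
rewrite (bigD1 T) //= (big_pred1 T) => [|S]; last by rewrite /= eqEsubset andbC.
rewrite big1 ?addr0 // => R /andP[TR RT].
have [i iR iT] : exists2 i, i \in R & i \notin T.
  by apply/subsetPn; apply: contra RT => RT; rewrite eqEsubset RT.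
apply: (@sum_toggle _ _ i) => // S iS.
rewrite subUset sub1set iR; congr (_ && _).
by apply: subset_setU1.
Qed.

Definition spanned (q : Q) := exists2 g : {set I} -> P,
  (forall S, g S \is 41.-homog) & q = \sum_(S : {set I} | S != set0) comp S (g S).

Lemma spanned0 : spanned 0.
Proof.
exists (fun _ => 0) => [S|]; first exact: dhomog0.
by rewrite big1 // => S _; apply: comp0.
Qed.

Lemma spannedD (x y : Q) : spanned x -> spanned y -> spanned (x + y).
Proof.
move=> [f f41 ->] [g g41 ->]; exists (fun S => f S + g S) => [S|]; first exact: rpredD.
by rewrite -big_split; apply: eq_bigr => S _; rewrite compD.
Qed.

Lemma spanned_cls T g : T != set0 -> g \is 41.-homog -> spanned (cls T g).
Proof.
move=> T0 g41; exists (fun S => if T \subset S then g else 0) => [S|].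
  by case: (T \subset S); rewrite ?dhomog0.
rewrite cls_comp [RHS]big_mkcond [LHS]big_mkcond; apply: eq_bigr => S _.
have [->|S0] := eqVneq S set0; first by rewrite subset0 (negbTE T0).
by case: (T \subset S); rewrite ?comp0.
Qed.

Lemma homog41_ind (p : P -> Prop) : p 0 -> (forall f g, p f -> p g -> p (f + g)) ->
  (forall a u, u \is 40.-homog -> p ('X_a * u)) -> forall g, g \is 41.-homog -> p g.
Proof.
move=> p0 pD pX g g41; apply: (@homog_closed_ind _ p 41 _ _ _ g g41) => // w wd.
have w0 : w <> 0%MM by move=> w0; move: wd; rewrite w0 mdeg0.
have [b wb] : exists b, (0 < w b)%N.
  apply/existsP; apply: contra_notT w0 => /existsPn H.
  by apply/mnmP=> i; rewrite mnm0E; apply/eqP; have := H i; rewrite lt0n negbK.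
have [w' wE] : exists w', w = (U_(b) + w')%MM.
  by exists (w - U_(b))%MM; rewrite addmC submK // lep1mP -lt0n.
move: wd; rewrite wE mdegD mdeg1 mpolyXD => -[w'd].
by apply: pX; rewrite dhomogX /=; apply/eqP.
Qed.

Lemma spanned_tower o g : size o = d -> g \is 41.-homog -> spanned (pi (tower o g)).
Proof.
move=> so g41; pose T := [set x in o].
have oT : o =i T by move=> x; rewrite inE.
have T0 : T != set0.
  case: o so @T oT => [d0|a o _ T _]; first by move: d5; rewrite -d0.
  by apply/set0Pn; exists a; rewrite inE mem_head.
rewrite (gen_word so oT T0 g41).
have [TT|nT] := eqVneq T setT; last first.
  have -> : gen T g = cls T g by rewrite /cls (negbTE nT) (negbTE T0).
  exact: spanned_cls.
(* A word with all six letters has length at least six, so the relation of a five-letter set is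
   available and identifies its class with [zfull]. *)
have d6 : (5 < d)%N.
  have : (#|T| <= size o)%N.
    by rewrite cardE; apply: uniq_leq_size (enum_uniq _) _ => x; rewrite mem_enum -oT.
  by rewrite TT cardsT card_ord so.
suff -> : gen T g = cls T g by exact: spanned_cls.
rewrite TT /cls eqxx; move: g g41; apply: homog41_ind => [|f h Hf Hh|b u u40].
- have z0 : zfull 0 = 0 by apply: linear0.
  by rewrite z0 /gen tower0 pi0.
- by rewrite genD zfullD Hf Hh.
rewrite zfullX //; have := @gen_rel [set~ b] u.
rewrite card_omit => /(_ d6 u40); rewrite (bigD1 b) //= setUCr => /addxx_eq ->.
rewrite /zgen gen_lsum; apply: eq_big => [i|i ib]; first by rewrite !inE.
by congr gen; apply/setUidPr; rewrite sub1set !inE.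
Qed.

Lemma pi_tower_span e f : f \is (stage e).-homog ->
  exists2 s : seq (seq I * P), all (fun x => (size x.1 == e) && (x.2 \is 41.-homog)) s
    & pi f = \sum_(x <- s) pi (tower x.1 x.2).
Proof.
elim: e f => [|e IH] f fe.
  by exists [:: ([::], f)]; rewrite /= ?fe // big_seq1.
apply: (@homog_closed_ind _ (fun f => exists2 s : seq (seq I * P),
  all (fun x => (size x.1 == e.+1) && (x.2 \is 41.-homog)) s
    & pi f = \sum_(x <- s) pi (tower x.1 x.2)) _ _ _ _ f fe).
- by exists [::]; rewrite // big_nil pi0.
- move=> g h [s sP gE] [r rP hE]; exists (s ++ r); first by rewrite all_cat sP.
  by rewrite big_cat piD gE hE.
move=> w wd; rewrite monomial_block; have := mdeg_block w; rewrite wd.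
set S := oddset w => E.
have [S5|S5] := ltnP #|S| 5.
  exists [::]; rewrite // big_nil; apply: (@pi_weight e _ _ (mdeg (halfm w))) => //.
  by rewrite dhomogX.
have c5 : #|S| = 5%N.
  have := max_card S; rewrite card_ord => S6.
  by move: E; rewrite stageS; lia.
have [a Sa] := cards5 c5.
have hd : ('X_[halfm w] : P) \is (stage e).-homog.
  by rewrite dhomogX /=; apply/eqP; move: E; rewrite c5 stageS; lia.
have [s sP hE] := IH _ hd.
exists [seq (a :: x.1, x.2) | x <- s].
  by rewrite all_map; apply: sub_all sP => x /=; rewrite eqSS.
rewrite big_map Sa -pi_sum -[LHS]/(pi (tower [:: a] 'X_[halfm w])).
rewrite (@pi_tower_eq e [:: a] _ (\sum_(x <- s) tower x.1 x.2)) //; last by rewrite pi_sum.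
  by rewrite tower_sum.
rewrite big_seq; apply: rpred_sum => x /(allP sP)/andP[/eqP sx x41].
by have := @tower_homog 0 x.1 x.2 x41; rewrite sx addn0.
Qed.

Lemma spanned_stage f : f \is (stage d).-homog -> spanned (pi f).
Proof.
move=> /pi_tower_span[s sP ->]; rewrite big_seq; apply: big_ind => [||x /(allP sP)/andP[/eqP sx x41]].
- exact: spanned0.
- exact: spannedD.
exact: spanned_tower.
Qed.

End Stage.

Lemma F2_cases (c : 'F_2) : c = 0 \/ c = 1.
Proof. by case: c => -[|[|//]] i; [left|right]; apply/val_inj. Qed.

Lemma has_dimension_fin (V : lmodType 'F_2) (U : V -> Prop) (K : finType) (b : K -> V) :
  (forall k, U (b k)) ->
  (forall v, U v -> exists c : K -> 'F_2, v = \sum_k c k *: b k) ->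
  (forall c : K -> 'F_2, \sum_k c k *: b k = 0 -> forall k, c k = 0) ->
  has_dimension 'F_2 U #|K|.
Proof.
move=> bU bS bI; exists (fun i => b (enum_val i)) => // v /bS[c vE].
have reidx (F : K -> V) : \sum_k F k = \sum_(i < #|K|) F (enum_val i).
  by rewrite (reindex (@enum_val K K)) //; apply: onW_bij; apply: enum_val_bij.
exists [ffun i => c (enum_val i)]; split=> [|c' vE'].
  by rewrite vE reidx; apply: eq_bigr => i _; rewrite ffunE.
apply/ffunP=> i; rewrite ffunE; pose e k := c k - c' (enum_rank k).
have e0 : \sum_k e k *: b k = 0.
  rewrite (eq_bigr (fun k => c k *: b k - c' (enum_rank k) *: b k)); last first.
    by move=> k _; rewrite scalerBl.
  rewrite sumrB -vE (reidx (fun k => c' (enum_rank k) *: b k)).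
  apply/eqP; rewrite subr_eq0 {1}vE'; apply/eqP/eq_bigr => j _.
  by rewrite enum_valK.
have := bI e e0 (enum_val i); rewrite /e enum_valK.
by move/eqP; rewrite subr_eq0 => /eqP.
Qed.

(** * Restriction to the hyperplanes *)

Section Restriction.
Local Notation P6 := {mpoly 'F_2[6]}.
Local Notation P5 := {mpoly 'F_2[5]}.
Local Notation I := 'I_6.
Implicit Types (S R T : {set I}).

Definition pivot S : I := odflt ord0 [pick i in S].

Lemma pivot_in S : S != set0 -> pivot S \in S.
Proof. by rewrite /pivot; case: pickP => [//|H] /set0Pn[i iS]; have := H i; rewrite /= iS. Qed.

(** The equation of the hyperplane is solved for one of its variables, the pivot; [embed] is the
    section that avoids the pivot. *)
Definition rho S : 6.-tuple P5 := [tuple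
  if unlift (pivot S) i is Some j then 'X_j else \sum_(j | lift (pivot S) j \in S) 'X_j | i < 6].

Definition embed S : 5.-tuple P6 := [tuple 'X_(lift (pivot S) j) | j < 5].

Lemma rho_linform S i : linform (tnth (rho S) i).
Proof.
rewrite tnth_mktuple; case: unlift => [j|]; first exact: linformX.
by apply: linform_sum => j _; apply: linformX.
Qed.

Lemma embed_linform S j : linform (tnth (embed S) j).
Proof. by rewrite tnth_mktuple; apply: linformX. Qed.

Lemma rhoX S i : 'X_i \mPo rho S =
  if unlift (pivot S) i is Some j then 'X_j else \sum_(j | lift (pivot S) j \in S) 'X_j.
Proof. by rewrite comp_mpolyXU -tnth_nth tnth_mktuple. Qed.

Lemma rhoX_lift S j : 'X_(lift (pivot S) j) \mPo rho S = 'X_j.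
Proof. by rewrite rhoX liftK. Qed.

Lemma rhoX_pivot S : 'X_(pivot S) \mPo rho S = \sum_(j | lift (pivot S) j \in S) 'X_j.
Proof. by rewrite rhoX unlift_none. Qed.

Lemma embedX S j : 'X_j \mPo embed S = 'X_(lift (pivot S) j).
Proof. by rewrite comp_mpolyXU -tnth_nth tnth_mktuple. Qed.

Lemma comp_mpoly_sum n k (lq : n.-tuple {mpoly 'F_2[k]}) (J : Type) (r : seq J) (p : pred J)
    (F : J -> {mpoly 'F_2[n]}) :
  (\sum_(i <- r | p i) F i) \mPo lq = \sum_(i <- r | p i) (F i \mPo lq).
Proof. exact: linear_sum. Qed.

Lemma embedK S (g : P5) : (g \mPo embed S) \mPo rho S = g.
Proof.
elim/mpoly_mulX_ind: g => [|c f g Hf Hg|j f Hf].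
- by rewrite !comp_mpoly1.
- rewrite (comp_mpolyD (embed S) (c *: f) g) (comp_mpolyZ c f (embed S)).
  rewrite (comp_mpolyD (rho S) (c *: _) (g \mPo _)) (comp_mpolyZ c (f \mPo embed S) (rho S)).
  by congr (c *: _ + _); [apply: Hf | apply: Hg].
rewrite (comp_mpolyM (embed S) 'X_j f) (comp_mpolyM (rho S) ('X_j \mPo _) (f \mPo _)).
by rewrite embedX rhoX_lift; congr (_ * _); apply: Hf.
Qed.

Lemma sum_lift (V : zmodType) (s : I) (p : pred I) (F : I -> V) :
  \sum_(i | p i) F i = (if p s then F s else 0) + \sum_(j : 'I_5 | p (lift s j)) F (lift s j).
Proof.
rewrite big_mkcond (bigD1_ord s) //=; congr (_ + _).
by rewrite [RHS]big_mkcond.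
Qed.

Lemma lsum_lift S : S != set0 ->
  lsum S = 'X_(pivot S) + \sum_(j | lift (pivot S) j \in S) 'X_(lift (pivot S) j).
Proof. by move=> S0; rewrite /lsum (sum_lift (pivot S)) pivot_in. Qed.

Lemma rho_lsum S : S != set0 -> lsum S \mPo rho S = 0.
Proof.
move=> S0; rewrite lsum_lift // comp_mpolyD rhoX_pivot comp_mpoly_sum.
rewrite [X in _ + X](eq_bigr (fun j => 'X_j)); first exact: addxx.
by move=> j _; apply: rhoX_lift.
Qed.

Lemma mul_congr (K : comNzRingType) (A : comAlgType K) (x y a b l u : A) (e : K) :
  x = a + e *: l -> y = b + l * u ->
  x * y = a * b + l * (a * u + e *: b + e *: (l * u)).
Proof.
move=> -> ->.
rewrite mulrDl [a * _]mulrDr.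
rewrite -[(e *: l) * _]scalerAl.
rewrite [l * (b + _)]mulrDr scalerDr.
rewrite [l * (_ + _ + _)]mulrDr [l * (_ + _)]mulrDr.
rewrite -[l * (e *: b)]scalerAr -[l * (e *: _)]scalerAr -!addrA; congr (_ + (_ + _)).
by rewrite mulrCA.
Qed.

(** Each variable differs from its reduced form by 0 or by the linear form of the hyperplane, and
    this congruence is multiplicative. *)
Lemma rho_kernel S g : S != set0 -> g \is 41.-homog ->
  exists2 u : P6, u \is 40.-homog & g = ((g \mPo rho S) \mPo embed S) + lsum S * u.
Proof.
move=> S0 g41; pose red (f : P6) := (f \mPo rho S) \mPo embed S.
have redX i : exists e : 'F_2, 'X_i = red 'X_i + e *: lsum S.
  case: (unliftP (pivot S) i) => [j|] ->; rewrite /red.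
    by exists 0; rewrite scale0r addr0 rhoX_lift embedX.
  exists 1; rewrite scale1r rhoX_pivot comp_mpoly_sum lsum_lift //.
  rewrite (eq_bigr (fun j => 'X_(lift (pivot S) j))) => [|j _]; last exact: embedX.
  by rewrite addrCA addxx addr0.
(* In degree 0 the predecessor is again 0, so the vanishing of the cofactor has to be recorded
   separately. *)
have mono w : exists2 u : P6, u \is (mdeg w).-1.-homog /\ (mdeg w = 0%N -> u = 0)
    & 'X_[w] = red 'X_[w] + lsum S * u.
  elim/mono_ind: w => [|i w [u [uh u0] wE]].
    exists 0; first by split; rewrite ?dhomog0.
    by rewrite mulr0 addr0 mpolyX0 /red !comp_mpoly1.
  have [e iE] := redX i; rewrite mdegD mdeg1.
  have rXh : red 'X_i \is 1.-homog.
    apply: (homog_comp (embed_linform S)); apply: (homog_comp (rho_linform S)).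
    by rewrite dhomogX /= mdeg1.
  have rwh : red 'X_[w] \is (mdeg w).-homog.
    apply: (homog_comp (embed_linform S)); apply: (homog_comp (rho_linform S)).
    by rewrite dhomogX.
  have homX (f : P6) : f \is 1.-homog -> f * u \is (mdeg w).-homog.
    move=> f1; have [w0|w0] := posnP (mdeg w); first by rewrite u0 // mulr0 dhomog0.
    by have := dhomogM f1 uh; rewrite add1n prednK.
  exists (red 'X_i * u + e *: red 'X_[w] + e *: (lsum S * u)).
    split=> //; apply: rpredD; first apply: rpredD.
    - exact: homX.
    - exact: rpredZ.
    by apply: rpredZ; apply: homX; apply: lsum_homog.
  have redM f h : red (f * h) = red f * red h by rewrite /red !comp_mpolyM.
  rewrite mpolyXD redM; move: iE wE; move: (red 'X_i) (red 'X_[w]) => A B.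
  exact: mul_congr.
apply: (@homog_closed_ind _ (fun g => exists2 u : P6, u \is 40.-homog & g = red g + lsum S * u)
  _ _ _ _ g g41).
- by exists 0; rewrite ?dhomog0 // mulr0 addr0 /red !comp_mpoly0.
- move=> f h [u u40 fE] [v v40 hE]; exists (u + v); first exact: rpredD.
  by rewrite {1}fE {1}hE mulrDr /red !comp_mpolyD addrACA.
by move=> w wd; have [u [uh _] E] := mono w; exists u; rewrite // wd in uh *.
Qed.

(** If a is the pivot, the restriction is x_1 ... x_5. Otherwise the pivot becomes the sum of the
    other variables of S, and in its product with the four remaining variables only the summand x_a
    has five odd exponents; it occurs exactly when a is in S. *)
Lemma kameko_omit S a (h : P5) : S != set0 ->
  kameko ((omit a \mPo rho S) * h ^+ 2) = if a \in S then h else 0.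
Proof.
move=> S0; pose s := pivot S.
have compX R : xs R \mPo rho S = \prod_(i in R) ('X_i \mPo rho S) by exact: rmorph_prod.
have prodL (p : pred I) (F : I -> P5) : \prod_(i | p i) F i =
    (if p s then F s else 1) * \prod_(j : 'I_5 | p (lift s j)) F (lift s j).
  rewrite big_mkcond (bigD1_ord s) //=; congr (_ * _).
  by rewrite [RHS]big_mkcond.
rewrite /omit compX prodL !inE.
rewrite (eq_bigr (fun j => 'X_j)); last by move=> j _; exact: rhoX_lift.
have [<-|sa] := eqVneq s a.
  rewrite pivot_in // mul1r (eq_bigl (mem [set: 'I_5])); last first.
    by move=> j; rewrite !inE eq_sym neq_lift.
  by rewrite -[\prod_(_ in _) _]/(xs _) kameko_block eqxx.
have [b bE] : exists b, a = lift s b.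
  by have := unlift_some sa => -[b bE _]; exists b.
rewrite (eq_bigl (mem [set~ b])); last by move=> j; rewrite !inE bE (inj_eq lift_inj).
rewrite -[\prod_(_ in _) _]/(xs _) rhoX_pivot -/s !mulr_suml kameko_sum.
have term j : kameko ('X_j * xs [set~ b] * h ^+ 2) = if j == b then h else 0.
  have [->|jb] := eqVneq j b.
    have -> : 'X_b * xs [set~ b] = xs [set: 'I_5].
      rewrite (xs_setD1 (in_setT b)); congr (_ * xs _).
      by apply/setP=> i; rewrite !inE andbT.
    by rewrite kameko_block eqxx.
  rewrite (@xs_setD1 _ [set~ b] j) ?inE //.
  have -> : 'X_j * ('X_j * xs ([set~ b] :\ j)) * h ^+ 2 = xs ([set~ b] :\ j) * ('X_j * h) ^+ 2 by ring.
  rewrite kameko_block ifF //; apply/eqP => /setP/(_ j); rewrite !inE eqxx //.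
rewrite (eq_bigr (fun j => if j == b then h else 0)) // -big_mkcondr bE.
have [bS|bS] := boolP (lift s b \in S).
  by rewrite (big_pred1 b) // => j /=; case: eqVneq => [->|]; rewrite ?bS ?andbF ?andbT.
by rewrite big_pred0 // => j; case: eqVneq => [->|]; rewrite ?(negbTE bS) ?andbF.
Qed.

End Restriction.

(** * Detection of the components, and the factor 63 *)

Section Hyperplanes.
Local Notation P6 := {mpoly 'F_2[6]}.
Local Notation P5 := {mpoly 'F_2[5]}.
Local Notation Q6 := (cohit 6).
Local Notation Q5 := (cohit 5).
Local Notation I := 'I_6.
Implicit Types (S R T : {set I}) (f g h : P6).

Variable d : nat.
Hypothesis d5 : (5 <= d)%N.

Definition psi S f : Q5 := cohit_pi (iter d (@kameko 5) (f \mPo rho S)).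

Lemma iter_kamekoD n (f g : P5) :
  iter n (@kameko 5) (f + g) = iter n (@kameko 5) f + iter n (@kameko 5) g.
Proof. by elim: n => //= n ->; rewrite kamekoD. Qed.

Lemma iter_kameko0 n : iter n (@kameko 5) 0 = 0.
Proof. by apply: (@addrI _ (iter n (@kameko 5) 0)); rewrite -iter_kamekoD !addr0. Qed.

Lemma psiD S f g : psi S (f + g) = psi S f + psi S g.
Proof. by rewrite /psi comp_mpolyD iter_kamekoD cohit_piD. Qed.

Lemma psi_hit S f : hit f -> psi S f = 0.
Proof.
move=> /(hit_comp (rho_linform S)) hf; apply/pi_eq0.
by elim: d => //= n; apply: hit_kameko.
Qed.

(** Each dual Kameko map removes one floor, by [kameko_omit], and gives 0 at the first letter
    outside S. *)
Lemma psi_tower S o g : S != set0 -> size o = d ->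
  psi S (tower o g) = if all (mem S) o then cohit_pi (g \mPo rho S) else 0.
Proof.
rewrite /psi => S0 <-; elim: o => [//|a o IH].
have -> : size (a :: o) = (size o).+1 by [].
have -> : tower (a :: o) g = omit a * tower o g ^+ 2 by [].
have -> : (omit a * tower o g ^+ 2) \mPo rho S = (omit a \mPo rho S) * (tower o g \mPo rho S) ^+ 2.
  by rewrite (comp_mpolyM _ (omit a)) expr2 (comp_mpolyM _ (tower o g)).
rewrite iterSr.
rewrite (kameko_omit a _ S0).
have -> : all (mem S) (a :: o) = (a \in S) && all (mem S) o by [].
have [aS|aS] := boolP (a \in S); first by rewrite andTb; exact: IH.
by rewrite iter_kameko0; apply/pi_eq0/hit0.
Qed.

Definition psiQ S (q : Q6) : Q5 := psi S (repr q).

Lemma psiQ_pi S f : psiQ S (cohit_pi f) = psi S f.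
Proof.
apply: addxx_eq; rewrite -psiD; apply: psi_hit.
by apply/pi_eq0; rewrite cohit_piD [cohit_pi (repr _)]reprK addxx.
Qed.

Lemma psiQD S p q : psiQ S (p + q) = psiQ S p + psiQ S q.
Proof.
have [[f ->] [g ->]] := (cohit_surj p, cohit_surj q).
by rewrite -cohit_piD !psiQ_pi psiD.
Qed.

Lemma psiQ0 S : psiQ S 0 = 0.
Proof. by apply: (@addrI _ (psiQ S 0)); rewrite -psiQD !addr0. Qed.

Lemma psiQ_sum S (J : Type) (r : seq J) (p : pred J) (F : J -> Q6) :
  psiQ S (\sum_(i <- r | p i) F i) = \sum_(i <- r | p i) psiQ S (F i).
Proof. exact: (big_morph _ (psiQD S) (psiQ0 S)). Qed.

Lemma psiQZ S (c : 'F_2) q : psiQ S (c *: q) = c *: psiQ S q.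
Proof. by case: (F2_cases c) => ->; rewrite ?scale0r ?psiQ0 ?scale1r. Qed.

Lemma psiQ_gen S T g : S != set0 -> T != set0 -> (#|T| <= d)%N ->
  psiQ S (gen d T g) = if T \subset S then cohit_pi (g \mPo rho S) else 0.
Proof.
move=> S0 T0 Td; rewrite /gen psiQ_pi psi_tower ?word_size //.
suff -> : all (mem S) (word d T) = (T \subset S) by [].
apply/allP/subsetP => H x; first by move=> xT; apply: H; rewrite word_mem.
by rewrite word_mem // => /H.
Qed.

Lemma pi_rhoD S f g :
  cohit_pi ((f + g) \mPo rho S) = cohit_pi (f \mPo rho S) + cohit_pi (g \mPo rho S).
Proof. by rewrite comp_mpolyD cohit_piD. Qed.

Lemma pi_rho0 S : cohit_pi (0 \mPo rho S) = 0.
Proof. by rewrite comp_mpoly0; apply/pi_eq0/hit0. Qed.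

(** The defining class has the five letters other than a, so S is full or is that set. In the second
    case the linear factor restricts to 0; in the first it restricts to x_a, since the sum of all
    six variables vanishes there. *)
Lemma psiQ_zfull S g : S != set0 -> g \is 41.-homog ->
  psiQ S (zfull d g) = if S == setT then cohit_pi (g \mPo rho S) else 0.
Proof.
move=> S0; move: g; apply: homog41_ind => [|f g Hf Hg|a u u40].
- have -> : zfull d 0 = 0 by apply: linear0.
  by rewrite psiQ0 pi_rho0; case: (S == setT).
- rewrite zfullD psiQD Hf Hg; case: (S == setT); last by rewrite addr0.
  exact: esym (pi_rhoD S f g).
have ne : [set~ a] != set0 by rewrite -card_gt0 card_omit.
rewrite (zfullX d5 a u40) /zgen psiQ_gen // ?card_omit //.
have [->|ST] := eqVneq S setT.
  rewrite subsetT; apply: addxx_eq; rewrite -pi_rhoD -mulrDl addrC -lsumT comp_mpolyM.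
  by rewrite rho_lsum ?mul0r; [apply/pi_eq0/hit0 | rewrite -card_gt0 cardsT card_ord].
have [aS|//] := boolP (_ \subset S).
suff <- : [set~ a] = S by rewrite comp_mpolyM rho_lsum // mul0r; apply/pi_eq0/hit0.
by apply/eqP; rewrite eqEcard aS card_omit leqNgt -setT_cards.
Qed.

Lemma psiQ_cls S T g : S != set0 -> T != set0 -> g \is 41.-homog ->
  psiQ S (cls d T g) = if T \subset S then cohit_pi (g \mPo rho S) else 0.
Proof.
move=> S0 T0 g41; rewrite /cls (negbTE T0); have [->|TT] := eqVneq T setT.
  by rewrite psiQ_zfull // subTset.
apply: psiQ_gen => //; apply: leq_trans d5; rewrite leqNgt -setT_cards; exact: TT.
Qed.

(** The sum has one equal term for each T between R and S; there is an even number of them unless R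
    = S. *)
Lemma psiQ_comp S R g : S != set0 -> R != set0 -> g \is 41.-homog ->
  psiQ S (comp d R g) = if R == S then cohit_pi (g \mPo rho S) else 0.
Proof.
move=> S0 R0 g41; rewrite /comp psiQ_sum.
rewrite (eq_bigr (fun T => if T \subset S then cohit_pi (g \mPo rho S) else 0)); last first.
  move=> T RT; apply: psiQ_cls => //; apply: contraNneq R0 => T0.
  by rewrite -subset0 -T0.
rewrite -big_mkcondr; have [<-|RS] := eqVneq R S.
  by rewrite (big_pred1 R) // => T; rewrite /= eqEsubset andbC.
have [sRS|nRS] := boolP (R \subset S); last first.
  rewrite big_pred0 // => T; apply: contraNF nRS => /andP[]; exact: subset_trans.
have [i iS iR] : exists2 i, i \in S & i \notin R.
  by apply/subsetPn; apply: contra RS => SR; rewrite eqEsubset sRS.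
apply: (@sum_toggle _ _ i) => // T iT.
by rewrite subUset sub1set iS; congr (_ && _); apply: subset_setU1.
Qed.

Lemma cohit_deg0 m n : @cohit_deg m n 0.
Proof. by exists 0; [apply: dhomog0 | apply/esym/pi_eq0/hit0]. Qed.

Lemma cohit_degD n p q : @cohit_deg 6 n p -> cohit_deg n q -> cohit_deg n (p + q).
Proof. by have := @cohit_deg_closed 6 n 1 p q; rewrite scale1r. Qed.

Lemma gen_deg T g : (#|T| <= d)%N -> g \is 41.-homog -> cohit_deg (stage d) (gen d T g).
Proof.
move=> Td g41; exists (tower (word d T) g) => //.
by have := @tower_homog 0 (word d T) g g41; rewrite word_size // addn0.
Qed.

Lemma cls_deg T g : g \is 41.-homog -> cohit_deg (stage d) (cls d T g).
Proof.
move=> g41; rewrite /cls; have [_|TT] := eqVneq T setT; last first.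
  case: (T == set0); first exact: (cohit_deg0 6).
  by apply: gen_deg => //; apply: leq_trans d5; rewrite leqNgt -setT_cards; exact: TT.
move: g g41; apply: homog41_ind => [|f g Hf Hg|a u u40].
- have -> : zfull d 0 = 0 by apply: linear0.
  exact: (cohit_deg0 6).
- by rewrite zfullD; apply: cohit_degD.
by rewrite (zfullX d5 a u40); apply: gen_deg; rewrite ?card_omit //; apply: lsum_mul_homog.
Qed.

Lemma comp_deg S g : g \is 41.-homog -> cohit_deg (stage d) (comp d S g).
Proof.
move=> g41; apply: big_ind => [||T _]; [exact: (cohit_deg0 6) | exact: cohit_degD | exact: cls_deg].
Qed.

Lemma compZ S (c : 'F_2) g : comp d S (c *: g) = c *: comp d S g.
Proof. by case: (F2_cases c) => ->; rewrite ?scale0r ?comp0 ?scale1r. Qed.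

Lemma comp_sum S (J : Type) (r : seq J) (p : pred J) (F : J -> P6) :
  comp d S (\sum_(i <- r | p i) F i) = \sum_(i <- r | p i) comp d S (F i).
Proof. exact: (big_morph _ (@compD d S) (@comp0 d S)). Qed.

Local Notation nonempty := {S : {set I} | S != set0}.

Lemma card_nonempty : #|{: nonempty}| = 63%N.
Proof.
rewrite card_sig -(eq_card (_ : [set~ set0] =i _)); last by move=> S; rewrite !inE.
have c64 : #|{set I}| = 64%N by rewrite -cardsT -powersetT card_powerset cardsT card_ord.
by apply: (@addnI 1); have := cardsC [set (set0 : {set I})]; rewrite cards1 c64.
Qed.

Theorem dimension_stage N :
  has_dimension 'F_2 (@cohit_deg 5 41) N ->
  has_dimension 'F_2 (@cohit_deg 6 (stage d)) (63 * N).
Proof.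
case=> b bU bB; have /boolp.choice[a aP] j : exists f : P5, f \is 41.-homog /\ b j = cohit_pi f.
  by have [f fh E] := bU j; exists f.
have a41 j : a j \is 41.-homog by case: (aP j).
have bE j : b j = cohit_pi (a j) by case: (aP j).
have i41 S (f : P5) : f \is 41.-homog -> f \mPo embed S \is 41.-homog.
  by move=> f41; apply: (homog_comp (embed_linform S)).
pose B (k : nonempty * 'I_N) := comp d (val k.1) (a k.2 \mPo embed (val k.1)).
have -> : (63 * N)%N = #|{: nonempty * 'I_N}| by rewrite card_prod card_nonempty card_ord.
apply: (@has_dimension_fin _ _ _ B) => [[S j]|v [f fd ->]|c c0].
- by apply: comp_deg; apply: i41.
- have [g g41 ->] := spanned_stage d5 fd.
  have H S : exists c : 'I_N -> 'F_2, S != set0 -> comp d S (g S) = \sum_j c j *: comp d S (a j \mPo embed S).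
    have [->|S0] := eqVneq S set0; first by exists (fun _ => 0).
    (* The component of S kills multiples of its linear form, so only the restriction h counts, and
       h may be replaced modulo hits by a combination of the a_j. *)
    have [u u40 gE] := rho_kernel S0 (g41 S); set h := g S \mPo rho S in gE.
    have h41 : h \is 41.-homog by apply: (homog_comp (rho_linform S)).
    have [c [hE _]] := bB (cohit_pi h) (ex_intro2 _ _ h h41 erefl).
    exists c => _; rewrite gE compD (comp_lsum d5 S u40) addr0.
    pose h' := \sum_j c j *: a j; have h'41 : h' \is 41.-homog.
      by apply: rpred_sum => j _; apply: rpredZ.
    apply: (@etrans _ _ (comp d S (h' \mPo embed S))).
      apply: addxx_eq; rewrite -compD -comp_mpolyD; apply: (comp_hit d5).
        by apply: i41; apply: rpredD.
      apply: (hit_comp (embed_linform S)); apply/pi_eq0.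
      rewrite cohit_piD hE; have -> : cohit_pi h' = \sum_j c j *: b j; last exact: addxx.
      rewrite /h' (linear_sum (@cohit_pi 5)); apply: eq_bigr => j _.
      by rewrite bE; exact: cohit_piZ.
    rewrite /h' comp_mpoly_sum comp_sum; apply: eq_bigr => j _.
    by rewrite comp_mpolyZ compZ.
  have [c cE] := boolp.choice H; exists (fun k => c (val k.1) k.2).
  rewrite -(pair_bigA _ (fun (S : nonempty) j => c (val S) j *: B (S, j))) /=.
  rewrite -(big_sub (fun S : {set I} => S != set0)
    (fun S : {set I} => \sum_j c S j *: comp d S (a j \mPo embed S))) /=.
  by apply: eq_bigr => S S0; apply: cE.
(* The map of S sees only its own component, and restriction undoes the embedding: what remains is a
   relation between the given basis elements in five variables. *)
- move=> [S j]; have hS : psiQ (val S) (\sum_k c k *: B k) = \sum_j c (S, j) *: b j.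
    rewrite psiQ_sum; transitivity (\sum_(R : nonempty) \sum_j psiQ (val S) (c (R, j) *: B (R, j))).
      by rewrite pair_bigA; apply: eq_bigr => -[].
    have SS := valP S; rewrite (bigD1 S) //= [X in _ + X]big1 ?addr0 => [|R RS].
      apply: eq_bigr => i _; rewrite psiQZ /B psiQ_comp ?i41 //= eqxx embedK bE //.
    apply: big1 => i _; rewrite psiQZ /B psiQ_comp ?i41 ?(valP R) //=.
    by rewrite (inj_eq val_inj) (negbTE RS) scaler0.
  have [c' [_ cU]] := bB 0 (cohit_deg0 5 41).
  have z0 : 0 = \sum_j (0 : {ffun 'I_N -> 'F_2}) j *: b j.
    by rewrite big1 // => i _; rewrite ffunE scale0r.
  have z1 : 0 = \sum_j [ffun j => c (S, j)] j *: b j.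
    by rewrite -[LHS](psiQ0 (val S)) -c0 hS; apply: eq_bigr => i _; rewrite ffunE.
  by have := congr1 (fun f : {ffun _} => f j) (etrans (esym (cU _ z1)) (cU _ z0)); rewrite !ffunE.
Qed.
End Hyperplanes.

(** * Gaussian elimination over F_2 *)

Lemma pos_eqP : Equality.axiom Pos.eqb.
Proof. by move=> x y; apply: (iffP idP) => [/Pos.eqb_eq|/Pos.eqb_eq]. Qed.

HB.instance Definition _ := hasDecEq.Build positive pos_eqP.

Notation pmap := (PositiveMap.t (seq positive)).

(* Vectors over F_2 are decreasing lists of columns; [merge2] is their sum. *)
Fixpoint merge2 (r : seq positive) : seq positive -> seq positive :=
  if r is x :: r' then
    fix merge_r s := if s is y :: s' then
      match Pos.compare x y with
      | Eq => merge2 r' s'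
      | Lt => y :: merge_r s'
      | Gt => x :: merge2 r' s
      end else r
  else id.

(* A pivot row is stored as its tail, at the key given by its head. *)
Fixpoint reduce (fuel : nat) (M : pmap) (r : seq positive) : option (seq positive) :=
  if r is l :: s then
    if PositiveMap.find l M is Some t then
      if fuel is n.+1 then reduce n M (merge2 s t) else None
    else Some r
  else Some [::].

Section Eliminate.

(* Rows that run out of fuel, or reduce to zero, are skipped or rejected. *)
Variables (col : positive -> bool) (skip_fuel skip_zero : bool) (fuel : nat).

(** Testing each pivot row at run time makes the result triangular without any invariant on sorted
    lists: [merge2] computes a sum in any case. *)
Definition pivot_ok l s := all (fun x => Pos.ltb x l && col x) s.

Fixpoint eliminate (M : pmap) (rows : seq (seq positive)) : option pmap :=
  if rows is r :: rows' then
    match reduce fuel M r with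
    | None => if skip_fuel then eliminate M rows' else None
    | Some [::] => if skip_zero then eliminate M rows' else None
    | Some (l :: s) =>
        if pivot_ok l s then eliminate (PositiveMap.add l s M) rows' else None
    end
  else Some M.

End Eliminate.

Section Specification.
Variable V : lmodType 'F_2.
Implicit Types (v : positive -> V) (M : pmap) (r s t : seq positive) (l c x : positive).

Definition ev v r : V := \sum_(c <- r) v c.

Lemma ev_cons v c r : ev v (c :: r) = v c + ev v r.
Proof. exact: big_cons. Qed.

Lemma ev_merge2 v r s : ev v (merge2 r s) = ev v r + ev v s.
Proof.
elim: r s => [|x r IHr] s; first by rewrite /ev big_nil add0r.
elim: s => [|y s IHs]; first by rewrite /ev big_nil addr0.
rewrite [merge2 _ _]/=; case: Pos.compare_spec => [<-|_|_].
- by rewrite IHr !ev_cons addrACA addxx add0r.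
- by rewrite !ev_cons -/(merge2 (x :: r) s) IHs ev_cons addrCA.
by rewrite !ev_cons IHr ev_cons addrA.
Qed.

Definition kills v M := forall l t, PositiveMap.find l M = Some t -> v l = ev v t.

Lemma kills_add v M l s : PositiveMap.find l M = None ->
  kills v (PositiveMap.add l s M) <-> v l = ev v s /\ kills v M.
Proof.
move=> lM; split=> [H|[vl H] k t].
  split=> [|k t kM]; first by apply: H; rewrite PositiveMap.gss.
  by apply: H; rewrite PositiveMap.gso // => E; rewrite -E kM in lM.
have [->|/eqP kl] := eqVneq k l; first by rewrite PositiveMap.gss => -[<-].
by rewrite PositiveMap.gso //; apply: H.
Qed.

Lemma kills_empty v : kills v (PositiveMap.empty _).
Proof. by move=> l t; rewrite PositiveMap.gempty. Qed.

Lemma reduce_ev v fuel M r s : kills v M -> reduce fuel M r = Some s -> ev v s = ev v r.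
Proof.
move=> kM; elim: fuel r => [|n IH] [|l r] /=; try by case=> <-.
  by case: PositiveMap.find => // -[<-].
case E: PositiveMap.find => [t|]; last by case=> <-.
by move=> /IH ->; rewrite ev_merge2 ev_cons (kM _ _ E) addrC.
Qed.

Lemma reduce_head fuel M r l s : reduce fuel M r = Some (l :: s) -> PositiveMap.find l M = None.
Proof.
elim: fuel r => [|n IH] [|x r] //=; case E: PositiveMap.find => [t|] //; first by case=> <-.
  exact: IH.
by case=> <-.
Qed.

Lemma eliminate_kills v col sf sz fuel M rows M' : kills v M ->
  (forall r, r \in rows -> ev v r = 0) ->
  eliminate col sf sz fuel M rows = Some M' -> kills v M'.
Proof.
elim: rows M => [|r rows IH] M kM H /=; first by case=> <-.
have H' s : s \in rows -> ev v s = 0 by move=> sr; apply: H; rewrite inE sr orbT.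
case E: reduce => [[|l s]|]; [by case: ifP => // _; apply: IH | | by case: ifP => // _; apply: IH].
case: ifP => // _; apply: IH => //; apply/kills_add; first exact: reduce_head E.
split=> //; apply: addxx_eq; rewrite -ev_cons (reduce_ev kM E).
by apply: H; rewrite mem_head.
Qed.

(** The converse of [eliminate_kills]: the stored relations imply all the rows. Here no row may be
    dropped for lack of fuel. *)
Lemma eliminate_rows v col sz fuel M rows M' :
  eliminate col false sz fuel M rows = Some M' -> kills v M' ->
  kills v M /\ forall r, r \in rows -> ev v r = 0.
Proof.
elim: rows M => [|r rows IH] M /=; first by case=> <-.
case E: reduce => [[|l s]|] //.
  case: sz IH => // IH EM' kM'; have [kM H] := IH _ EM' kM'; split=> // q.
  by rewrite inE => /orP[/eqP->|/H //]; rewrite -(reduce_ev kM E) /ev big_nil.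
case: ifP => // _ EM' kM'; have [] := IH _ EM' kM'.
rewrite kills_add; last exact: reduce_head E.
move=> [vl kM] H; split=> // q; rewrite inE => /orP[/eqP->|/H //].
by rewrite -(reduce_ev kM E) ev_cons vl addxx.
Qed.

Definition triangular (col : positive -> bool) M :=
  forall l t, PositiveMap.find l M = Some t -> pivot_ok col l t.

Lemma triangular_empty col : triangular col (PositiveMap.empty _).
Proof. by move=> l t; rewrite PositiveMap.gempty. Qed.

Lemma triangular_add col M l s : pivot_ok col l s -> triangular col M ->
  triangular col (PositiveMap.add l s M).
Proof.
move=> ls H k t; have [->|/eqP kl] := eqVneq k l; first by rewrite PositiveMap.gss => -[<-].
by rewrite PositiveMap.gso //; apply: H.
Qed.

Lemma eliminate_triangular col sf sz fuel M rows M' : triangular col M ->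
  eliminate col sf sz fuel M rows = Some M' -> triangular col M'.
Proof.
elim: rows M => [|r rows IH] M tM /=; first by case=> <-.
case E: reduce => [[|l s]|]; [by case: ifP => // _; apply: IH | | by case: ifP => // _; apply: IH].
by case: ifP => // ls; apply/IH/triangular_add.
Qed.

Lemma pos_ind (p : positive -> Prop) :
  (forall c, (forall x, Pos.ltb x c -> p x) -> p c) -> forall c, p c.
Proof.
move=> H c; have [n] := ubnP (Pos.to_nat c); elim: n c => // n IH c cn.
by apply: H => x /Pos.ltb_lt xc; apply: IH; lia.
Qed.

(** The values on the columns without pivot are free, and a pivot relation expresses its column
    through smaller ones. *)
Lemma kills_extend col M (u : positive -> V) : triangular col M ->
  exists2 v, kills v M & forall c, PositiveMap.find c M = None -> v c = u c.
Proof.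
move=> tM.
(* Recursion on a bound n for the column; [wE] shows that any bound larger than the column gives the
   same value. *)
pose fix w (n : nat) (c : positive) {struct n} : V := if n is n'.+1 then
  if PositiveMap.find c M is Some t then ev (w n') t else u c else 0.
have wE n n' c : (Pos.to_nat c < n)%N -> (Pos.to_nat c < n')%N -> w n c = w n' c.
  elim: n n' c => // n IH [//|n'] c cn cn' /=; case E: PositiveMap.find => [t|//].
  rewrite /ev big_seq [RHS]big_seq; apply: eq_bigr => x xt.
  by have /andP[/Pos.ltb_lt xc _] := allP (tM _ _ E) x xt; apply: IH; lia.
have wS n c : w n.+1 c = if PositiveMap.find c M is Some t then ev (w n) t else u c by [].
clearbody w; exists (fun c => w (Pos.to_nat c).+1 c) => [l t E|c E]; last by rewrite wS E.
rewrite wS E /ev big_seq [RHS]big_seq; apply: eq_bigr => x xt.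
by have /andP[/Pos.ltb_lt xc _] := allP (tM _ _ E) x xt; apply: wE; lia.
Qed.

Lemma triangular_span col M v (p : V -> Prop) : triangular col M -> kills v M ->
  p 0 -> (forall a b, p a -> p b -> p (a + b)) ->
  (forall c, col c -> PositiveMap.find c M = None -> p (v c)) ->
  forall c, col c -> p (v c).
Proof.
move=> tM kM p0 pD pF; elim/pos_ind => c IH cc.
case E: (PositiveMap.find c M) => [t|]; last exact: pF.
rewrite (kM _ _ E) /ev big_seq; apply: big_ind => // x xt.
by have /andP[xc cx] := allP (tM _ _ E) x xt; apply: IH.
Qed.

End Specification.

(** If each row yields a new pivot, the rows are independent modulo M. Functionals that also kill
    the first pivot row dispose of the later coefficients by induction; a functional equal to 1 at
    the first pivot and 0 below it then isolates the first one. *)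
Lemma eliminate_free col fuel M rows M' (b : nat -> 'F_2) :
  triangular col M -> eliminate col false false fuel M rows = Some M' ->
  (forall v : positive -> ('F_2)^o, kills v M ->
     \sum_(i < size rows) b i * ev v (nth [::] rows i) = 0) ->
  forall i, (i < size rows)%N -> b i = 0.
Proof.
elim: rows M b => [//|r rows IH] M b tM /=.
case E: reduce => [[|l s]|] //; case: ifP => // ls EM' H.
have lM := reduce_head E.
have bS i : (i < size rows)%N -> b i.+1 = 0.
  apply: (IH _ (fun i => b i.+1) (triangular_add ls tM) EM') => v /kills_add -/(_ lM)[vl kM].
  by rewrite -[RHS](H v kM) big_ord_recl /= -(reduce_ev kM E) ev_cons vl addxx mulr0 add0r.
have [v kM vE] := kills_extend (fun c => (c == l)%:R : ('F_2)^o) tM.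
have v0 x : Pos.ltb x l -> v x = 0.
  elim/pos_ind: x => x IHx xl; case F: (PositiveMap.find x M) => [t|].
    rewrite (kM _ _ F) /ev big_seq big1 // => y yt.
    have /andP[yx _] := allP (tM _ _ F) y yt; apply: IHx => //.
    by move: yx xl => /Pos.ltb_lt yx /Pos.ltb_lt xl; apply/Pos.ltb_lt; lia.
  by rewrite vE //; case: eqP => // xl'; move: xl => /Pos.ltb_lt; lia.
have vr : ev v r = 1.
  rewrite -(reduce_ev kM E) ev_cons vE // eqxx /ev big_seq big1 ?addr0 // => x xs.
  by have /andP[xl _] := allP ls x xs; apply: v0.
have := H v kM; rewrite big_ord_recl /= vr mulr1 big1 ?addr0 => [b0|i _].
  by case=> [//|i]; rewrite ltnS => /bS.
by rewrite bS ?mul0r.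
Qed.

(** * Monomials as lists of exponents and as numbers *)

Definition exponents := seq N.

Definition total (l : exponents) : nat := sumn (map N.to_nat l).

Lemma total_cons a l : total (a :: l) = (N.to_nat a + total l)%N.
Proof. by []. Qed.

(* Lucas: C(a, k) is odd when the binary digits of k are bounded by those of a. *)
Fixpoint odd_bin_pos (a : positive) (k : N) : bool :=
  match a with
  | xH => if k is (N0 | Npos xH) then true else false
  | xO a' => match k with N0 => true | Npos (xO k') => odd_bin_pos a' (Npos k') | _ => false end
  | xI a' => match k with N0 | Npos xH => true
             | Npos (xO k') | Npos (xI k') => odd_bin_pos a' (Npos k') end
  end.

Definition odd_bin (a k : N) : bool :=
  if a is Npos a' then odd_bin_pos a' k else if k is N0 then true else false.

Fixpoint upto (n : nat) : seq N := N.of_nat n :: if n is m.+1 then upto m else [::].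

Fixpoint monomials (n d : nat) : seq exponents :=
  if n is m.+1 then flatten [seq [seq N.of_nat k :: l | l <- monomials m (d - k)] | k <- iota 0 d.+1]
  else if d is 0%N then [:: [::]] else [::].

Fixpoint sq_terms (K : N) (l : exponents) {struct l} : seq exponents :=
  if K is N0 then [:: l] else
  if l is a :: l' then
    flatten [seq if odd_bin a k then [seq N.add a k :: m | m <- sq_terms (N.sub K k) l'] else [::]
            | k <- upto (N.to_nat K)]
  else [::].

(* The monomials whose image by Sq^K involves a given one. *)
Fixpoint sq_sources (K : N) (l : exponents) {struct l} : seq exponents :=
  if K is N0 then [:: l] else
  if l is a :: l' then
    flatten [seq if N.leb k a && odd_bin (N.sub a k) k
                 then [seq N.sub a k :: m | m <- sq_sources (N.sub K k) l'] else [::]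
            | k <- upto (N.to_nat K)]
  else [::].

(** Digits in base 64 with the first exponent leading, so that [monomials] lists the codes in
    increasing order when the degree is less than 64. The constant monomial has no code of its
    own. *)
Definition encode (l : exponents) : positive :=
  if foldl (fun c a => N.add (N.mul 64 c) a) N0 l is Npos p then p else xH.

Fixpoint decode_rec (n : nat) (c : N) (l : exponents) : exponents :=
  if n is m.+1 then decode_rec m (N.div c 64) (N.modulo c 64 :: l) else l.

Lemma decode_recS n c l :
  decode_rec n.+1 c l = decode_rec n (N.div c 64) (N.modulo c 64 :: l).
Proof. by []. Qed.

Definition decode (n : nat) (c : positive) : exponents := decode_rec n (Npos c) [::].

Lemma mem_upto n k : (k \in upto n) = (N.to_nat k <= n)%N.
Proof.
elim: n => [|n IH]; rewrite inE ?IH.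
  by apply/eqP/idP => [->//|k0]; lia.
apply/orP/idP => [[/eqP->|]|kn]; [by rewrite Nnat.Nat2N.id|lia|].
by have [/eqP kE|ne] := boolP (N.to_nat k == n.+1); [left; apply/eqP; lia | right; lia].
Qed.

Lemma sum_upto (V : nmodType) n (f : nat -> V) :
  \sum_(k <- upto n) f (N.to_nat k) = \sum_(i < n.+1) f i.
Proof.
elim: n => [|n IH]; first by rewrite big_seq1 big_ord1.
by rewrite big_cons big_ord_recr IH Nnat.Nat2N.id addrC.
Qed.

Lemma monomialsS n d : monomials n.+1 d =
  flatten [seq [seq N.of_nat k :: l | l <- monomials n (d - k)] | k <- iota 0 d.+1].
Proof. by []. Qed.

Lemma monomialsP n d l : size l = n -> total l = d -> l \in monomials n d.
Proof.
elim: n d l => [|n IH] d [|a l] // => [_ <- //|[sl]].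
rewrite /total [map _ _]/= [sumn _]/= -/(total l) monomialsS => E.
apply/flattenP; exists [seq N.of_nat (N.to_nat a) :: m | m <- monomials n (d - N.to_nat a)].
  by apply/mapP; exists (N.to_nat a) => //; rewrite mem_iota; lia.
rewrite Nnat.N2Nat.id; apply/mapP; exists l => //; apply: IH => //.
by rewrite -E addKn.
Qed.

Lemma monomials_spec n d l : l \in monomials n d -> size l = n /\ total l = d.
Proof.
elim: n d l => [|n IH] d l; first by case: d => //; rewrite inE => /eqP->.
rewrite monomialsS => /flattenP[_ /mapP[k kd ->] /mapP[m /IH[sm tm] ->]].
by split; rewrite /total /= ?sm //; move: kd; rewrite mem_iota -/(total m) tm Nnat.Nat2N.id; lia.
Qed.

Lemma sq_terms0 l : sq_terms 0 l = [:: l]. Proof. by case: l. Qed.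

Lemma sq_termsS K a l : sq_terms (Npos K) (a :: l) =
  flatten [seq if odd_bin a k then [seq N.add a k :: m | m <- sq_terms (N.sub (Npos K) k) l] else [::]
          | k <- upto (N.to_nat (Npos K))].
Proof. by []. Qed.

Lemma sq_terms_spec K l m : m \in sq_terms K l ->
  size m = size l /\ total m = (total l + N.to_nat K)%N.
Proof.
elim: l K m => [|a l IH] K m.
  by case: K => //; rewrite sq_terms0 inE => /eqP->.
case: K => [|K]; first by rewrite sq_terms0 inE => /eqP->; rewrite addn0.
rewrite sq_termsS => /flattenP[x /mapP[k + ->]]; rewrite mem_upto => kK.
case: ifP => // _ /mapP[m' /IH[sm tm] ->]; split; first by rewrite /= sm.
by rewrite !total_cons tm; lia.
Qed.

Lemma foldl_encode c l : foldl (fun c a => N.add (N.mul 64 c) a) c l =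
  N.add (N.mul (N.pow 64 (N.of_nat (size l))) c) (foldl (fun c a => N.add (N.mul 64 c) a) N0 l).
Proof.
elim/last_ind: l c => [|l a IH] c; first by change (c = N.add (N.mul 1 c) 0); lia.
rewrite !foldl_rcons IH size_rcons Nnat.Nat2N.inj_succ N.pow_succ_r'; lia.
Qed.

Definition horner l := foldl (fun c a => N.add (N.mul 64 c) a) N0 l.

Lemma encodeE l : (0 < total l)%N -> Npos (encode l) = horner l.
Proof.
move=> l0; rewrite /encode -/(horner l); case E: (horner l) => [|//].
suff : (0 < N.to_nat (horner l))%N by rewrite E.
move: l0 {E}; elim/last_ind: l => [//|l a IH].
rewrite /total map_rcons sumn_rcons /horner foldl_rcons -/(horner l) -/(total l).
by have [t0|t0] := posnP (total l); [lia|move: (IH t0); lia].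
Qed.

Lemma decode_encode l : all (fun a => N.ltb a 64) l -> (0 < total l)%N -> decode (size l) (encode l) = l.
Proof.
move=> l64 l0; rewrite /decode encodeE //.
have -> : decode_rec (size l) (horner l) [::] = l ++ [::]; last exact: cats0.
move: [::] l64 => m; elim/last_ind: l m {l0} => [//|l a IH] m.
rewrite all_rcons => /andP[/N.ltb_lt a64 l64]; rewrite size_rcons /horner foldl_rcons -/(horner l).
rewrite decode_recS cat_rcons -IH //; congr decode_rec; last congr (_ :: _).
  by rewrite N.mul_comm N.div_add_l ?N.div_small //; lia.
by rewrite N.add_comm N.mul_comm N.Div0.mod_add N.mod_small.
Qed.

Section Monomials.
Variable n : nat.
Local Notation P := {mpoly 'F_2[n]}.
Implicit Types (l : exponents) (w : 'X_{1..n}) (s : seq 'I_n).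

Lemma Sq_Xeven k b (i : 'I_n) :
  Sq k ('X_i ^+ b.*2 : P) = if odd k then 0 else Sq k./2 ('X_i ^+ b) ^+ 2.
Proof. by rewrite -muln2 exprM Sq_sqr. Qed.

Lemma Sq_Xodd k b (i : 'I_n) :
  Sq k ('X_i ^+ b.*2.+1 : P) = 'X_i ^+ (odd k).+1 * Sq k./2 ('X_i ^+ b) ^+ 2.
Proof.
rewrite exprS -muln2 exprM; case: k => [|k]; first by rewrite !Sq0 expr1.
rewrite Sq_mulX !Sq_sqr /=; case E: (odd k) => /=.
  by rewrite mulr0 addr0 expr1 uphalf_half E.
by rewrite mulr0 add0r uphalf_half E.
Qed.

Lemma Sq_Xn (a : positive) (k : N) (i : 'I_n) : Sq (N.to_nat k) ('X_i ^+ Pos.to_nat a : P) =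
  if odd_bin_pos a k then 'X_i ^+ (Pos.to_nat a + N.to_nat k) else 0.
Proof.
elim: a k => [a IH|a IH|] k.
- have -> : Pos.to_nat a~1 = (Pos.to_nat a).*2.+1 by lia.
  rewrite Sq_Xodd; case: k => [|[k|k|]].
  + by rewrite !Sq0 expr1 -exprM -exprS; congr ('X_i ^+ _); lia.
  + have -> : odd (N.to_nat (Npos k~1)) by lia.
    have -> : (N.to_nat (Npos k~1))./2 = N.to_nat (Npos k) by lia.
    rewrite IH /=; case: (odd_bin_pos a _); last by rewrite expr0n mulr0.
    by rewrite -exprM -exprD; congr ('X_i ^+ _); lia.
  + have -> : odd (N.to_nat (Npos k~0)) = false by lia.
    have -> : (N.to_nat (Npos k~0))./2 = N.to_nat (Npos k) by lia.
    rewrite IH /=; case: (odd_bin_pos a _); last by rewrite expr0n mulr0.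
    by rewrite -exprM -exprS; congr ('X_i ^+ _); lia.
  by rewrite Sq0 -exprM -exprD; congr ('X_i ^+ _); lia.
- have -> : Pos.to_nat a~0 = (Pos.to_nat a).*2 by lia.
  rewrite Sq_Xeven; case: k => [|[k|k|]] //.
  + by rewrite !Sq0 -exprM; congr ('X_i ^+ _); lia.
  + by have -> : odd (N.to_nat (Npos k~1)) by lia.
  have -> : odd (N.to_nat (Npos k~0)) = false by lia.
  have -> : (N.to_nat (Npos k~0))./2 = N.to_nat (Npos k) by lia.
  rewrite IH /=; case: (odd_bin_pos a _); last by rewrite expr0n.
  by rewrite -exprM; congr ('X_i ^+ _); lia.
have Xi : 'X_i ^+ Pos.to_nat 1 = 'X_i :> P by rewrite expr1.
rewrite Xi SqX; case: k => [|[k|k|]] //.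
  by have -> : N.to_nat (Npos k~1) = (N.to_nat (Npos k)).*2.-2.+3 by lia.
by have -> : N.to_nat (Npos k~0) = (N.to_nat (Npos k)).*2.-2.+2 by lia.
Qed.

Lemma Sq_pow (a k : N) (i : 'I_n) : Sq (N.to_nat k) ('X_i ^+ N.to_nat a : P) =
  if odd_bin a k then 'X_i ^+ N.to_nat (N.add a k) else 0.
Proof.
case: a => [|a]; last by rewrite Sq_Xn; congr (if _ then 'X_i ^+ _ else _); lia.
by rewrite expr0 Sq1; case: k => [|k] //=; have -> : (Pos.to_nat k == 0%N) = false by lia.
Qed.

Definition power_prod s l : P := \prod_(x <- zip s l) 'X_(x.1) ^+ N.to_nat x.2.

Lemma power_prod_cons i s a l :
  power_prod (i :: s) (a :: l) = 'X_i ^+ N.to_nat a * power_prod s l.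
Proof. exact: big_cons. Qed.

Lemma Sq_power_prod s l K : size s = size l ->
  Sq (N.to_nat K) (power_prod s l) = \sum_(m <- sq_terms K l) power_prod s m.
Proof.
elim: l s K => [|a l IH] [|i s] //= K.
  have -> : power_prod [::] [::] = 1 by rewrite /power_prod big_nil.
  rewrite Sq1 => _; case: K => [|K]; first by rewrite big_seq1 /power_prod big_nil.
  by rewrite big_nil; have -> : (N.to_nat (Npos K) == 0%N) = false by lia.
move=> [sz]; case: K => [|K]; first by rewrite Sq0 big_seq1.
rewrite -/(sq_terms (Npos K) (a :: l)) sq_termsS big_flatten big_map power_prod_cons.
rewrite Sq_cartan; set K' := Npos K.
rewrite -(@sum_upto _ _ (fun k => Sq k ('X_i ^+ N.to_nat a) * Sq (N.to_nat K' - k) (power_prod s l))).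
rewrite big_seq [RHS]big_seq; apply: eq_bigr => k; rewrite mem_upto => kK.
have -> : (N.to_nat K' - N.to_nat k = N.to_nat (N.sub K' k))%N by lia.
rewrite Sq_pow IH //; case: ifP => _; last by rewrite mul0r big_nil.
rewrite big_map mulr_sumr; apply: eq_bigr => m _.
by rewrite power_prod_cons.
Qed.

Definition mono l : P := power_prod (enum 'I_n) l.

Lemma Sq_mono l K : size l = n -> Sq (N.to_nat K) (mono l) = \sum_(m <- sq_terms K l) mono m.
Proof. by move=> sl; apply: Sq_power_prod; rewrite sl size_enum_ord. Qed.

Definition exps w : exponents := [seq N.of_nat (w i) | i <- enum 'I_n].

Lemma size_exps w : size (exps w) = n.
Proof. by rewrite size_map size_enum_ord. Qed.

Lemma total_exps w : total (exps w) = mdeg w.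
Proof.
rewrite /total -map_comp sumnE big_map big_enum mdegE; apply: eq_bigr => i _.
exact: Nnat.Nat2N.id.
Qed.

Lemma mono_exps w : mono (exps w) = 'X_[w].
Proof.
rewrite /mono /power_prod mpolyXE_id -[X in zip X _]map_id zip_map big_map big_enum /=.
by apply: eq_bigr => i _; rewrite Nnat.Nat2N.id.
Qed.

Definition mnm l : 'X_{1..n} := [multinom N.to_nat (nth N0 l i) | i < n].

Lemma exps_mnm l : size l = n -> exps (mnm l) = l.
Proof.
move=> sl; apply: (@eq_from_nth _ N0); first by rewrite size_exps.
rewrite size_exps => i ilt; rewrite (nth_map (Ordinal ilt)) ?size_enum_ord //.
by rewrite mnmE nth_enum_ord // Nnat.N2Nat.id.
Qed.

Lemma mono_mnm l : size l = n -> mono l = 'X_[mnm l].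
Proof. by move=> sl; rewrite -mono_exps exps_mnm. Qed.

Lemma mdeg_mnm l : size l = n -> mdeg (mnm l) = total l.
Proof. by move=> sl; rewrite -total_exps exps_mnm. Qed.

End Monomials.

Lemma total_lt l d : (total l < d)%N -> all (fun a => N.ltb a (N.of_nat d)) l.
Proof.
elim: l => //= a l IH; rewrite total_cons => lt; apply/andP; split; last by apply: IH; lia.
by apply/N.ltb_lt; lia.
Qed.

Lemma encodeK n l : size l = n -> (0 < total l < 64)%N -> decode n (encode l) = l.
Proof. by move=> <- /andP[l0 l64]; apply: decode_encode => //; apply: total_lt l64. Qed.

(** From (r+1) C(2^i, r+1) = 2^i C(2^i - 1, r) the number C(2^i, r+1) is even, so by Pascal
    consecutive entries of row 2^i - 1 have the same parity. *)
Lemma odd_bin_pow2 i r : (r < 2 ^ i)%N -> odd 'C((2 ^ i).-1, r).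
Proof.
elim: r => [|r IH] lt; first by rewrite bin0.
have i0 : (0 < 2 ^ i)%N by rewrite expn_gt0.
have := binS (2 ^ i).-1 r; rewrite prednK // => E.
have : ~~ odd 'C(2 ^ i, r.+1).
  apply/negP => oc; have := mul_bin_diag (2 ^ i) r => D.
  have : (2 ^ i %| r.+1)%N.
    rewrite -(@Gauss_dvdl _ _ 'C(2 ^ i, r.+1)); first by rewrite -D dvdn_mulr.
    by rewrite coprimeXl // coprime2n.
  by move/dvdn_leq => /(_ isT); rewrite leqNgt lt.
by rewrite E oddD IH 1?ltnW // addbT negbK.
Qed.

(* The Adem relations express every Sq^k through those with k a power of 2. *)
Lemma Sq_pow2_ind n (p : {mpoly 'F_2[n]} -> Prop) :
  p 0 -> (forall f g, p f -> p g -> p (f + g)) ->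
  (forall j g, p (Sq (2 ^ j) g)) -> forall k g, (0 < k)%N -> p (Sq k g).
Proof.
move=> p0 pD pS k g; have [N] := ubnP k; elim: N k g => // N IH k g kN k0.
(* Write k = 2^i + r with r < 2^i: in the Adem relation for Sq^r Sq^(2^i) the coefficient of Sq^k is
   C(2^i - 1, r), which is odd. *)
pose i := trunc_log 2 k; have /andP[ik ki] := trunc_log_bounds (isT : 1 < 2)%N k0.
rewrite -/i in ik ki; pose r := (k - 2 ^ i)%N.
have [r0|r0] := posnP r; first by have -> : k = (2 ^ i)%N by lia.
have ri : (r < 2 ^ i)%N by move: ki; rewrite expnS; lia.
have := @Sq_adem n r (2 ^ i) g; rewrite r0 -muln2 => /(_ ltac:(lia)) E.
have -> : Sq k g = Sq r (Sq (2 ^ i) g) +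
   \sum_(c < r./2) 'C(2 ^ i - c.+1 - 1, r - c.+1.*2)%:R *: Sq (r + 2 ^ i - c.+1) (Sq c.+1 g).
  rewrite E big_ord_recl /= subn0 double0 subn0 Sq0 subn1.
  have -> : 'C((2 ^ i).-1, r)%:R = 1 :> 'F_2.
    by apply/val_inj; rewrite Zp_nat /= modn2 odd_bin_pow2.
  have -> : (r + 2 ^ i - 0 = k)%N by lia.
  by rewrite scale1r -addrA addxx addr0.
apply: (pD); first by apply: IH => //; lia.
apply: (big_ind p p0 pD) => c _; have cr := ltn_ord c.
case: (F2_cases ('C(2 ^ i - c.+1 - 1, r - c.+1.*2)%:R)) => ->; first by rewrite scale0r.
by rewrite scale1r; apply: IH; lia.
Qed.

(** * Elimination tables for the hits of a given degree *)

Definition sq_indices : seq N := map N.of_nat [:: 1; 2; 4; 8; 16; 32]%N.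

Definition columns n d : seq positive := map encode (monomials n d).

(** By [Sq_pow2_ind] the squares of index a power of two suffice, and in degrees below 64 these
    indices are at most 32. *)
Definition sq_rows n d : seq (seq positive) :=
  flatten [seq [seq map encode (sq_terms k l) | l <- monomials n (d - N.to_nat k)]
          | k <- sq_indices & (N.to_nat k <= d)%N].

Definition is_free (M : pmap) c := if PositiveMap.find c M is None then true else false.

Definition free_columns n d M := filter (is_free M) (columns n d).

Lemma monomials_uniq n d : uniq (monomials n d).
Proof.
elim: n d => [|n IH] d; first by case: d.
apply: allpairs_uniq_dep => [|k _|[k l] [k' l'] _ _ [/= kE lE]]; [exact: iota_uniq|exact: IH|].
by have {}kE : k = k' by [lia]; move: l lE; rewrite kE => l ->.
Qed.

Lemma encode_inj n d : (0 < d < 64)%N -> {in monomials n d &, injective encode}.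
Proof.
move=> d64 l m /monomials_spec[sl tl] /monomials_spec[sm tm] E.
by rewrite -(encodeK sl) ?tl // -(encodeK sm) ?tm // E.
Qed.

Section Table.
Variables (n d : nat).
Hypothesis d64 : (0 < d < 64)%N.
Local Notation P := {mpoly 'F_2[n]}.
Local Notation mono := (@mono n).

Lemma free_columns_uniq M : uniq (free_columns n d M).
Proof.
by apply: filter_uniq; rewrite map_inj_in_uniq; [exact: monomials_uniq | exact: encode_inj].
Qed.

Section Values.
Variables (V : lmodType 'F_2) (L : {linear P -> V}).

Definition column_value c : V := if c \in columns n d then L (mono (decode n c)) else 0.

Lemma column_value_encode l : size l = n -> total l = d -> column_value (encode l) = L (mono l).
Proof.
move=> sl tl; rewrite /column_value map_f; last exact: monomialsP.
by rewrite encodeK ?tl.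
Qed.

Lemma ev_terms K l : size l = n -> (total l + N.to_nat K = d)%N ->
  ev column_value (map encode (sq_terms K l)) = L (Sq (N.to_nat K) (mono l)).
Proof.
move=> sl tl; rewrite Sq_mono // linear_sum /ev big_map big_seq [RHS]big_seq.
apply: eq_bigr => m /sq_terms_spec[sm tm].
by apply: column_value_encode; rewrite ?sm // tm.
Qed.

Hypothesis L0 : forall k l, (0 < k)%N -> size l = n -> (total l + k = d)%N -> L (Sq k (mono l)) = 0.

Lemma sq_rows_kill r : r \in sq_rows n d -> ev column_value r = 0.
Proof.
case/flattenP => s /mapP[K]; rewrite mem_filter => /andP[Kd Ks] -> /mapP[l].
case/monomials_spec => sl tl ->; rewrite ev_terms //; last by rewrite tl subnK.
apply: L0 => //; last by rewrite tl subnK.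
by move: Ks; rewrite !inE; do !case/orP; move/eqP => ->.
Qed.

End Values.

Variables (fuel : nat) (M : pmap).
Hypothesis EM : eliminate (fun=> true) false true fuel (PositiveMap.empty _) (sq_rows n d) = Some M.

Let tM : triangular (fun=> true) M.
Proof. exact: eliminate_triangular (@triangular_empty _) EM. Qed.

Lemma is_freeP c : reflect (PositiveMap.find c M = None) (is_free M c).
Proof. by rewrite /is_free; case: PositiveMap.find => [t|]; constructor. Qed.

Lemma column_value_kills (V : lmodType 'F_2) (L : {linear P -> V}) :
  (forall k l, (0 < k)%N -> size l = n -> (total l + k = d)%N -> L (Sq k (mono l)) = 0) ->
  kills (column_value L) M.
Proof. by move=> L0; apply: eliminate_kills EM; [exact: kills_empty | exact: sq_rows_kill]. Qed.

Lemma homog_mono_ind (V : lmodType 'F_2) (L : {linear P -> V}) (p : V -> Prop) :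
  p 0 -> (forall a b, p a -> p b -> p (a + b)) ->
  (forall l, size l = n -> total l = d -> p (L (mono l))) ->
  forall f, f \is d.-homog -> p (L f).
Proof.
move=> p0 pD pM f fd; apply: (@homog_closed_ind _ (fun f => p (L f)) d _ _ _ f fd).
- by rewrite linear0.
- by move=> g h; cbv beta => pg ph; rewrite linearD; apply: pD.
by move=> w wd; rewrite -mono_exps; apply: pM; rewrite ?size_exps ?total_exps.
Qed.

Lemma table_span (V : lmodType 'F_2) (L : {linear P -> V}) (p : V -> Prop) :
  (forall k l, (0 < k)%N -> size l = n -> (total l + k = d)%N -> L (Sq k (mono l)) = 0) ->
  p 0 -> (forall a b, p a -> p b -> p (a + b)) ->
  (forall c, c \in free_columns n d M -> p (L (mono (decode n c)))) ->
  forall f, f \is d.-homog -> p (L f).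
Proof.
move=> L0 p0 pD pF; apply: homog_mono_ind => // l sl tl; rewrite -column_value_encode //.
apply: (triangular_span tM (column_value_kills L0)) => // c _ cM.
rewrite /column_value; case: ifP => // cc; apply: pF.
by rewrite mem_filter cc andbT; apply/is_freeP.
Qed.

(** Extend the Kronecker function of c0 on the free columns to all columns; the result satisfies
    every row, so it vanishes on hits. *)
Lemma table_dual c0 : c0 \in free_columns n d M ->
  exists2 L : {linear P -> ('F_2)^o}, forall k g, (0 < k)%N -> L (Sq k g) = 0
    & forall c, c \in free_columns n d M -> L (mono (decode n c)) = (c == c0)%:R.
Proof.
rewrite mem_filter => /andP[/is_freeP c0M _].
have [v kM vE] := kills_extend (fun c => (c == c0)%:R : ('F_2)^o) tM.
have [_ H] := eliminate_rows EM kM.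
(* The functional is zero outside degree d, so only squares landing in degree d have to be compared
   with the rows. *)
pose L : {linear P -> ('F_2)^o} := mlin (fun w => if mdeg w == d then v (encode (exps w)) else 0).
have LE l : size l = n -> L (mono l) = if total l == d then v (encode l) else 0.
  by move=> sl; rewrite (mono_mnm sl) [L _]mlinX mdeg_mnm // exps_mnm.
exists L => [|c]; last first.
  rewrite mem_filter => /andP[/is_freeP cM /mapP[l /monomials_spec[sl tl] cE]].
  by rewrite {1}cE encodeK ?tl // LE // tl eqxx -cE vE.
apply: (@Sq_pow2_ind n (fun f => L f = 0)) => [|f g Lf Lg|j g]; first exact: linear0.
  by rewrite linearD Lf Lg addr0.
rewrite (mpolyE g) Sq_sum linear_sum big1 // => w _; rewrite SqZ linearZ.
suff -> : L (Sq (2 ^ j) 'X_[w]) = 0 by exact: scaler0.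
rewrite -mono_exps -{1}(Nnat.Nat2N.id (2 ^ j)) Sq_mono ?size_exps //.
have [E|ne] := eqVneq (mdeg w + 2 ^ j)%N d; last first.
  rewrite linear_sum big_seq big1 // => m /sq_terms_spec[sm tm].
  by rewrite LE ?sm ?size_exps // tm total_exps Nnat.Nat2N.id (negbTE ne).
have <- : ev v (map encode (sq_terms (N.of_nat (2 ^ j)) (exps w))) = 0.
  apply: H; apply/flattenP; exists [seq map encode (sq_terms (N.of_nat (2 ^ j)) l)
      | l <- monomials n (d - N.to_nat (N.of_nat (2 ^ j)))].
    apply/mapP; exists (N.of_nat (2 ^ j)) => //; rewrite mem_filter Nnat.Nat2N.id; apply/andP; split.
      by lia.
    apply: map_f; have : (2 ^ j < 2 ^ 6)%N by move: d64; lia.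
    by rewrite ltn_exp2l //; case: j {E} => [|[|[|[|[|[|j]]]]]].
  apply: map_f; apply: monomialsP; rewrite ?size_exps // total_exps Nnat.Nat2N.id.
  by rewrite -E addnK.
rewrite linear_sum /ev big_map big_seq [RHS]big_seq; apply: eq_bigr => m /sq_terms_spec[sm tm].
by rewrite LE ?sm ?size_exps // tm total_exps Nnat.Nat2N.id E eqxx.
Qed.

End Table.

(** * Relations between blocks with three odd exponents *)

(* The code of the monomial x_J y^2, for J given by its indicator. *)
Definition block_code (J : exponents) (c : positive) : positive :=
  if N.add (Npos (xO c)) (foldl (fun c a => N.add (N.mul 64 c) a) N0 J) is Npos p then p else xH.

Definition indicators (n k : nat) : seq exponents :=
  [seq l <- monomials n k | all (fun a => N.leb a 1) l].

Definition get_nf (N : pmap) c := odflt [:: c] (PositiveMap.find c N).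

Definition merge_all : seq (seq positive) -> seq positive := foldr merge2 [::].

(** Columns are visited in increasing order and the tail of a pivot row lies below its pivot, so the
    normal forms of the tail are already known and one pass suffices. *)
Definition nf_step (M N : pmap) c :=
  PositiveMap.add c (if PositiveMap.find c M is Some t then merge_all (map (get_nf N) t) else [:: c]) N.

Definition nf_map M (cs : seq positive) : pmap := foldl (nf_step M) (PositiveMap.empty _) cs.

Definition zero_at (i : nat) (l : exponents) := set_nth N0 l i N0.
Definition incr_at (i : nat) (l : exponents) := set_nth N0 l i (N.succ (nth N0 l i)).

(* The image by Sq^1 of x_K w^2. *)
Definition sq1_row (nf : positive -> seq positive) (K w : exponents) : seq positive :=
  merge_all [seq map (block_code (zero_at i K)) (nf (encode (incr_at i w)))
            | i <- iota 0 (size K) & nth N0 K i != N0].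

Definition sq1_rows nf n d :=
  [seq sq1_row nf K w | w <- monomials n d, K <- indicators n 4].

(** Positions are given by the numbers of entries skipped between them, so the list is traversed
    once. *)
Fixpoint select (T : Type) (x0 : T) (gaps : seq nat) (s : seq T) : seq T :=
  if gaps is g :: gaps' then
    let s' := drop g s in head x0 s' :: select x0 gaps' (behead s')
  else [::].

Section BlockTable.
Variables (n d : nat).

Definition key_set (cs : seq positive) : pmap :=
  foldl (fun m c => PositiveMap.add c [::] m) (PositiveMap.empty _) cs.

Definition block_columns M :=
  [seq block_code J x | J <- indicators n 3, x <- free_columns n d.+1 M].

(** With fuel 0 the first pass keeps, unreduced, the rows whose leading column is new and skips the
    others; the second pass reduces the selected rows. Omitting a relation can only enlarge the set
    of generators, so the bound obtained is valid for any selection. *)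
Definition block_table (gaps : seq nat) (M : pmap) : option pmap :=
  let nf := get_nf (nf_map M (columns n d.+1)) in
  let rows := sq1_rows nf n d in
  let keys := key_set (block_columns M) in
  let col c := ~~ is_free keys c in
  if eliminate col true true 0 (PositiveMap.empty _) rows is Some M0 then
    eliminate col true true 1000 M0 (select [::] gaps rows)
  else None.

Definition free_blocks M MK := filter (is_free MK) (block_columns M).

End BlockTable.

Lemma merge2_all (Q : pred positive) r s : all Q r -> all Q s -> all Q (merge2 r s).
Proof.
elim: r s => [//|x r IHr] s /= /andP[Qx Qr]; elim: s => [_|y s IHs /= /andP[Qy Qs]].
  by rewrite /= Qx.
case: Pos.compare_spec => _ /=; first exact: IHr.
  by rewrite Qy; apply: IHs.
by rewrite Qx; apply: IHr => //=; rewrite Qy.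
Qed.

Definition within (Q : pred positive) M := forall l t, PositiveMap.find l M = Some t -> all Q t.

Lemma within_empty Q : within Q (PositiveMap.empty _).
Proof. by move=> l t; rewrite PositiveMap.gempty. Qed.

Lemma within_add Q M l s : all Q s -> within Q M -> within Q (PositiveMap.add l s M).
Proof.
move=> Qs QM k t; have [->|/eqP kl] := eqVneq k l; first by rewrite PositiveMap.gss => -[<-].
by rewrite PositiveMap.gso //; apply: QM.
Qed.

Lemma reduce_all Q fuel M r s : within Q M -> all Q r -> reduce fuel M r = Some s -> all Q s.
Proof.
move=> QM; elim: fuel r => [|m IH] [|l r] /=; try by move=> _ [<-].
  by move=> Qr; case: PositiveMap.find => // -[<-].
move=> Qlr; case E: PositiveMap.find => [t|]; last by case=> <-.
by apply: IH; apply: merge2_all; [case/andP: Qlr | exact: QM E].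
Qed.

Lemma eliminate_within Q col sf sz fuel M rows M' : within Q M ->
  (forall r, r \in rows -> all Q r) -> eliminate col sf sz fuel M rows = Some M' -> within Q M'.
Proof.
elim: rows M => [|r rows IH] M QM H /=; first by case=> <-.
have H' s : s \in rows -> all Q s by move=> sr; apply: H; rewrite inE sr orbT.
case E: reduce => [[|l s]|]; [by case: ifP => // _; apply: IH | | by case: ifP => // _; apply: IH].
case: ifP => // _; apply: IH => //; apply: within_add => //.
by have := reduce_all QM (H r (mem_head _ _)) E => /andP[].
Qed.

Lemma sq_rows_within n d r : r \in sq_rows n d -> all (mem (columns n d)) r.
Proof.
case/flattenP => s /mapP[K]; rewrite mem_filter => /andP[Kd _] -> /mapP[l].
case/monomials_spec => sl tl ->; apply/allP => _ /mapP[m /sq_terms_spec[sm tm] ->].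
by apply: map_f; apply: monomialsP; rewrite ?sm // tm tl subnK.
Qed.

Lemma find_key_set cs c : ~~ is_free (key_set cs) c -> c \in cs.
Proof.
rewrite /key_set; suff H M : ~~ is_free (foldl (fun m c => PositiveMap.add c [::] m) M cs) c ->
    ~~ is_free M c \/ c \in cs.
  by case/H => //; rewrite /is_free PositiveMap.gempty.
elim: cs M => [|x cs IH] M /=; first by left.
move=> /IH[]; last by right; rewrite inE orbC (_ : c \in cs).
rewrite inE; have [->|/eqP cx] := eqVneq c x; first by right.
by rewrite /is_free PositiveMap.gso // => ?; left.
Qed.

Lemma mem_select (T : eqType) (x0 x : T) gaps s : x \in select x0 gaps s -> x = x0 \/ x \in s.
Proof.
elim: gaps s => [//|g gaps IH] s; rewrite [select _ _ _]/= inE => /orP[/eqP->|/IH[->|]].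
- case E: (drop g s) => [|y r]; [by left|right].
  by apply: (@mem_drop g); rewrite E mem_head.
- by left.
by move=> /mem_behead/mem_drop xs; right.
Qed.

Section NormalForms.
Variables (V : lmodType 'F_2) (v : positive -> V) (M : pmap).
Hypothesis kM : kills v M.

Lemma ev_merge_all ls : ev v (merge_all ls) = \sum_(l <- ls) ev v l.
Proof.
elim: ls => [|l ls IH]; first by rewrite big_nil /ev big_nil.
by rewrite big_cons -IH -ev_merge2.
Qed.

Lemma ev1 c : ev v [:: c] = v c.
Proof. exact: big_seq1. Qed.

Lemma ev_get_nf cs x : ev v (get_nf (nf_map M cs) x) = v x.
Proof.
suff H N : (forall x, ev v (get_nf N x) = v x) ->
    forall x, ev v (get_nf (foldl (nf_step M) N cs) x) = v x.
  by apply: H => y; rewrite /get_nf PositiveMap.gempty ev1.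
elim: cs N => [//|c cs IH] N HN; apply: IH => y; rewrite /get_nf /nf_step.
have [->|/eqP yc] := eqVneq y c; last by rewrite PositiveMap.gso //; apply: HN.
rewrite PositiveMap.gss /=; case E: (PositiveMap.find c M) => [t|]; last exact: ev1.
by rewrite ev_merge_all big_map (eq_bigr v) // (kM E).
Qed.

End NormalForms.

Lemma merge_all_all (Q : pred positive) ls : (forall l, l \in ls -> all Q l) -> all Q (merge_all ls).
Proof.
elim: ls => [//|l ls IH] H; apply: merge2_all; first by apply: H; rewrite mem_head.
by apply: IH => m mls; apply: H; rewrite inE mls orbT.
Qed.

Lemma get_nf_all (Q : pred positive) M cs x : within Q M -> Q x -> all Q cs ->
  all Q (get_nf (nf_map M cs) x).
Proof.
move=> QM Qx Qcs; suff H N : (forall x, Q x -> all Q (get_nf N x)) ->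
    forall x, Q x -> all Q (get_nf (foldl (nf_step M) N cs) x).
  by apply: H => // y Qy; rewrite /get_nf PositiveMap.gempty /= Qy.
elim: cs Qcs N => [//|c cs IH] /= /andP[Qc Qcs] N HN; apply: IH => // y Qy; rewrite /get_nf /nf_step.
have [->|/eqP yc] := eqVneq y c; last by rewrite PositiveMap.gso //; apply: HN.
rewrite PositiveMap.gss /=; case E: (PositiveMap.find c M) => [t|]; last by rewrite /= Qc.
by apply: merge_all_all => _ /mapP[z zt ->]; apply: HN; apply: (allP (QM _ _ E)).
Qed.

Lemma total_map2 (J h : exponents) : size J = size h ->
  total [seq N.add x.1 (N.mul 2 x.2) | x <- zip J h] = (total J + (total h).*2)%N.
Proof.
elim: J h => [|a J IH] [|b h] // [/IH E]; rewrite [zip _ _]/= map_cons !total_cons E; cbn [fst snd]; lia.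
Qed.

Definition block_exps (J h : exponents) : exponents :=
  [seq N.add x.1 (N.mul 2 x.2) | x <- zip J h].

Lemma size_block_exps J h : size J = size h -> size (block_exps J h) = size h.
Proof. by move=> E; rewrite size_map size_zip E minnn. Qed.

Lemma horner_cons a l : horner (a :: l) = N.add (N.mul (N.pow 64 (N.of_nat (size l))) a) (horner l).
Proof. by rewrite /horner /= foldl_encode. Qed.

Lemma horner_block J h : size J = size h ->
  horner (block_exps J h) = N.add (horner J) (N.mul 2 (horner h)).
Proof.
elim: J h => [|a J IH] [|b h] // [E].
have -> : block_exps (a :: J) (b :: h) = N.add a (N.mul 2 b) :: block_exps J h by [].
by rewrite !horner_cons IH // size_block_exps // E; lia.
Qed.

Lemma block_code_encode J h : size J = size h -> (0 < total h)%N ->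
  block_code J (encode h) = encode (block_exps J h).
Proof.
move=> E h0; have eh := encodeE h0; rewrite /block_code -/(horner J).
have -> : N.add (Npos (encode h)~0) (horner J) = horner (block_exps J h).
  by rewrite horner_block // -eh; lia.
by [].
Qed.

Section Blocks.
Variable n : nat.
Local Notation P := {mpoly 'F_2[n]}.
Local Notation mono := (@mono n).
Implicit Types (S : {set 'I_n}).

Definition support (J : exponents) : {set 'I_n} := [set i : 'I_n | nth N0 J i != N0].

Definition indicator S : exponents := [seq if i \in S then 1%num else N0 | i <- enum 'I_n].

Lemma supportK S : support (indicator S) = S.
Proof.
apply/setP=> i; rewrite inE (nth_map i) ?size_enum_ord // nth_ord_enum.
by case: (i \in S).
Qed.

Lemma indicator_mem S : indicator S \in indicators n #|S|.
Proof.
rewrite mem_filter; apply/andP; split.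
  by apply/allP => _ /mapP[i _ ->]; case: (i \in S).
apply: monomialsP; first by rewrite size_map size_enum_ord.
rewrite /total -map_comp sumnE big_map big_enum -sum1_card [RHS]big_mkcond.
by apply: eq_bigr => i _ /=; case: (i \in S).
Qed.

Lemma indicatorsP J k : J \in indicators n k -> [/\ size J = n, total J = k & J = indicator (support J)].
Proof.
rewrite mem_filter => /andP[/allP J1 /monomials_spec[sJ tJ]]; split=> //.
apply: (@eq_from_nth _ N0); first by rewrite size_map size_enum_ord.
rewrite sJ => i ilt; rewrite (nth_map (Ordinal ilt)) ?size_enum_ord // inE nth_enum_ord //.
have := J1 _ (mem_nth N0 (_ : i < size J)%N); rewrite sJ => /(_ ilt) /N.leb_le.
by case: (nth N0 J i) => [|[p|p|]] //=; lia.
Qed.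

Lemma card_support J k : J \in indicators n k -> #|support J| = k.
Proof.
case/indicatorsP => sJ tJ JE; have := indicator_mem (support J); rewrite -JE.
by case/indicatorsP => _ <- _; rewrite tJ.
Qed.

Lemma mono_block J h k : J \in indicators n k -> size h = n ->
  mono (block_exps J h) = xs (support J) * mono h ^+ 2.
Proof.
move=> /indicatorsP[sJ _ JE] sh; have sz : size J = size h by rewrite sJ.
rewrite !mono_mnm ?size_block_exps // blockmE; congr 'X_[_]; apply/mnmP=> i.
rewrite !mnmE (nth_map (N0, N0)) ?size_zip ?sz ?minnn ?sh // nth_zip // inE.
rewrite {1}JE (nth_map i) ?size_enum_ord // nth_ord_enum inE; cbn [fst snd].
by case: (nth N0 J i != N0); cbn [nat_of_bool]; lia.
Qed.

Definition block_map S (g : P) : cohit n := cohit_pi (xs S * g ^+ 2).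

Lemma block_map_is_linear S : linear (block_map S).
Proof.
move=> c f g; rewrite /block_map.
have -> : (c *: f + g) ^+ 2 = c *: f ^+ 2 + g ^+ 2.
  by rewrite sqrDxx sqrZ.
by rewrite mulrDr -scalerAr cohit_piD cohit_piZ.
Qed.

HB.instance Definition _ S := GRing.isLinear.Build 'F_2 P (cohit n) *:%R
  (block_map S) (block_map_is_linear S).

Lemma Sq1_block_sum S w : \sum_(i in S) cohit_pi (xs (S :\ i) * ('X_i * w) ^+ 2) = 0 :> cohit n.
Proof.
rewrite -[RHS](@pi_Sq n 1 (xs S * w ^+ 2) isT) Sq_block.
rewrite (eq_bigl (mem [set [set i] | i in S])) => [|R].
  rewrite big_imset; last by move=> i j _ _ /set1_inj.
  rewrite (big_morph _ (@cohit_piD n) (proj2 (@pi_eq0 n 0) (@hit0 n))).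
  apply: eq_bigr => i iS; rewrite cards1 subnn Sq0 xs1.
  by [].
apply/and3P/imsetP => [[RS R1 oR]|[i iS ->]]; last by rewrite sub1set cards1 iS.
have /eqP/cards1P[i E] : #|R| = 1%N by move: R1 oR; case: #|R| => [|[|m]].
by exists i; rewrite // -sub1set -E.
Qed.

End Blocks.

Lemma mem_key_set cs c : c \in cs -> ~~ is_free (key_set cs) c.
Proof.
rewrite /key_set; suff H M : ~~ is_free M c \/ c \in cs ->
    ~~ is_free (foldl (fun m c => PositiveMap.add c [::] m) M cs) c by move=> cc; apply: H; right.
elim: cs M => [|x cs IH] M /=; first by case.
move=> H; apply: IH; have [->|/eqP cx] := eqVneq c x.
  by left; rewrite /is_free PositiveMap.gss.
case: H => [H|]; first by left; move: H; rewrite /is_free PositiveMap.gso.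
by rewrite inE => /orP[/eqP//|]; right.
Qed.

Section Exponents.
Variable n : nat.
Local Notation P := {mpoly 'F_2[n]}.
Local Notation mono := (@mono n).

Lemma zero_atE (K : exponents) (i : 'I_n) : K \in indicators n 4 -> nth N0 K i != N0 ->
  zero_at i K \in indicators n 3 /\ support n (zero_at i K) = support n K :\ i.
Proof.
move=> K4 Ki; have [sK tK KE] := indicatorsP K4.
have E : support n (zero_at i K) = support n K :\ i.
  apply/setP=> j; rewrite !inE nth_set_nth /= -val_eqE /=.
  by case: (nat_of_ord j == nat_of_ord i).
have sz : size (zero_at i K) = n by rewrite size_set_nth sK; apply/maxn_idPr.
have iK : i \in support n K by rewrite inE.
split=> //; have : zero_at i K = indicator (support n K :\ i).
  apply: (@eq_from_nth _ N0); first by rewrite sz size_map size_enum_ord.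
  rewrite sz => j jn; rewrite (nth_map i) ?size_enum_ord // nth_set_nth /= !inE.
  rewrite -val_eqE /= nth_enum_ord // {1}KE; case: (eqVneq j i) => [//|_].
  by rewrite (nth_map i) ?size_enum_ord // inE nth_enum_ord.
move=> ->; have <- : #|support n K :\ i| = 3%N; last exact: indicator_mem.
by have := cardsD1 i (support n K); rewrite (card_support K4) iK => -[].
Qed.

Lemma incr_atE (w : exponents) (i : 'I_n) : size w = n ->
  [/\ size (incr_at i w) = n, total (incr_at i w) = (total w).+1
    & mono (incr_at i w) = 'X_i * mono w].
Proof.
move=> sw; have sz : size (incr_at i w) = n by rewrite size_set_nth sw; apply/maxn_idPr.
have E : mnm n (incr_at i w) = (U_(i) + mnm n w)%MM.
  apply/mnmP=> j; rewrite mnmDE !mnmE nth_set_nth /= eq_sym -val_eqE /=.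
  case: eqP => [->|_]; cbn [nat_of_bool]; lia.
split=> //; first by rewrite -(mdeg_mnm sz) E mdegD mdeg1 mdeg_mnm.
by rewrite !mono_mnm // E mpolyXD.
Qed.

End Exponents.

Section WeightThree.
Variables (n d fuel : nat) (gaps : seq nat) (M MK : pmap).
Hypothesis d64 : (d.+1.*2 + 3 < 64)%N.
Hypothesis EM : eliminate (fun=> true) false true fuel (PositiveMap.empty _) (sq_rows n d.+1) = Some M.
Hypothesis EK : block_table n d gaps M = Some MK.
Local Notation P := {mpoly 'F_2[n]}.
Local Notation mono := (@mono n).
Local Notation block_map := (@block_map n).

Hypothesis block_Sq : forall (S : {set 'I_n}) k l, #|S| = 3%N ->
  (0 < k)%N -> size l = n -> (total l + k = d.+1)%N -> block_map S (Sq k (mono l)) = 0.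

Let d1 : (0 < d.+1 < 64)%N. Proof. by move: d64; lia. Qed.

Definition block_value c : cohit n :=
  if c \in [seq block_code J x | J <- indicators n 3, x <- columns n d.+1]
  then cohit_pi (mono (decode n c)) else 0.

Lemma block_value_code J h : J \in indicators n 3 -> size h = n -> total h = d.+1 ->
  block_value (block_code J (encode h)) = block_map (support n J) (mono h).
Proof.
move=> J3 sh th; have [sJ tJ _] := indicatorsP J3.
rewrite /block_value allpairs_f ?map_f //; last exact: monomialsP.
have sz : size J = size h by rewrite sJ.
rewrite block_code_encode ?th // encodeK ?size_block_exps //.
  by rewrite /block_map -(mono_block J3).
by rewrite total_map2 // tJ th; move: d64; lia.
Qed.

Lemma ev_block J r : J \in indicators n 3 -> all (mem (columns n d.+1)) r ->
  ev block_value (map (block_code J) r) = ev (@column_value n d.+1 _ (block_map (support n J) : {linear P -> cohit n})) r.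
Proof.
move=> J3 /allP rc; rewrite /ev big_map big_seq [RHS]big_seq; apply: eq_bigr => c /rc /mapP[l].
by case/monomials_spec => sl tl ->; rewrite block_value_code // column_value_encode.
Qed.

Let M_within : within (mem (columns n d.+1)) M.
Proof. exact: eliminate_within (@within_empty _) (@sq_rows_within _ _) EM. Qed.

Let nf := get_nf (nf_map M (columns n d.+1)).

Lemma sq1_row_kill K w : K \in indicators n 4 -> size w = n -> total w = d ->
  ev block_value (sq1_row nf K w) = 0.
Proof.
move=> K4 sw tw; have [sK tK _] := indicatorsP K4.
have iE : iota 0 n = index_iota 0 n by rewrite /index_iota subn0.
rewrite ev_merge_all big_map big_filter sK iE big_mkord.
rewrite -[RHS](Sq1_block_sum (support n K) (mono w)).
apply: eq_big => [i|i Ki]; first by rewrite inE.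
have [K3 <-] := zero_atE K4 Ki; have [si ti <-] := incr_atE i sw.
have ic : encode (incr_at i w) \in columns n d.+1 by apply: map_f; apply: monomialsP; rewrite // ti tw.
rewrite ev_block //; last by apply: get_nf_all M_within _ _ => //; apply/allP.
rewrite ev_get_nf; first by rewrite column_value_encode // ti tw.
by apply: (column_value_kills d1 EM) => k l k0 sl tl; apply: block_Sq => //; apply: card_support K3.
Qed.

Let keys := key_set (block_columns n d M).
Let col c := ~~ is_free keys c.

Let MK_spec : triangular col MK /\ kills block_value MK.
Proof.
have rows0 r : r \in sq1_rows nf n d -> ev block_value r = 0.
  case/allpairsP => -[w K] [/= /monomials_spec[sw tw] K4 ->]; exact: sq1_row_kill.
move: EK; rewrite /block_table -/nf -/keys -/col.
case E: eliminate => [M0|] // E'; split.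
  exact: eliminate_triangular (eliminate_triangular (@triangular_empty _) E) E'.
apply: eliminate_kills E'; first exact: eliminate_kills (@kills_empty _ _) rows0 E.
by move=> r /mem_select[->|/rows0//]; rewrite /ev big_nil.
Qed.

(** Two successive reductions: h modulo the hits of its own degree, then the blocks with reduced h
    modulo the relations from Sq^1. *)
Lemma block_span (p : cohit n -> Prop) :
  p 0 -> (forall a b, p a -> p b -> p (a + b)) ->
  (forall c, c \in free_blocks n d M MK -> p (cohit_pi (mono (decode n c)))) ->
  forall (S : {set 'I_n}) f, #|S| = 3%N -> f \is d.+1.-homog -> p (block_map S f).
Proof.
move=> p0 pD pF S f S3; apply: (table_span d1 EM) => //.
  by move=> k l k0 sl tl; apply: block_Sq.
have J3 := indicator_mem S; rewrite S3 in J3.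
move=> c cF; have [cM /mapP[l /monomials_spec[sl tl] cE]] : is_free M c /\ c \in columns n d.+1.
  by move: cF; rewrite mem_filter => /andP[].
have cB : block_code (indicator S) c \in block_columns n d M by apply: allpairs_f.
have E : block_map S (mono (decode n c)) = block_value (block_code (indicator S) c).
  by rewrite cE encodeK ?tl // block_value_code // supportK.
apply: (eq_ind _ p _ _ (esym E)); have [tMK kMK] := MK_spec.
apply: (triangular_span tMK kMK) => // [x xk xM|]; last exact: mem_key_set.
rewrite /block_value; case: ifP => // _; apply: pF.
by rewrite mem_filter /is_free xM; apply: find_key_set xk.
Qed.

End WeightThree.

Section Span.
Variable V : lmodType 'F_2.
Implicit Types (s : seq V) (q : V).

Definition spans s q := exists a : 'I_(size s) -> 'F_2, q = \sum_i a i *: s`_i.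

Lemma spans0 s : spans s 0.
Proof. by exists (fun=> 0); rewrite big1 // => i _; rewrite scale0r. Qed.

Lemma spansD s p q : spans s p -> spans s q -> spans s (p + q).
Proof.
move=> [a ->] [b ->]; exists (fun i => a i + b i); rewrite -big_split.
by apply: eq_bigr => i _; rewrite scalerDl.
Qed.

Lemma spans_mem s q : q \in s -> spans s q.
Proof.
move=> qs; have lt : (index q s < size s)%N by rewrite index_mem.
exists (fun i => (i == Ordinal lt)%:R); rewrite (bigD1 (Ordinal lt)) //= eqxx scale1r.
rewrite nth_index // big1 ?addr0 // => i /negbTE->; exact: scale0r.
Qed.

End Span.

(** * Generators in degree 41 with five variables *)

Section Degree41.
Local Notation P := {mpoly 'F_2[5]}.
Local Notation pi := (@cohit_pi 5).
Local Notation mono := (@mono 5).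
Implicit Types (S R : {set 'I_5}).

Let piD f g : pi (f + g) = pi f + pi g. Proof. exact: cohit_piD. Qed.

Let pi_sum (J : Type) (r : seq J) (p : pred J) (F : J -> P) :
  pi (\sum_(i <- r | p i) F i) = \sum_(i <- r | p i) pi (F i).
Proof. exact: (big_morph _ (@cohit_piD 5) (proj2 (@pi_eq0 5 0) (@hit0 5))). Qed.

(** Here e + #|S| = 21, which is not a power of two. *)
Lemma block_weight1 S h e : #|S| = 1%N -> e = 20%N -> h \is e.-homog -> pi (xs S * h ^+ 2) = 0.
Proof. by move=> S1 -> hh; apply: (pi_block_gap hh); rewrite S1; exact: pow2le1_21. Qed.

(* Expanding Sq^(2k) of x_S v^2, all terms but one have fewer odd exponents. *)
Lemma block_Sq_sum S k v : (0 < k)%N ->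
  pi (xs S * (Sq k v) ^+ 2) =
  \sum_(R : {set 'I_5} | [&& R \subset S, #|R| <= k.*2 & ~~ odd #|R|]%N && (R != set0))
    pi (xs (S :\: R) * (xs R * Sq (k - #|R|./2) v) ^+ 2).
Proof.
move=> k0; apply: addxx_eq; rewrite -[RHS](@pi_Sq 5 k.*2 (xs S * v ^+ 2)) ?double_gt0 //.
rewrite Sq_block [X in _ = pi X](eq_bigl (fun R : {set 'I_5} => [&& R \subset S, #|R| <= k.*2 & ~~ odd #|R|]%N)); last first.
  move=> R; case: (R \subset S); rewrite ?andFb // !andTb.
  by have [Rk|//] := leqP #|R| k.*2; rewrite !andTb oddB // odd_double.
have E R : ~~ odd #|R| -> ((k.*2 - #|R|)./2 = k - #|R|./2)%N.
  by move=> oR; have := odd_double_half #|R|; rewrite (negbTE oR); lia.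
rewrite pi_sum [RHS](bigD1 set0) /=; last by rewrite sub0set cards0.
rewrite cards0 subn0 doubleK setD0 /xs big_set0 mul1r; congr (_ + _).
by apply: eq_bigr => R /andP[/and3P[_ _ oR] _]; rewrite E.
Qed.

Lemma block_Sq_homog S R k v e : R \subset S -> (#|R| <= k.*2)%N -> ~~ odd #|R| ->
  v \is (e - k).-homog -> (k <= e)%N ->
  xs R * Sq (k - #|R|./2) v \is (e + #|R|./2).-homog.
Proof.
move=> RS Rk oR ve ke; have := dhomogM (xs_homog R) (Sq_homog (k - #|R|./2) ve).
have := odd_double_half #|R|; rewrite (negbTE oR) => oE.
by have -> : (#|R| + (e - k + (k - #|R|./2)) = e + #|R|./2)%N by lia.
Qed.

Lemma cardD S R : R \subset S -> (#|S :\: R| + #|R| = #|S|)%N.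
Proof. by move=> RS; have := cardsID R S; rewrite (setIidPr RS) addnC. Qed.

(** A nonempty R of even size inside a set of three elements has two, which leaves a single odd
    exponent and hence a hit. So x_S h^2 depends only on the class of h. *)
Lemma block3_Sq S k l : #|S| = 3%N -> (0 < k)%N -> size l = 5%N -> (total l + k = 19)%N ->
  block_map S (Sq k (mono l)) = 0.
Proof.
move=> S3 k0 sl tl; rewrite [block_map _ _]block_Sq_sum // big1 // => R /andP[/and3P[RS Rk oR] R0].
have lh : mono l \is (19 - k).-homog.
  by rewrite mono_mnm // dhomogX /= mdeg_mnm // -tl addnK.
have k19 : (k <= 19)%N by rewrite -tl leq_addl.
have hh := block_Sq_homog RS Rk oR lh k19.
have cR := cardD RS; rewrite S3 in cR; have R1 : (0 < #|R|)%N by rewrite card_gt0.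
have R2 : #|R| = 2%N by case: #|R| R1 oR cR => [|[|[|[|m]]]] //; lia.
apply: (block_weight1 _ _ hh); last by rewrite R2.
have aux x y : (x + y = 3 -> y = 2 -> x = 1)%N by lia.
exact: aux cR R2.
Qed.

Variables (F18 FB : seq positive).
Hypothesis F18_homog : forall c, c \in F18 -> mono (decode 5 c) \is 18.-homog.
Hypothesis F18_span : forall p : cohit 5 -> Prop,
  p 0 -> (forall a b, p a -> p b -> p (a + b)) ->
  (forall c, c \in F18 -> p (pi (mono (decode 5 c)))) ->
  forall f, f \is 18.-homog -> p (pi f).
Hypothesis FB_span : forall p : cohit 5 -> Prop,
  p 0 -> (forall a b, p a -> p b -> p (a + b)) ->
  (forall c, c \in FB -> p (pi (mono (decode 5 c)))) ->
  forall S f, #|S| = 3%N -> f \is 19.-homog -> p (block_map S f).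

Definition top_family : seq (cohit 5) :=
  [seq block_map setT (mono (decode 5 c)) | c <- F18].

Definition block_family : seq (cohit 5) :=
  [seq cohit_pi (mono (decode 5 c)) | c <- FB].

Let s := top_family ++ block_family.

Lemma spans_block3 S h e : #|S| = 3%N -> e = 19%N -> h \is e.-homog -> spans s (pi (xs S * h ^+ 2)).
Proof.
move=> S3 ->; apply: FB_span S3; [exact: spans0 | exact: spansD |].
by move=> c cF; apply: spans_mem; rewrite mem_cat; apply/orP; right; apply/mapP; exists c.
Qed.

(** Now R has two or four elements: the first kind leaves three odd exponents, which the blocks
    span, the second leaves one, which is a hit. *)
Lemma spans_block5_hit g : g \is 18.-homog -> hit g -> spans s (pi (xs setT * g ^+ 2)).
Proof.
apply: (@hit_homog_ind _ (fun g => spans s (pi (xs setT * g ^+ 2))) 18).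
- by rewrite expr0n mulr0; have := spans0 s; rewrite -(proj2 (@pi_eq0 5 0) (@hit0 5)).
- by move=> f h Hf Hh; rewrite sqrDxx mulrDr piD; apply: spansD.
move=> k v /andP[k0 k18] vd; rewrite block_Sq_sum //.
apply: (big_ind (spans s)) => [||R /andP[/and3P[RS Rk oR] R0]]; [exact: spans0 | exact: spansD |].
have hh := block_Sq_homog RS Rk oR vd k18.
have cR := cardD RS; rewrite cardsT card_ord in cR; have R1 : (0 < #|R|)%N by rewrite card_gt0.
have [R2|R4] : #|R| = 2%N \/ #|R| = 4%N.
  by case: #|R| R1 oR cR => [|[|[|[|[|[|m]]]]]] //; [left | right | lia].
  apply: (spans_block3 _ _ hh); last by rewrite R2.
  have aux x y : (x + y = 5 -> y = 2 -> x = 3)%N by lia.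
  exact: aux cR R2.
rewrite (block_weight1 _ _ hh); [exact: spans0 | | by rewrite R4].
have aux x y : (x + y = 5 -> y = 4 -> x = 1)%N by lia.
exact: aux cR R4.
Qed.

Lemma spans_block5 h : h \is 18.-homog -> spans s (pi (xs setT * h ^+ 2)).
Proof.
(* The predicate carries a representative, because squaring into blocks with five odd exponents
   respects hits only up to blocks with fewer. *)
move=> h18; pose p (q : cohit 5) := exists2 g, g \is 18.-homog & q = pi g /\ spans s (pi (xs setT * g ^+ 2)).
have : p (pi h).
  apply: F18_span h18.
  - exists 0; first exact: dhomog0.
    split; first exact/esym/pi_eq0/hit0.
    by rewrite expr0n mulr0; have := spans0 s; rewrite -(proj2 (@pi_eq0 5 0) (@hit0 5)).
  - move=> _ _ [f f18 [-> sf]] [g g18 [-> sg]]; exists (f + g); first exact: rpredD.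
    by split; [rewrite piD | rewrite sqrDxx mulrDr piD; apply: spansD].
  move=> c cF; exists (mono (decode 5 c)); first exact: F18_homog.
  split=> //; apply: spans_mem; rewrite mem_cat; apply/orP; left.
  by apply/mapP; exists c.
case=> g g18 [E sg]; have hgh : hit (h + g) by apply/pi_eq0; rewrite piD E addxx.
have := spansD (spans_block5_hit (rpredD h18 g18) hgh) sg.
by rewrite sqrDxx mulrDr piD -addrA addxx addr0.
Qed.

Lemma spans41 f : f \is 41.-homog -> spans s (pi f).
Proof.
move: f; apply: (@homog_closed_ind _ (fun f => spans s (pi f)) 41).
- by have := spans0 s; rewrite -(proj2 (@pi_eq0 5 0) (@hit0 5)).
- by move=> f h; cbv beta => Hf Hh; rewrite piD; apply: spansD.
move=> w wd; rewrite monomial_block; have := mdeg_block w; rewrite wd.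
set S := oddset w; set h : P := 'X_[halfm w] => E.
have hh : h \is (mdeg (halfm w)).-homog by rewrite dhomogX.
have S5 : (#|S| <= 5)%N by have := max_card S; rewrite card_ord.
have oS : odd #|S| by have := congr1 odd E; rewrite oddD odd_double addbF.
have [S1|[S3|S55]] : #|S| = 1%N \/ #|S| = 3%N \/ #|S| = 5%N.
  by case: #|S| S5 oS {E} => [|[|[|[|[|[|m]]]]]] //; auto.
- rewrite (block_weight1 S1 _ hh); first exact: spans0.
  by move: E; rewrite S1; lia.
- by apply: (spans_block3 S3 _ hh); move: E; rewrite S3; lia.
have -> : S = setT by apply/eqP; rewrite eqEcard subsetT cardsT card_ord S55.
apply: spans_block5.
by have <- : mdeg (halfm w) = 18%N by move: E; rewrite S55; lia.
Qed.

End Degree41.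

(** * Coefficients of linear substitutions as Boolean polynomials *)

Definition odd_at (l : exponents) : seq nat := [seq i <- iota 0 (size l) | N.odd (nth N0 l i)].

Definition halves (l : exponents) : exponents := map N.div2 l.

(* A set of entries (i, j) of a 5 x 3 matrix is a mask with bits 3 i + j, and a
   list of masks is a Boolean polynomial in the entries.  This is the permanent
   of the minor with rows J and columns T. *)
Fixpoint perm_masks (J T : seq nat) : seq N :=
  if J is i :: J' then
    flatten [seq [seq N.setbit m (N.of_nat (3 * i + j)) | m <- perm_masks J' (rem j T)] | j <- T]
  else if T is [::] then [:: N0] else [::].

(* The coefficient of y^f in the image of x^l by a linear substitution. *)
Fixpoint level_masks (k : nat) (l f : exponents) : seq N :=
  if k is k'.+1 then
    let ms := level_masks k' (halves l) (halves f) in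
    flatten [seq [seq N.lor m m' | m' <- ms] | m <- perm_masks (odd_at l) (odd_at f)]
  else if all (N.eqb N0) f then [:: N0] else [::].

(** The coefficient is a product of permanents as long as both monomials have equally many odd
    exponents at each binary level, and 0 at the first level where the source has fewer. The case
    where it has more, in which the formula fails, is excluded. *)
Fixpoint level_ok (k : nat) (l f : exponents) : bool :=
  if k is k'.+1 then
    (size (odd_at l) < size (odd_at f))%N ||
    (size (odd_at l) == size (odd_at f)) && level_ok k' (halves l) (halves f)
  else all (N.eqb N0) l.

Definition mask_in (A : nat -> bool) (m : N) : bool :=
  all (fun k => N.testbit m (N.of_nat k) ==> A k) (iota 0 15).

Definition mask_sum (A : nat -> bool) (ms : seq N) : 'F_2 := \sum_(m <- ms) (mask_in A m)%:R.

Lemma mask_in0 A : mask_in A N0.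
Proof. by apply/allP => k _; rewrite N.bits_0. Qed.

Lemma mask_in_lor A m m' : mask_in A (N.lor m m') = mask_in A m && mask_in A m'.
Proof.
rewrite /mask_in -all_predI; apply: eq_all => k /=.
by rewrite N.lor_spec; case: N.testbit; case: N.testbit; case: (A k).
Qed.

Lemma mask_in_setbit A m k : (k < 15)%N -> mask_in A (N.setbit m (N.of_nat k)) = A k && mask_in A m.
Proof.
move=> k15; apply/allP/andP => [H|[Ak /allP H] j j15]; last first.
  rewrite N.setbit_eqb; case: N.eqb_spec => [/Nnat.Nat2N.inj <-|_]; first by rewrite Ak.
  exact: H j15.
split=> [|]; first by have := H k; rewrite mem_iota k15 N.setbit_eq => /(_ isT).
apply/allP => j j15; have := H j j15; rewrite N.setbit_eqb.
by case: (N.testbit m _); rewrite ?implyTb ?implyFb // orbT.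
Qed.

Lemma perm_masks_nil J T : (size J < size T)%N -> perm_masks J T = [::].
Proof.
elim: J T => [|i J IH] T; first by case: T.
move=> lt; rewrite [perm_masks _ _]/=.
have H j : j \in T -> [seq N.setbit m (N.of_nat (3 * i + j)) | m <- perm_masks J (rem j T)] = [::].
  by move=> jT; rewrite IH // size_rem // -ltnS (ltn_predK lt).
by rewrite ((eq_in_map _ (fun=> [::]) T).1 H); elim: {lt H} T.
Qed.

Section Substitution.
Variable A : nat -> bool.
Local Notation P3 := {mpoly 'F_2[3]}.
Local Notation P5 := {mpoly 'F_2[5]}.

Definition row_form (i : nat) : P3 := \sum_(j < 3 | A (3 * i + j)) 'X_j.

Definition row_forms : 5.-tuple P3 := [tuple row_form i | i < 5].

Lemma row_forms_linform i : linform (tnth row_forms i).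
Proof. by rewrite tnth_mktuple; apply: linform_sum => j _; apply: linformX. Qed.

Definition col_set (T : seq nat) : 'X_{1..3} := [multinom (val j \in T : nat) | j < 3].

Lemma mcoeff_mulX n (i : 'I_n) (u : {mpoly 'F_2[n]}) w :
  ('X_i * u)@_w = if (0 < w i)%N then u@_(w - U_(i)) else 0.
Proof.
rewrite mulrC; case: ifP => wi.
  have E : w = (U_(i) + (w - U_(i)))%MM by rewrite addmC submK // lep1mP -lt0n.
  by rewrite {1}E mcoeffMX.
rewrite mcoeffM big1 // => -[k1 k2] /= /eqP E; rewrite mcoeffX.
case: eqP => [k2E|_]; last by rewrite mulr0.
suff : (0 < w i)%N by rewrite wi.
have -> : w i = (bmnm k1 i + bmnm k2 i)%N by rewrite -mnmDE -E.
by rewrite -k2E mnm1E eqxx addn1.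
Qed.

(** The coefficient of a squarefree monomial in a product of linear forms is a permanent, expanded
    here along the first row. *)
Lemma perm_masksE J T : all (fun i => i < 5)%N J -> all (fun j => j < 3)%N T -> uniq T ->
  (\prod_(i <- J) row_form i)@_(col_set T) = mask_sum A (perm_masks J T).
Proof.
elim: J T => [|i J IH] T.
  move=> _ T3 _; rewrite big_nil mcoeff1; case: T T3 => [|j T] /=.
    move=> _; rewrite /mask_sum big_seq1 mask_in0.
    by have -> : col_set [::] == 0%MM by apply/eqP/mnmP=> j; rewrite !mnmE.
  move=> /andP[j3 _]; rewrite /mask_sum big_nil; case: eqP => // /mnmP/(_ (Ordinal j3)).
  by rewrite !mnmE mem_head.
move=> /= /andP[i5 J5] T3 uT; rewrite big_cons /row_form mulr_suml raddf_sum /=.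
rewrite /mask_sum big_flatten big_map.
have E (F : nat -> 'F_2) : \sum_(j <- T) F j = \sum_(j < 3 | val j \in T) F j.
  rewrite -(big_mkord (fun j => j \in T)) -big_filter; apply: perm_big.
  apply: uniq_perm; rewrite ?filter_uniq ?iota_uniq // => j; rewrite mem_filter mem_index_iota /=.
  by apply/idP/andP => [jT|[]//]; split=> //; apply: (allP T3).
rewrite E big_mkcond [RHS]big_mkcond; apply: eq_bigr => j _.
have R ms : \sum_(m <- [seq N.setbit m (N.of_nat (3 * i + val j)) | m <- ms]) (mask_in A m)%:R =
    (A (3 * i + val j))%:R * mask_sum A ms :> 'F_2.
  rewrite big_map /mask_sum mulr_sumr; apply: eq_bigr => m _; rewrite mask_in_setbit.
    by rewrite -natrM mulnb.
  by have := ltn_ord j; move: i5; rewrite /=; lia.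
rewrite R.
have T3' : all (fun j => j < 3)%N (rem (val j) T) by apply/allP => k /mem_rem; apply: (allP T3).
rewrite -IH ?rem_uniq //; case: (A _); last by rewrite mul0r if_same.
rewrite mul1r mcoeff_mulX mnmE; case: (boolP (val j \in T)) => // jT.
congr (_ @_ _); apply/mnmP => k; rewrite mnmBE !mnmE mem_rem_uniq // inE -val_eqE eq_sym /=.
by case: eqP => [->|_]; rewrite ?jT ?subnn ?subn0.
Qed.

(** If x + 2v = w for a monomial x of u, then x has every odd exponent of w and, by its degree,
    nothing else; so x and v are determined by w. *)
Lemma block_coeff n (u h : {mpoly 'F_2[n]}) (w : 'X_{1..n}) : u \is #|oddset w|.-homog ->
  (u * h ^+ 2)@_w = u@_[multinom (i \in oddset w : nat) | i < n] * h@_(halfm w).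
Proof.
move=> uw; rewrite {1}(mpolyE h) sqr_sum mulr_sumr raddf_sum /=.
transitivity (\sum_(v <- msupp h) h@_v * (u@_[multinom (i \in oddset w : nat) | i < n] * (v == halfm w)%:R)).
  apply: eq_bigr => v _; rewrite sqrZ -scalerAr mcoeffZ; congr (_ * _).
  move: u uw; apply: homog_closed_ind => [|f g|x xw].
  - by rewrite mul0r !mcoeff0 mul0r.
  - by cbv beta => Hf Hg; rewrite mulrDl !mcoeffD Hf Hg mulrDl.
  rewrite expr2 -mpolyXD -mpolyXD !mcoeffX -natrM mulnb; congr (nat_of_bool _)%:R.
  apply/eqP/andP => [E|[/eqP-> /eqP->]]; last first.
    by apply/mnmP=> i; rewrite !mnmDE !mnmE inE -[RHS]odd_double_half -addnn.
  have xo i : odd (x i) = odd (w i) by rewrite -E !mnmDE addnn oddD odd_double addbF.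
  have xE i : x i = (i \in oddset w).
    have le k : ((k \in oddset w) <= x k)%N by rewrite inE -xo; case: (x k) => // m; case: odd.
    have S : (\sum_k (k \in oddset w : nat) = \sum_k x k)%N.
      by rewrite -[RHS]mdegE xw -sum1_card [RHS]big_mkcond; apply: eq_bigr => k _; case: (k \in _).
    have /eqP := esym S; rewrite (bigD1 i) // [X in _ == X](bigD1 i) //= => /eqP S'.
    have L : (\sum_(k | k != i) (k \in oddset w : nat) <= \sum_(k | k != i) x k)%N by apply: leq_sum.
    have aux a b c e : (a + b = c + e -> b <= e -> c <= a)%N by lia.
    by apply/eqP; rewrite eqn_leq le (aux _ _ _ _ (esym S') L).
  split; apply/eqP/mnmP=> i; first by rewrite mnmE xE.
  by rewrite mnmE -E !mnmDE xE addnn halfD odd_double half_double; case: (i \in _).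
rewrite (eq_bigr (fun v => u@_[multinom (i \in oddset w : nat) | i < n] * (h@_v * (v == halfm w)%:R))).
  rewrite -mulr_sumr; congr (_ * _); rewrite [in RHS](mpolyE h) raddf_sum /=.
  by apply: eq_bigr => v _; rewrite mcoeffZ mcoeffX.
by move=> v _; rewrite mulrCA.
Qed.

Lemma block_coeff0 n (u h : {mpoly 'F_2[n]}) (w : 'X_{1..n}) e : u \is e.-homog ->
  (e < #|oddset w|)%N -> (u * h ^+ 2)@_w = 0.
Proof.
move=> ue lt; rewrite (mpolyE h) sqr_sum mulr_sumr raddf_sum big1 //= => v _.
rewrite sqrZ -scalerAr mcoeffZ; suff -> : (u * 'X_[v] ^+ 2)@_w = 0 by rewrite mulr0.
move: u ue; apply: homog_closed_ind => [|f g|x xe]; first by rewrite mul0r mcoeff0.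
  by cbv beta => Hf Hg; rewrite mulrDl mcoeffD Hf Hg addr0.
rewrite expr2 -mpolyXD -mpolyXD mcoeffX; case: eqP => // E.
suff : (#|oddset w| <= e)%N by rewrite leqNgt lt.
rewrite -xe mdegE -sum1_card big_mkcond; apply: leq_sum => i _.
by rewrite inE -E !mnmDE addnn oddD odd_double addbF; case: (x i) => // m; case: odd.
Qed.

Lemma nth_odd_at l i : (i \in odd_at l) = N.odd (nth N0 l i).
Proof.
rewrite mem_filter mem_iota /= add0n; have [//|le] := ltnP i (size l); first by rewrite andbT.
by rewrite andbF nth_default.
Qed.

Lemma odd_to_nat a : odd (N.to_nat a) = N.odd a.
Proof.
case: a => [|[p|p|]] //.
  have -> : N.to_nat (Npos p~1) = (Pos.to_nat p).*2.+1 by lia.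
  by rewrite oddS odd_double.
have -> : N.to_nat (Npos p~0) = (Pos.to_nat p).*2 by lia.
by rewrite odd_double.
Qed.

Lemma half_to_nat a : (N.to_nat a)./2 = N.to_nat (N.div2 a).
Proof.
case: a => [|[p|p|]] //.
  have -> : N.to_nat (Npos p~1) = (Pos.to_nat p).*2.+1 by lia.
  by rewrite -[_.+1./2]/(uphalf _) uphalf_double.
have -> : N.to_nat (Npos p~0) = (Pos.to_nat p).*2 by lia.
by rewrite doubleK.
Qed.

Lemma oddsetE n l (i : 'I_n) : (i \in oddset (mnm n l)) = (val i \in odd_at l).
Proof. by rewrite nth_odd_at inE mnmE odd_to_nat. Qed.

Lemma halfmE n l : size l = n -> halfm (mnm n l) = mnm n (halves l).
Proof. by move=> sl; apply/mnmP=> i; rewrite !mnmE (nth_map N0) ?sl // half_to_nat. Qed.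

Lemma odd_at_lt l n : size l = n -> all (fun i => i < n)%N (odd_at l).
Proof. by move=> sl; apply/allP => i; rewrite mem_filter mem_iota sl => /andP[_ /andP[]]. Qed.

Lemma sum_odd_at (R : Type) (idx : R) (op : Monoid.com_law idx) l n (F : nat -> R) : size l = n ->
  \big[op/idx]_(i <- odd_at l) F i = \big[op/idx]_(i < n | val i \in odd_at l) F i.
Proof.
move=> sl; rewrite big_filter -(big_mkord (fun i => i \in odd_at l)) /index_iota subn0 sl.
by apply: eq_bigl => i; rewrite nth_odd_at.
Qed.

Lemma row_prod_homog J : all (fun i => i < 5)%N J -> \prod_(i <- J) row_form i \is (size J).-homog.
Proof.
elim: J => [|i J IH] /=; first by rewrite big_nil dhomog1.
move=> /andP[i5 /IH H]; rewrite big_cons.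
have [+ _] := row_forms_linform (Ordinal i5); rewrite tnth_mktuple => ri.
by have := dhomogM ri H; rewrite add1n.
Qed.

Lemma level_masksE k l f : size l = 5%N -> size f = 3%N -> level_ok k l f ->
  (mono 5 l \mPo row_forms)@_(mnm 3 f) = mask_sum A (level_masks k l f).
Proof.
elim: k l f => [|k IH] l f sl sf.
  move=> /allP l0; rewrite mono_mnm // (_ : mnm 5 l = 0%MM); last first.
    apply/mnmP=> i; have il : (i < size l)%N by rewrite sl.
    by rewrite !mnmE; have := l0 _ (mem_nth N0 il) => /N.eqb_eq <-.
  rewrite mpolyX0 comp_mpoly1 mcoeff1 /mask_sum [level_masks _ _ _]/=.
  have -> : all (N.eqb N0) f = (mnm 3 f == 0%MM).
    apply/allP/eqP => [f0|/mnmP f0 x /(nthP N0)[i]].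
      apply/mnmP=> i; have il : (i < size f)%N by rewrite sf.
      by rewrite !mnmE; have := f0 _ (mem_nth N0 il) => /N.eqb_eq <-.
    rewrite sf => i3 <-; have := f0 (Ordinal i3); rewrite !mnmE /=.
    by case: (nth N0 f i) => [//|p]; lia.
  by case: (_ == _); rewrite ?big_seq1 ?mask_in0 ?big_nil.
move=> ok; have sl' : size (halves l) = 5%N by rewrite size_map.
have sf' : size (halves f) = 3%N by rewrite size_map.
have lE : mono 5 l = xs (oddset (mnm 5 l)) * mono 5 (halves l) ^+ 2.
  by rewrite mono_mnm // monomial_block halfmE // -mono_mnm.
have uE : xs (oddset (mnm 5 l)) \mPo row_forms = \prod_(i <- odd_at l) row_form i.
  have prodM (S : {set 'I_5}) : xs S \mPo row_forms = \prod_(i in S) ('X_i \mPo row_forms).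
    exact: rmorph_prod.
  rewrite (sum_odd_at _ _ sl) prodM.
  apply: eq_big => [i|i _]; first exact: oddsetE.
  by rewrite comp_mpolyXU -tnth_nth tnth_mktuple.
have fE : #|oddset (mnm 3 f)| = size (odd_at f).
  rewrite -sum1_size (sum_odd_at _ _ sf) -sum1_card; apply: eq_bigl => i; exact: oddsetE.
set h := mono 5 (halves l) in lE *; have hE : h ^+ 2 \mPo row_forms = (h \mPo row_forms) ^+ 2.
  by rewrite !expr2 (comp_mpolyM row_forms h h).
rewrite lE (comp_mpolyM row_forms (xs (oddset (mnm 5 l))) (h ^+ 2)) hE uE.
have uh := row_prod_homog (odd_at_lt sl).
case/orP: ok => [lt|/andP[/eqP sz ok]].
  by rewrite (block_coeff0 _ uh) ?fE // /mask_sum [level_masks _ _ _]/= perm_masks_nil // big_nil.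
rewrite block_coeff; last by rewrite fE -sz.
rewrite (halfmE sf) /h IH //.
have -> : [multinom (i \in oddset (mnm 3 f) : nat) | i < 3] = col_set (odd_at f).
  by apply/mnmP=> i; rewrite !mnmE oddsetE.
rewrite perm_masksE ?filter_uniq ?iota_uniq //; try exact: odd_at_lt.
rewrite /mask_sum [level_masks _ _ _]/= big_flatten big_map mulr_suml.
apply: eq_bigr => m _; rewrite big_map mulr_sumr; apply: eq_bigr => m' _.
by rewrite mask_in_lor -mulnb natrM.
Qed.

End Substitution.

Fixpoint merge_pairs (ls : seq (seq positive)) : seq (seq positive) :=
  if ls is r :: s :: ls' then merge2 r s :: merge_pairs ls' else ls.

(** A merge sort in which equal entries cancel. Fourteen rounds merge up to 2^14 entries into one
    list; the final merge keeps the sum right for longer inputs. *)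
Definition xor_sort (r : seq positive) : seq positive :=
  merge_all (iter 14 merge_pairs [seq [:: c] | c <- r]).

Lemma ev_xor_sort (V : lmodType 'F_2) (v : positive -> V) r : ev v (xor_sort r) = ev v r.
Proof.
have pairs ls : \sum_(l <- merge_pairs ls) ev v l = \sum_(l <- ls) ev v l.
  have [n] := ubnP (size ls); elim: n ls => // n IH [|a [|b ls]] // lt.
  rewrite [merge_pairs _]/= !big_cons IH ?ev_merge2 ?addrA //.
  by move: lt; rewrite /= !ltnS; apply: ltnW.
rewrite ev_merge_all; elim: 14%N => [|n IH]; last by rewrite iterS pairs.
by rewrite big_map /ev; apply: eq_bigr => c _; rewrite big_seq1.
Qed.

Lemma sum_count (D s : seq N) (u : N -> 'F_2) : uniq D -> {subset s <= D} ->
  \sum_(m <- s) u m = \sum_(m <- D) u m * (count_mem m s)%:R.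
Proof.
move=> uD; elim: s => [|x s IH] sD; first by rewrite big_nil big1 // => m _; rewrite mulr0.
rewrite big_cons IH => [|m ms]; last by apply: sD; rewrite inE ms orbT.
have xD : x \in D by apply: sD; rewrite mem_head.
transitivity (\sum_(m <- D) (u m * (x == m)%:R + u m * (count_mem m s)%:R)); last first.
  by apply: eq_bigr => m _; rewrite /= natrD mulrDr.
rewrite big_split; congr (_ + _); rewrite (bigD1_seq x) //= eqxx mulr1 big1 ?addr0 //.
by move=> m mx; rewrite eq_sym (negbTE mx) mulr0.
Qed.

Definition short_mask (m : N) := forall k, N.testbit m k -> (N.to_nat k < 15)%N.

(* Boolean functions determine their algebraic normal forms. *)
Lemma mask_sums n (b : 'I_n -> 'F_2) (ms : 'I_n -> seq N) :
  (forall i m, m \in ms i -> short_mask m) ->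
  (forall A, \sum_i b i * mask_sum A (ms i) = 0) ->
  forall u : N -> 'F_2, \sum_i b i * (\sum_(m <- ms i) u m) = 0.
Proof.
move=> short H; pose D := undup (flatten [seq ms i | i <- enum 'I_n]).
have uD : uniq D by exact: undup_uniq.
have sub i : {subset ms i <= D}.
  move=> m mi; rewrite mem_undup; apply/flattenP; exists (ms i) => //.
  by apply: map_f; rewrite mem_enum.
have shortD m : m \in D -> short_mask m.
  by rewrite mem_undup => /flattenP[_ /mapP[i _ ->]]; apply: short.
pose G m := \sum_i b i * (count_mem m (ms i))%:R.
have swap u : \sum_i b i * (\sum_(m <- ms i) u m) = \sum_(m <- D) u m * G m.
  rewrite (eq_bigr (fun i => \sum_(m <- D) u m * (b i * (count_mem m (ms i))%:R))); last first.
    by move=> i _; rewrite (sum_count _ uD (sub i)) mulr_sumr; apply: eq_bigr => m _; rewrite mulrCA.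
  by rewrite exchange_big; apply: eq_bigr => m _; rewrite mulr_sumr.
suff G0 m : m \in D -> G m = 0 by move=> u; rewrite swap big_seq big1 // => m /G0 ->; rewrite mulr0.
pose bits m : {set 'I_15} := [set k : 'I_15 | N.testbit m (N.of_nat k)].
(* Evaluate at the matrix whose nonzero entries are the bits of m: only monomials contained in m
   contribute, and those strictly contained have coefficient 0 by induction. *)
have [c] := ubnP #|bits m|; elim: c m => // c IH m lt mD.
have := swap (fun m' => (mask_in (fun k => N.testbit m (N.of_nat k)) m')%:R).
rewrite H (bigD1_seq m) //= [X in _ = _ + X]big_seq_cond [X in _ = _ + X]big1 ?addr0.
  suff -> : mask_in (fun k => N.testbit m (N.of_nat k)) m by rewrite mul1r.
  by apply/allP => k _; rewrite implybb.
move=> m' /andP[m'D m'm]; case: (boolP (mask_in _ _)) => [/allP inm|_]; last by rewrite mul0r.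
have lt' : (#|bits m| <= c)%N by rewrite -ltnS.
rewrite IH ?mulr0 //; apply: (leq_trans _ lt'); apply: proper_card.
have imp k : (k < 15)%N -> N.testbit m' (N.of_nat k) -> N.testbit m (N.of_nat k).
  by move=> k15; have := inm k; rewrite mem_iota => /(_ k15) /implyP.
rewrite properE; apply/andP; split.
  by apply/subsetP => k; rewrite !inE; apply: imp.
apply: contra m'm => /subsetP le; apply/eqP/N.bits_inj => k.
apply/idP/idP => Hk.
  by have := imp _ (shortD _ m'D k Hk); rewrite Nnat.N2Nat.id; apply.
have := le (Ordinal (shortD _ mD k Hk)); rewrite !inE /= Nnat.N2Nat.id; exact.
Qed.

Lemma perm_masks_short J T m : all (fun i => i < 5)%N J -> all (fun j => j < 3)%N T ->
  m \in perm_masks J T -> short_mask m.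
Proof.
elim: J T m => [|i J IH] T m /=.
  by case: T => // _ _; rewrite inE => /eqP-> k; rewrite N.bits_0.
move=> /andP[i5 J5] T3 /flattenP[_ /mapP[j jT ->] /mapP[m' m'm ->]] k.
rewrite N.setbit_eqb => /orP[/N.eqb_eq <-|].
  by rewrite Nnat.Nat2N.id; have := allP T3 _ jT; move: i5; lia.
by apply: IH m'm k => //; apply/allP => x /mem_rem; apply: (allP T3).
Qed.

Lemma level_masks_short k l f m : size l = 5%N -> size f = 3%N ->
  m \in level_masks k l f -> short_mask m.
Proof.
elim: k l f m => [|k IH] l f m sl sf /=.
  by case: ifP => // _; rewrite inE => /eqP-> i; rewrite N.bits_0.
case/flattenP => _ /mapP[m1 m1p ->] /mapP[m2 m2l ->] i; rewrite N.lor_spec => /orP[].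
  by apply: perm_masks_short m1p i; apply: odd_at_lt.
by apply: IH m2l i; rewrite size_map.
Qed.

Lemma sq_sources0 l : sq_sources 0 l = [:: l]. Proof. by case: l. Qed.

Lemma sq_sourcesS K a l : sq_sources (Npos K) (a :: l) =
  flatten [seq if N.leb k a && odd_bin (N.sub a k) k
               then [seq N.sub a k :: m | m <- sq_sources (N.sub (Npos K) k) l] else [::]
          | k <- upto (N.to_nat (Npos K))].
Proof. by []. Qed.

Lemma count_sources K l m : size l = size m ->
  count_mem m (sq_terms K l) = count_mem l (sq_sources K m).
Proof.
elim: l m K => [|a l IH] [|b m] // K.
move=> [sz]; case: K => [|K].
  by rewrite sq_terms0 sq_sources0 /= eq_sym.
rewrite sq_termsS sq_sourcesS !count_flatten -!map_comp; congr sumn; apply: eq_map => k /=.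
have cc (x y : N) (s : seq exponents) (r : exponents) :
    count_mem (y :: r) [seq x :: t | t <- s] = if x == y then count_mem r s else 0%N.
  rewrite count_map; case: eqP => [->|/eqP xy].
    by apply: eq_count => t /=; rewrite eqseq_cons eqxx.
  by rewrite (eq_count (a2 := pred0)) ?count_pred0 // => t /=; rewrite eqseq_cons (negbTE xy).
have [E|ne] := eqVneq (N.add a k) b.
  have -> : N.leb k b by apply/N.leb_le; lia.
  have -> : N.sub b k = a by lia.
  by case: (odd_bin a k) => //=; rewrite !cc E !eqxx IH.
have -> : count_mem (b :: m) (if odd_bin a k then [seq N.add a k :: t | t <- sq_terms (N.sub (Npos K) k) l] else [::]) = 0%N.
  by case: ifP => // _; rewrite cc (negbTE ne).
case: ifP => // /andP[/N.leb_le kb _]; rewrite cc; case: eqP => // E.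
by case/eqP: ne; lia.
Qed.

(** L is read as an element of the dual: the transposes of the squares of index a power of two must
    send it to 0 modulo 2. *)
Definition dual_ok (d : nat) (L : seq exponents) : bool :=
  all (fun k => nilp (xor_sort (flatten [seq map encode (sq_sources k l) | l <- L]))) sq_indices.

Section CoefficientSums.
Variables (n d : nat) (L : seq exponents).
Local Notation P := {mpoly 'F_2[n]}.

Definition coeff_sum (g : P) : ('F_2)^o := \sum_(l <- L) g@_(mnm n l).

Lemma coeff_sum_is_linear : linear coeff_sum.
Proof.
move=> c f g; rewrite /coeff_sum scaler_sumr -big_split; apply: eq_bigr => l _ /=.
by rewrite mcoeffD mcoeffZ.
Qed.

HB.instance Definition _ := GRing.isLinear.Build 'F_2 P ('F_2)^o *:%R coeff_sum coeff_sum_is_linear.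

Lemma coeff_sum_combination (J : Type) (r : seq J) (b : J -> 'F_2) (F : J -> P) :
  coeff_sum (\sum_(i <- r) b i *: F i) = \sum_(i <- r) b i * coeff_sum (F i).
Proof. by rewrite linear_sum; apply: eq_bigr => i _; rewrite linearZ. Qed.

Hypothesis LP : forall l, l \in L -> size l = n /\ total l = d.
Hypothesis d64 : (32 < d < 64)%N.
Hypothesis Lok : dual_ok d L.

Lemma sq_sources_spec K l m : l \in sq_sources K m -> size l = size m /\ (total l + N.to_nat K = total m)%N.
Proof.
elim: m K l => [|a m IH] K l.
  by case: K => [|K]; rewrite ?sq_sources0 ?inE // => /eqP->.
case: K => [|K]; first by rewrite sq_sources0 inE => /eqP->; rewrite addn0.
rewrite sq_sourcesS => /flattenP[x /mapP[k + ->]]; rewrite mem_upto => kK.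
case: ifP => // /andP[/N.leb_le ka _] /mapP[l' /IH[sl tl] ->]; split; first by rewrite /= sl.
by rewrite !total_cons -tl; lia.
Qed.

Lemma coeff_sum_hit f : hit f -> coeff_sum f = 0.
Proof.
apply: hit_linear; apply: (@Sq_pow2_ind n (fun f => coeff_sum f = 0)) => [|g h Hg Hh|j g].
- exact: linear0.
- by rewrite linearD /= Hg Hh addr0.
rewrite (mpolyE g) Sq_sum linear_sum big1 // => w _; rewrite SqZ linearZ.
suff E0 : coeff_sum (Sq (2 ^ j) 'X_[w]) = 0.
  by apply: etrans (scaler0 _ (g@_w)); congr (_ *: _); exact: E0.
rewrite -mono_exps -{1}(Nnat.Nat2N.id (2 ^ j)) Sq_mono ?size_exps //; set K := N.of_nat _.
have cE l : l \in L -> (\sum_(m <- sq_terms K (exps w)) mono n m)@_(mnm n l) =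
    (count_mem (exps w) (sq_sources K l))%:R.
  move=> /LP[sl _]; rewrite -count_sources ?size_exps // raddf_sum /= -sum1_count natr_sum.
  rewrite [RHS]big_mkcond big_seq [RHS]big_seq; apply: eq_bigr => m /sq_terms_spec[sm _].
  rewrite size_exps in sm; rewrite mono_mnm // mcoeffX.
  have -> : (mnm n m == mnm n l) = (m == l).
    by apply/eqP/eqP => [E|->//]; rewrite -(exps_mnm sm) -(exps_mnm sl) E.
  by rewrite /=; case: (m == l).
have [E|ne] := eqVneq (mdeg w + 2 ^ j)%N d; last first.
  rewrite /coeff_sum big_seq big1 // => l lL; rewrite cE //; have [sl tl] := LP lL.
  rewrite (_ : count_mem _ _ = 0%N) //; apply/count_memPn/negP => /sq_sources_spec[_].
  by rewrite total_exps Nnat.Nat2N.id tl => /eqP; rewrite (negbTE ne).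
have j6 : (j < 6)%N by rewrite -(@ltn_exp2l 2) //; move: d64; lia.
have w0 : (0 < mdeg w)%N.
  have : (2 ^ j <= 2 ^ 5)%N by rewrite leq_exp2l // -ltnS.
  by move: d64; lia.
have KI : K \in sq_indices.
  by rewrite map_f //; case: j j6 {E K cE w0} => [|[|[|[|[|[|j]]]]]].
pose v c : ('F_2)^o := (decode n c == exps w)%:R.
have := ev_xor_sort v (flatten [seq map encode (sq_sources K l) | l <- L]).
rewrite (nilP (allP Lok _ KI)) {1}/ev big_nil /ev big_flatten big_map => E0.
rewrite [RHS]E0 /coeff_sum big_seq [RHS]big_seq; apply: eq_bigr => l lL; rewrite cE //.
have [sl tl] := LP lL; rewrite big_map -sum1_count natr_sum [LHS]big_mkcond [LHS]big_seq [RHS]big_seq.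
apply: eq_bigr => m /sq_sources_spec[sm tm]; rewrite /v encodeK ?sm //; first by rewrite [pred1 _ _]/=; case: (m == exps w).
by move: tm; rewrite tl -E Nnat.Nat2N.id => /addIn ->; move: d64 w0; lia.
Qed.

End CoefficientSums.

(** * Independence of classes by functionals *)

Fixpoint pos_weight (p : positive) : N :=
  match p with xH => 1%num | xO p' => pos_weight p' | xI p' => N.succ (pos_weight p') end.

(** A Boolean monomial has 15 bits, preceded by its degree and by a tag for the functional, so that
    elimination treats the second functional first and higher degrees before lower ones. Injectivity
    is not at stake: a collision would only merge columns and weaken the test. *)
Definition mask_code (tag m : N) : positive :=
  let weight := if m is Npos p then pos_weight p else N0 in
  if N.add (N.shiftl (N.add (N.mul 16 tag) weight) 15) m is Npos p then p else xH.

Definition form_masks (F : seq exponents) (l : exponents) : seq N :=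
  flatten [seq level_masks 5 l f | f <- F].

(** The offset exceeds every mask code with tag at most 2, as these are below 48 * 2^15, so the
    columns of the individual functionals lead. *)
Definition index_code (i : nat) : positive := Pos.add 3000000 (Pos.of_succ_nat i).

Definition detection_row (FC FS : seq exponents) (keys : seq pmap) (c : positive) : seq positive :=
  let l := decode 5 c in
  xor_sort ([seq index_code i | i <- iota 0 (size keys)
              & ~~ is_free (nth (PositiveMap.empty _) keys i) c]
            ++ [seq mask_code 2 m | m <- form_masks FC l]
            ++ [seq mask_code 1 m | m <- form_masks FS l]).

Lemma size_decode n c : size (decode n c) = n.
Proof.
rewrite /decode; have H m l k : size (decode_rec m k l) = (m + size l)%N.
  by elim: m l k => [//|m IH] l k; rewrite decode_recS IH /= addnS.
by rewrite H addn0.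
Qed.

Section Detection.
Variables (FC FS : seq exponents) (XL : seq (seq positive)) (Bs : seq positive) (fuel : nat) (M : pmap).
Local Notation P5 := {mpoly 'F_2[5]}.
Local Notation mono := (@mono 5).

Definition forms_ok F := dual_ok 41 F && all (fun f => (size f == 3%N) && (total f == 41%N)) F.

Definition codes_ok X := [&& dual_ok 41 (map (decode 5) X), uniq X
  & all (fun c => (encode (decode 5 c) == c) && (total (decode 5 c) == 41%N)) X].

Hypothesis FCok : forms_ok FC.
Hypothesis FSok : forms_ok FS.
Hypothesis XLok : all codes_ok XL.
Hypothesis Bok : all (fun c => (encode (decode 5 c) == c) && all (level_ok 5 (decode 5 c)) (FC ++ FS)) Bs.
Hypothesis EB : eliminate (fun=> true) false false fuel (PositiveMap.empty _)
  (map (detection_row FC FS (map key_set XL)) Bs) = Some M.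

Variable b : nat -> 'F_2.
Local Notation B i := (nth xH Bs i).
Let g : P5 := \sum_(i < size Bs) b i *: mono (decode 5 (B i)).
Hypothesis hit_g : hit g.

Let form_sum0 F : forms_ok F -> {subset F <= FC ++ FS} -> forall u : N -> 'F_2,
  \sum_(i < size Bs) b i * (\sum_(m <- form_masks F (decode 5 (B i))) u m) = 0.
Proof.
case/andP => Fd /allP FP Fsub.
have FP' f : f \in F -> size f = 3%N /\ total f = 41%N.
  by move=> /FP/andP[/eqP-> /eqP->].
apply: mask_sums => [i m /flattenP[_ /mapP[f fF ->]]|A].
  by apply: level_masks_short; [exact: size_decode | case: (FP' f fF)].
have := @coeff_sum_hit 3 41 F FP' isT Fd _ (hit_comp (row_forms_linform A) hit_g).
rewrite /g comp_mpoly_sum.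
rewrite (eq_bigr (fun i : 'I_(size Bs) => b i *: (mono (decode 5 (B i)) \mPo row_forms A))); last first.
  by move=> i _; rewrite comp_mpolyZ.
rewrite coeff_sum_combination => E0; rewrite -[RHS]E0; apply: eq_bigr => i _; congr (_ * _).
rewrite /mask_sum /form_masks big_flatten big_map /coeff_sum big_seq [RHS]big_seq.
apply: eq_bigr => f fF; apply/esym.
apply: (@level_masksE A 5); [exact: size_decode | by case: (FP' f fF) |].
have := allP Bok (B i) (mem_nth _ (ltn_ord i)) => /andP[_ /allP]; apply; exact: Fsub.
Qed.

Let code_sum0 X : codes_ok X -> \sum_(i < size Bs) b i * (B i \in X)%:R = 0.
Proof.
case/and3P => Xd uX /allP XP.
have XP' l : l \in map (decode 5) X -> size l = 5%N /\ total l = 41%N.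
  by case/mapP => c /XP/andP[_ /eqP tc] ->; rewrite size_decode.
have := @coeff_sum_hit 5 41 _ XP' isT Xd _ hit_g.
rewrite /g coeff_sum_combination => E0; rewrite -[RHS]E0; apply: eq_bigr => i _.
congr (_ * _); rewrite /coeff_sum /= big_map.
have /andP[/eqP BE _] := allP Bok (B i) (mem_nth _ (ltn_ord i)).
rewrite (eq_big_seq (fun c => (c == B i)%:R)) => [|c cX]; last first.
  have /andP[/eqP cE _] := XP c cX; rewrite mono_mnm ?size_decode // mcoeffX; congr (nat_of_bool _)%:R.
  apply/eqP/eqP => [E|->//]; rewrite -cE -BE -(exps_mnm (size_decode 5 c)).
  by rewrite -(exps_mnm (size_decode 5 (B i))) E.
have [BX|BX] := boolP (B i \in X).
  by rewrite (bigD1_seq (B i)) //= eqxx big1 ?addr0 // => c /negbTE->.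
by rewrite big_seq big1 // => c cX; case: eqP => // E; rewrite -E cX in BX.
Qed.

(** A combination that is a hit is killed after every substitution. By [mask_sums] its Boolean
    polynomials then cancel formally, so any values v given to the columns satisfy the relation with
    coefficients b, and independent rows force b = 0. *)
Lemma detection_free i : (i < size Bs)%N -> b i = 0.
Proof.
move=> iB; have := eliminate_free (b := b) (@triangular_empty _) EB; rewrite size_map; apply=> // v _.
have subC : {subset FC <= FC ++ FS} by move=> f fF; rewrite mem_cat fF.
have subS : {subset FS <= FC ++ FS} by move=> f fF; rewrite mem_cat fF orbT.
pose C (k : 'I_(size Bs)) := b k * (\sum_(m <- form_masks FC (decode 5 (B k))) v (mask_code 2 m)).
pose D (k : 'I_(size Bs)) := b k * (\sum_(m <- form_masks FS (decode 5 (B k))) v (mask_code 1 m)).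
have SC : \sum_(k < size Bs) C k = 0 := form_sum0 FCok subC (fun m => v (mask_code 2 m)).
have SD : \sum_(k < size Bs) D k = 0 := form_sum0 FSok subS (fun m => v (mask_code 1 m)).
pose X (k : 'I_(size Bs)) := \sum_(j <- iota 0 (size XL)) v (index_code j) * (b k * (B k \in nth [::] XL j)%:R).
have SX : \sum_(k < size Bs) X k = 0.
  rewrite /X exchange_big big_seq big1 // => j; rewrite mem_iota => /andP[_ jX].
  by rewrite -mulr_sumr code_sum0 ?mulr0 //; apply: (allP XLok); apply: mem_nth.
have S0 : \sum_(k < size Bs) (X k + (C k + D k)) = 0.
  transitivity (\sum_(k < size Bs) X k + (\sum_(k < size Bs) C k + \sum_(k < size Bs) D k)).
    by rewrite -!big_split.
  by rewrite SX SC SD !addr0.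
rewrite -[RHS]S0; apply: eq_bigr => k _.
rewrite (nth_map xH) ?ltn_ord // ev_xor_sort /ev !big_cat !big_map !mulrDr.
congr (_ + _); rewrite /X big_filter size_map big_mkcond mulr_sumr big_seq [RHS]big_seq.
apply: eq_bigr => j; rewrite mem_iota => /andP[_ jX]; rewrite (nth_map [::]) //.
have -> : ~~ is_free (key_set (nth [::] XL j)) (B k) = (B k \in nth [::] XL j).
  by apply/idP/idP => [/find_key_set|/mem_key_set].
by case: (_ \in _); rewrite ?mulr0 // !mulr1 mulrC.
Qed.

End Detection.

(** * Data for the computations in degree 41 *)

(* Reducing all the rows of [sq1_rows] is too costly: those with a new leading
   column, together with the rows selected by these gaps, span the others. *)
Definition gaps : seq nat :=
  [:: 7596;4;14;4;34;4;15;0;0;7;0;0;7;0;0;7;0;0;17;0;0;7;0;0;16;4;16;0;19;1;20;0;0;7;0;0;18;0;17;0;0;6;14;19;19;10;0;0;7;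
  0;0;7;0;0;7;0;8;0;0;18;0;9;1;6;8;0;0;1;161;9;0;32;0;0;26;4;14;4;34;4;9;9;9;9;29;9;99;44;24;19;24;289;99;4;14;4;6;0;
  19;6;4;91;0;4;1;12;4;1;10;9;19;19;15;0;9;2;5;0;9;2;29;23;6;9;8;0;80;42;523;479;14;19;19;109;149;69;71;0;9;2;5;0;9;2;
  9;24;25;9;112;5;3;891;142;9;59;33;9;9;9;29;9;9;14;4;14;24;14;79;4;14;4;34;4;74;4;19;19;64;4;219;4;9;9;9;4;9;14;4;14;
  24;14;9;9;9;9;19;9;19;4;19;19;14;4;4;4;4;14;19;4;4;14;19;19;4;4;4;19;4;14;4;4;9;4;4;14;4;4;4;9;4;4;9;4;144;4;4;9;4;
  4;4;279;84;84;104;24;24;4;4;4;4;4;29;4;4;4;9;4;4;4;9;19;4;34;19;14;9;9;9;9;9;4;44;4;9;4;14;4;9;144;14;4;4;69;14;39;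
  9;39;274;14;4;19;19;9;9;4;14;4;14;4;4;9;19;19;9;19;84;4;29;9;124;9;4;14;4;54;9;14;4;59;4;64;4;9;4;44;9;4;4;4;9;4;69;
  39;4;9;4;29;19;734;14;4;9;4;39;4;4;797;0;19;22;9;19;19;9;4;4;4;5;0;4;13;0;4;7;9;9;9;19;9;4;5;0;9;8;0;9;27;4;4;9;15;
  19;80;37;4;4;18;4;4;4;4;4;29;4;4;4;9;9;4;24;9;34;19;9;9;19;4;14;29;19;4;4;9;19;14;49;109;4;4;91;0;4;13;0;4;34;43;0;
  8;0;2;5;0;8;0;2;19;19;54;9;9;30;462;76;0;9;8;0;9;371;225;9;9;75;92;1738;449;124;1544;29;1200;29;189;110;4;34;1249;4;
  4;477;4;4;4;34;4;4;4;4;4;19;9;4;4;4;49;4;14;14;114;54;179;164;4;19;19;14;4;4;4;9;34;29;9;39;14;4;29;19;339;4;239;9;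
  692;0;9;8;0;9;63;19;109;37;4;19;19;4;4;4;4;4;4;4;4;4;59;49;4;4;4;4;49;95;9;9;395;72;9;110;5033;4;4]%N.

Definition block_gaps : seq nat :=
  [:: 0;0;0;0;0;45;0;2;0;0;0;0;0;140;0;1;1;0;0;2;1;0;1;0;0;2;0;0;0;0;34;101;14;78;0;13;0;28;0;0;0;0;45;2;0;0;2;41;0;0;1;5;
  0;0;0;0;35;9;4;34;2;0;5;0;2;5;2;0;25;0;0;0;1;2;1;0;0;2;1;7;0;0;0;0;20;24;4;26;14;34;4;2;6;4;2;4;4;59;0;0;0;0;45;0;1;
  0;0;0;1;42;0;0;0;4;1;0;0;36;0;0;1;0;3;1;3;0;0;0;0;30;0;1;0;10;0;2;0;0;1;0;26;0;0;0;12;5;2;0;0;0;20;0;0;0;2;1;2;0;2;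
  0;0;2;2;2;3;0;0;0;0;22;0;2;6;3;0;0;1;7;1;20;14;12;0;18;14;16;12;0;0;47;0;0;1;0;0;0;0;0;40;0;2;0;0;0;0;0;0;0;0;0;0;
  40;4;4;34;4;1;1;0;1;1;5;1;1;26;4;3;0;2;5;0;0;0;0;0;0;2;33;1;4;1;0;0;0;0;3;19;4;0;0;0;1;0;0;0;1;2;13;0;1;0;0;0;0;15;
  4;19;4;4;19;4;14;4;4;4;4;0;0;48;0;1;0;0;0;0;0;44;1;0;0;0;1;0;0;37;3;0;0;0;0;1;3;0;0;0;0;30;0;3;0;0;1;6;0;1;0;0;0;1;
  27;8;5;3;1;2;0;0;0;25;9;0;2;0;0;0;0;0;1;3;0;2;21;0;0;0;6;1;3;3;9;0;0;0;11;3;0;0;0;2;1;1;0;0;0;1;1;4;1;6;3;0;0;0;0;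
  16;4;9;1;7;4;4;3;0;0;52;0;0;0;42;0;1;1;0;0;0;0;0;0;0;0;35;1;1;0;1;0;0;0;0;0;0;0;0;0;0;0;0;30;0;8;4;0;3;0;0;0;0;25;1;
  7;0;0;1;1;0;1;2;0;0;0;0;0;1;20;0;1;6;4;0;0;1;2;0;0;0;0;0;0;0;0;0;0;1;23;2;0;0;0;2;0;3;0;2;9;0;0;0;15;9;1;0;0;2;0;6;
  6;0;0;0;1;0;0;7;2;0;0;0;1;0;0;0;1;0;0;0;1;0;2;0;0;3;0;5;4;2;0;0;0;0;0;0;0;47;0;0;2;0;0;0;41;0;0;2;0;0;0;1;0;0;0;37;
  0;2;1;0;1;0;3;34;0;0;0;1;0;0;0;2;8;0;0;0;0;25;0;1;1;1;0;1;0;0;0;2;1;0;0;0;0;0;0;0;0;0;0;0;35;4;4;4;19;2;1;0;0;2;0;0;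
  3;0;1;0;0;0;0;0;0;0;0;0;0;0;3;0;0;0;0;0;25;4;4;9;4;24;9;4;4;4;4;4;0;0;47;0;0;2;0;0;0;41;1;3;4;0;0;0;35;0;0;2;0;0;0;
  2;3;0;0;0;32;0;0;2;0;0;6;4;0;0;0;0;28;7;9;0;0;0;1;0;1;21;4;0;0;1;1;0;1;0;0;0;1;0;0;0;0;1;3;0;0;0;0;22;3;9;0;0;0;6;2;
  1;0;0;0;11;1;2;3;1;0;1;0;0;2;0;0;0;0;1;2;0;0;0;0;0;1;3;0;0;0;0;10;5;0;0;0;11;4;4;4;4;3;0;0;52;0;0;0;0;40;0;0;4;0;1;
  0;0;0;37;0;4;0;1;0;0;0;1;0;0;0;51;0;0;1;26;0;0;1;5;0;0;1;5;0;0;0;0;0;0;0;0;20;1;0;1;0;4;0;0;1;1;0;1;1;0;0;0;0;0;0;0;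
  0;0;0;0;0;20;1;0;0;1;12;1;0;0;0;2;1;1;0;0;0;16;0;0;0;5;4;9;1;0;0;2;0;0;0;1;0;0;7;0;1;0;1;3;4;2;0;0;1;0;0;0;0;0;0;0;
  0;0;0;2;4;2;0;0;0;0;2;47;0;3;0;0;0;41;0;0;0;1;0;1;1;0;0;0;36;0;0;0;1;0;1;3;0;1;0;0;0;31;0;18;0;0;0;0;25;1;0;0;11;3;
  0;2;0;0;0;0;0;21;0;0;0;5;9;0;2;2;1;0;0;0;0;0;15;0;4;0;0;2;0;0;7;0;0;0;1;0;0;0;5;0;0;0;0;11;3;1;0;3;0;1;1;0;1;1;0;0;
  2;0;0;0;1;0;0;0;0;0;0;0;0;0;0;0;0;7;2;0;1;1;0;1;1;0;1;1;0;1;0;0;0;1;0;0;0;1;0;0;0;0;0;0;0;0;0;0;0;0;0;0;0;0;4;3;0;2;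
  0;2;0;186;3;0;2;0;2;0;6;7;0;2;0;0;170;6;16;2;7;11;0;155;2;0;18;0;18;0;6;3;3;3;0;126;3;0;2;0;2;0;6;3;0;2;0;2;0;46;11;
  0;111;34;47;4;6;8;103;26;19;27;0;18;0;10;3;3;3;96;30;32;15;10;19;3;88;94;15;0;14;4;2;3;67;19;3;3;31;19;3;15;4;14;3;
  3;3;7;7;0;2;0;10;0;2;0;0;1;0;0;193;15;7;1;169;3;0;0;1;0;0;15;1;0;10;3;0;0;1;0;0;157;1;13;3;1;17;1;9;7;1;137;71;5;
  113;3;1;1;0;0;25;3;0;2;1;1;1;33;0;4;9;7;0;0;173;1;1;15;1;13;99;25;13;8;10;5;23;9;19;4;55;18;35;3;19;35;3;19;19;3;1;
  1;1;79;73;11;4;18;19;0;2;3;12;2;0;0;1;0;0;210;7;0;175;2;15;3;0;10;7;0;149;0;2;0;0;1;0;0;17;0;18;0;0;10;2;0;0;1;0;0;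
  150;59;128;30;43;0;2;11;98;0;3;0;1;0;0;45;3;0;3;0;2;0;13;0;18;0;0;14;6;0;0;65;3;20;14;4;24;14;14;4;28;10;3;0;2;0;70;
  19;24;14;4;14;28;10;19;2;76;28;30;3;35;14;3;20;3;3;14;215;0;2;0;0;1;0;1;192;0;0;1;0;0;0;12;1;1;0;0;0;144;3;5;4;16;2;
  16;2;8;3;6;156;52;2;1;161;52;2;0;98;6;4;8;14;5;17;19;19;15;3;0;0;4;88;3;1;1;0;1;4;7;0;2;0;0;0;29;9;9;9;32;3;0;0;0;
  134;1;15;19;15;5;17;140;2;15;35;23;0;19;214;0;3;0;1;0;1;169;9;14;2;11;3;5;173;0;1;0;0;0;9;7;1;13;0;1;0;0;0;133;79;
  119;18;20;15;23;15;3;0;4;157;35;14;4;105;54;2;15;19;19;75;2;0;0;1;0;1;24;7;0;2;0;0;0;8;30;8;10;9;4;18;2;0;0;0;73;59;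
  18;4;11;3;39;20;219;203;5;4;3;0;1;1;0;176;1;5;9;3;0;4;9;2;0;0;134;19;17;20;15;3;0;119;79;19;99;79;39;99;24;34;23;15;
  19;79;44;14;43;35;69;4;2;0;0;1;1;0;4;3;3;0;0;1;0;0;0;19;4;19;24;34;9;1;0;0;0;16;199;19;1;217;0;158;2;16;1;17;19;0;0;
  0;184;12;10;0;2;0;2;0;0;0;168;9;13;0;0;1;0;0;0;12;0;0;1;1;0;84;3;9;0;52;3;15;6;12;6;8;7;2;88;43;6;8;7;0;0;0;4;11;0;
  0;0;36;2;64;3;3;5;0;28;7;51;19;9;13;3;67;3;3;4;1;16;91;23;3;0;19;199;19;179;19;19;0;0;197;19;178;31;0;2;0;3;0;0;109;
  9;33;3;35;4;10;7;1;129;42;0;0;2;0;0;9;3;5;12;0;0;2;0;0;89;3;4;10;7;41;53;3;71;23;35;7;0;0;24;11;0;0;0;9;3;4;18;1;77;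
  6;4;3;2;2;37;31;7;35;3;20;199;18;0;179;18;0;19;159;19;39;159;53;0;4;137;57;9;4;2;1;2;0;0;117;54;1;9;9;3;0;4;8;0;3;0;
  98;10;4;43;20;34;3;79;29;5;23;40;32;1;3;55;14;54;4;7;0;0;4;3;7;1;0;9;4;19;9;13;0;219;19;179;19;19;159;19;19;8;10;
  139;79;119;33;3;41;19;99;52;3;22;19;8;10;76;21;105;3;4;0;2;0;0;57;10;9;49;55;9;3;0;4;4;4;3;0;38;25;8;3;6;39;12;6;19;
  3;4;3;1;4;3;0;2;3;2;4;3;0;9]%N.

(* The monomials x_I (x_J)^2 (x_K)^4 x_a^8 x_b^16, where I, J and K have 3, 3 and
   2 elements, with a = b or a != b. *)
Definition block_candidates (diagonal : bool) : seq positive :=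
  let ends := [seq x <- [seq (a, b) | a <- indicators 5 1, b <- indicators 5 1]
              | (x.1 == x.2) == diagonal] in
  flatten [seq [seq encode (block_exps x.1 (block_exps x.2 y))
               | x <- [seq (J1, J2) | J1 <- indicators 5 3, J2 <- indicators 5 3],
                 y <- [seq block_exps J3 (block_exps z.1 z.2) | z <- ends]]
          | J3 <- indicators 5 2].

Definition block_monomials : seq positive :=
  select xH block_gaps (block_candidates true ++ block_candidates false).

(* Found by linear algebra over the annihilator of the hits, where it is a short
   vector outside of the span of the other functionals. *)
Definition exotic_codes : seq positive :=
  [:: 487354433;470577281;470577218;453800066;437809217;437547137;437022851;437022788;421032002;420769922;420245636;
  420245573;387477635;387477572;387215492;387215429;371748929;371486786;370962563;370962500;370454657;370454594;
  369942593;369938561;369930371;369930308;354971777;354709634;354185411;354185348;354185285;353939585;353939522;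
  353169473;353165378;353161346;353153156;353153093;336392321;336392258;322203713;321941633;321941570;321679490;
  321417347;321417284;321155204;321155141;320630981;320397377;320393345;320385155;320385092;320135234;320131202;
  320123012;320122949;319615106;303624257;303362177;302837891;302837828;286847042;286584962;286060676;286060613;
  255111233;255094979;254849153;254849090;254587010;254570693;254337089;254333057;254324867;254324804;254074946;
  254070914;254062724;254062661;253550723;253550660;253546628;253546565;253292675;253292612;253030532;253030469;
  239628353;239366210;238841987;238841924;238596161;238579907;238334018;238317827;238317701;238317638;237809795;
  237809732;237793541;237793478;237793415;237793352;237563969;237301826;236777603;236777540;236773571;236769539;
  236769413;236769350;236761349;236761286;236761223;236761160;236269697;236269634;235757633;235753601;235745411;
  235745348;222851201;222589058;222064835;222064772;222064709;221819009;221802755;221802629;221802566;221556866;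
  221540549;221032643;221032580;221032517;221016326;221016200;221016137;220786817;220524674;220000451;220000388;
  220000325;219996419;219996293;219996230;219992261;219984134;219984008;219983945;219754625;219754562;218984513;
  218980418;218976386;218968196;218968133;202207361;202207298;190083137;189821057;189820994;189558914;189296771;
  189296708;189034628;189034565;188510405;188276801;188272769;188248325;188248262;188248199;188248136;188018753;
  188014658;188010626;188002499;187986182;187986056;187985993;187756673;187756610;187494530;187490435;187490372;
  187486403;187486340;187486277;187478213;187232387;187232324;186970244;186970181;186446021;186441989;186441926;
  186441863;186441800;186437894;186437768;186437705;186212417;186208385;186200195;186200132;185950274;185946242;
  185938052;185937989;185430146;169439297;169177217;168652931;168652868;152662082;152400002;151875716;151875653;
  122990657;122974403;122728577;122728514;122466434;122450117;122216513;122212481;122204291;122204228;121954370;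
  121950338;121942148;121942085;121430147;121430084;121426052;121425989;121168067;121164035;121163909;121163846;
  121155845;121155782;121155719;121155656;120926273;120905987;120905861;120905798;120901829;120893702;120893576;
  120893513;120664193;120664130;120402050;120381701;120381638;120381575;120381512;120377606;120377480;120377417;
  120152129;120148097;120139907;120139844;119889986;119885954;119877764;119877701;119365763;119365700;119361731;
  119361668;119361605;119353541;119107715;119107652;118845572;118845509;102346817;102084737;101568641;101568578;
  101560451;101560388;85569602;85307522;84795521;84795458;84783236;84783173;52027457;52023362;51765377;51761282;
  51241091;51241028;51236996;51236933]%positive.

(** The ten shuffles of 0 < 1 < 2 with 3 < 4, one for each choice of the two positions taken by the
    last two variables. *)
Definition exotic_perms : seq (seq nat) :=
  [:: [:: 0; 1; 2; 3; 4]; [:: 0; 1; 3; 2; 4]; [:: 0; 1; 3; 4; 2]; [:: 0; 3; 1; 2; 4]; [:: 0; 3; 1; 4; 2];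
      [:: 0; 3; 4; 1; 2]; [:: 3; 0; 1; 2; 4]; [:: 3; 0; 1; 4; 2]; [:: 3; 0; 4; 1; 2]; [:: 3; 4; 0; 1; 2]]%N.

Definition exotic_lists : seq (seq positive) :=
  [seq [seq encode [seq nth N0 (decode 5 c) i | i <- p] | c <- exotic_codes] | p <- exotic_perms].

(* A monomial with exponents 2^k - 1 is a spike: it occurs in no square. *)
Definition spike_form : seq exponents := [:: [:: 31; 7; 3]%num].

(** The four coefficients cancel along a chain: Sq^4 of (7,7,23) involves the first two monomials,
    Sq^8 of (11,7,15) the second and third, and Sq^4 of (15,7,15) the last two. *)
Definition mixed_form : seq exponents :=
  [:: [:: 7; 7; 27]%num; [:: 11; 7; 23]%num; [:: 19; 7; 15]%num; [:: 15; 11; 15]%num].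

(** An independent family as long as a spanning one is a basis: the square matrix that expresses t
    through s has zero kernel, and its inverse expresses s through t. *)
Lemma has_dimension_exchange (V : lmodType 'F_2) (U : V -> Prop) (s t : seq V) :
  size t = size s -> (forall v, U v -> spans s v) -> (forall i : 'I_(size t), U t`_i) ->
  (forall b : nat -> 'F_2, \sum_(i < size t) b i *: t`_i = 0 -> forall i, (i < size t)%N -> b i = 0) ->
  has_dimension 'F_2 U (size t).
Proof.
move=> ts sU tU tfree; have free (c : 'I_(size t) -> 'F_2) : \sum_i c i *: t`_i = 0 -> forall i, c i = 0.
  move=> c0 i; pose b k := if insub k is Some j then c j else 0.
  have bE (j : 'I_(size t)) : b j = c j by rewrite /b valK.
  by rewrite -bE; apply: tfree => //; rewrite -[RHS]c0; apply: eq_bigr => j _; rewrite bE.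
have /boolp.choice[m mE] (i : 'I_(size t)) : exists a : 'I_(size t) -> 'F_2, t`_i = \sum_j a j *: s`_j.
  by have [] := sU _ (tU i); rewrite -ts => a; exists a.
pose M := \matrix_(i, j) m i j.
have ME (x : 'rV_(size t)) : \sum_i x 0 i *: t`_i = \sum_j (x *m M) 0 j *: s`_j.
  rewrite (eq_bigr (fun i => \sum_j (x 0 i * M i j) *: s`_j)) => [|i _]; last first.
    by rewrite mE scaler_sumr; apply: eq_bigr => j _; rewrite mxE scalerA.
  by rewrite exchange_big; apply: eq_bigr => j _; rewrite -scaler_suml mxE.
have Mu : M \in unitmx.
  rewrite -row_free_unit -kermx_eq0; apply/eqP/row_matrixP => i; rewrite row0.
  apply/rowP => j; rewrite [RHS]mxE; apply: free.
  by rewrite ME -row_mul mulmx_ker row0 big1 // => k _; rewrite mxE scale0r.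
have dim := @has_dimension_fin V U 'I_(size t) (fun i => t`_i) tU.
rewrite card_ord in dim; apply: dim => [v /sU[]|c c0 i]; last exact: free.
rewrite -ts => a ->; pose x := (\row_j a j) *m invmx M; exists (fun i => x 0 i).
by rewrite ME mulmxKV //; apply: eq_bigr => j _; rewrite mxE.
Qed.

Lemma some_check (T : Type) (o : option T) (p : pred T) :
  oapp p false o = true -> exists2 x, o = Some x & p x = true.
Proof. by case: o => // x px; exists x. Qed.

(** * A basis in degree 41 with five variables *)

Section Degree41Basis.
Local Notation P := {mpoly 'F_2[5]}.
Local Notation pi := (@cohit_pi 5).
Local Notation mono := (@mono 5).
Variables (F18 FB Bs : seq positive).

Hypothesis F18_uniq : uniq F18.
Hypothesis F18_homog : forall c, c \in F18 -> mono (decode 5 c) \is 18.-homog.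
Hypothesis F18_span : forall p : cohit 5 -> Prop,
  p 0 -> (forall a b, p a -> p b -> p (a + b)) ->
  (forall c, c \in F18 -> p (pi (mono (decode 5 c)))) ->
  forall f, f \is 18.-homog -> p (pi f).
Hypothesis F18_dual : forall c0, c0 \in F18 ->
  exists2 L : {linear P -> ('F_2)^o}, forall k g, (0 < k)%N -> L (Sq k g) = 0
    & forall c, c \in F18 -> L (mono (decode 5 c)) = (c == c0)%:R.
Hypothesis FB_span : forall p : cohit 5 -> Prop,
  p 0 -> (forall a b, p a -> p b -> p (a + b)) ->
  (forall c, c \in FB -> p (pi (mono (decode 5 c)))) ->
  forall (S : {set 'I_5}) f, #|S| = 3%N -> f \is 19.-homog -> p (block_map S f).
Hypothesis Bs_size : size Bs = size FB.
Hypothesis Bs_block : all (fun c => (total (decode 5 c) == 41%N) && (odd_at (decode 5 c) != iota 0 5)) Bs.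
Hypothesis Bs_free : forall b : nat -> 'F_2,
  hit (\sum_(i < size Bs) b i *: mono (decode 5 (nth xH Bs i))) -> forall i, (i < size Bs)%N -> b i = 0.

Let polys : seq P := [seq xs setT * mono (decode 5 c) ^+ 2 | c <- F18] ++ [seq mono (decode 5 c) | c <- Bs].

Let kameko_Bs c : c \in Bs -> kameko (mono (decode 5 c)) = 0.
Proof.
move=> cB; have /andP[_ /eqP oc] := allP Bs_block c cB.
rewrite mono_mnm ?size_decode // monomial_block kameko_block; case: eqP => // E; case: oc.
rewrite /odd_at size_decode; apply/all_filterP/allP => i; rewrite mem_iota => /andP[_ i5].
have := in_setT (Ordinal i5); rewrite -E oddsetE nth_odd_at; exact.
Qed.

(** The dual Kameko map sends x_1 ... x_5 m^2 to m and kills the monomials of [Bs], none of which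
    has five odd exponents. The functionals dual to the free columns of degree 18 thus remove the
    first family, and [Bs_free] applies to the rest. *)
Let free_polys (b : nat -> 'F_2) : hit (\sum_(i < size polys) b i *: polys`_i) ->
  forall i, (i < size polys)%N -> b i = 0.
Proof.
rewrite size_cat !size_map big_split_ord /=.
rewrite (eq_bigr (fun i : 'I_(size F18) => b i *: (xs setT * mono (decode 5 (nth xH F18 i)) ^+ 2))); last first.
  by move=> i _; rewrite nth_cat size_map ltn_ord (nth_map xH).
rewrite [X in _ + X](eq_bigr (fun i : 'I_(size Bs) => b (size F18 + i)%N *: mono (decode 5 (nth xH Bs i)))); last first.
  by move=> i _; rewrite nth_cat size_map ltnNge leq_addr /= addKn (nth_map xH).
move=> hs; have b0 i : (i < size F18)%N -> b i = 0.
  move=> iF; have [L LS LF] := F18_dual (mem_nth xH iF).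
  have := hit_linear LS (hit_kameko hs).
  rewrite kamekoD !kameko_sum [X in _ + X]big1 ?addr0 => [|j _]; last first.
    by rewrite kamekoZ kameko_Bs ?scaler0 // mem_nth.
  rewrite linear_sum (bigD1 (Ordinal iF)) //= big1 ?addr0 => [|j ji].
    rewrite kamekoZ kameko_block eqxx linearZ /= LF ?mem_nth // eqxx.
    by move=> E; rewrite -[RHS]E; apply/esym/mulr1.
  rewrite kamekoZ kameko_block eqxx linearZ /= LF ?mem_nth // nth_uniq //.
  by rewrite -val_eqE /= in ji; rewrite (negbTE ji); apply: scaler0.
move: hs; rewrite big1 ?add0r => [/(Bs_free (b := fun i => b (size F18 + i)%N)) bB i|i _]; last first.
  by rewrite b0 ?scale0r.
have [/b0 //|le] := ltnP i (size F18); rewrite -{1}(subnKC le) ltn_add2l => /bB.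
by rewrite subnKC.
Qed.

Lemma dimension41 : has_dimension 'F_2 (@cohit_deg 5 41) (size F18 + size Bs).
Proof.
pose s := top_family F18 ++ block_family FB; pose t := map pi polys.
have st : size t = size s by rewrite !(size_map, size_cat) Bs_size.
have pt : size t = size polys by rewrite size_map.
have -> : (size F18 + size Bs)%N = size t by rewrite !(size_map, size_cat).
apply: (has_dimension_exchange st) => [v [f f41 ->]|i|b].
- exact: spans41.
- have ip : (i < size polys)%N by rewrite -pt.
  exists polys`_i; last by rewrite (nth_map 0).
  have := mem_nth 0 ip; rewrite mem_cat => /orP[/mapP[c cF ->]|/mapP[c cB ->]].
    have xh := xs_homog [set: 'I_5]; rewrite cardsT card_ord in xh.
    by have := dhomogM xh (dhomogM (F18_homog cF) (F18_homog cF)).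
  have /andP[/eqP tc _] := allP Bs_block c cB.
  by rewrite mono_mnm ?size_decode // dhomogX /= mdeg_mnm ?size_decode // tc.
have E : \sum_(i < size t) b i *: t`_i = pi (\sum_(i < size polys) b i *: polys`_i).
  rewrite -(big_mkord xpredT (fun i => b i *: t`_i)) pt big_mkord (linear_sum pi).
  by apply: eq_bigr => i _; rewrite (nth_map 0) //; apply/esym/cohit_piZ.
by rewrite E pt => /pi_eq0; apply: free_polys.
Qed.

End Degree41Basis.

Lemma free_columns_homog n d M c : (0 < d < 64)%N -> c \in free_columns n d M ->
  mono n (decode n c) \is d.-homog.
Proof.
move=> d64; rewrite mem_filter => /andP[_ /mapP[l /monomials_spec[sl tl] ->]].
by rewrite encodeK ?tl // mono_mnm // dhomogX /= mdeg_mnm // tl.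
Qed.

(** * The computations by evaluation, and the conclusion *)

Lemma table18_check :
  oapp (fun M => size (free_columns 5 18 M) == 730%N) false
    (eliminate xpredT false true 1000 (PositiveMap.empty _) (sq_rows 5 18)) = true.
Proof. vm_cast_no_check (erefl true). Qed.

Lemma table19_check :
  oapp (fun M => oapp (fun MK => size (free_blocks 5 18 M MK) == 1900%N) false
    (block_table 5 18 gaps M)) false
    (eliminate xpredT false true 1000 (PositiveMap.empty _) (sq_rows 5 19)) = true.
Proof. vm_cast_no_check (erefl true). Qed.

Lemma exotic_check : all codes_ok exotic_lists = true.
Proof. vm_cast_no_check (erefl true). Qed.

Lemma mixed_check : forms_ok mixed_form = true.
Proof. vm_cast_no_check (erefl true). Qed.

Lemma spike_check : forms_ok spike_form = true.
Proof. vm_cast_no_check (erefl true). Qed.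

Lemma level_check :
  all (fun c => (encode (decode 5 c) == c) && all (level_ok 5 (decode 5 c)) (mixed_form ++ spike_form))
    block_monomials = true.
Proof. vm_cast_no_check (erefl true). Qed.

Lemma block_check :
  all (fun c => (total (decode 5 c) == 41%N) && (odd_at (decode 5 c) != iota 0 5)) block_monomials = true.
Proof. vm_cast_no_check (erefl true). Qed.

Lemma size_block_monomials : (size block_monomials == 1900%N) = true.
Proof. vm_cast_no_check (erefl true). Qed.

Lemma detection_check : oapp xpredT false
    (eliminate xpredT false false 1000 (PositiveMap.empty _)
      (map (detection_row mixed_form spike_form (map key_set exotic_lists)) block_monomials)) = true.
Proof. vm_cast_no_check (erefl true). Qed.

Lemma dimension_cohit41 : has_dimension 'F_2 (@cohit_deg 5 41) 2630.
Proof.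
have [M18 E18 c18] := some_check table18_check; have s18 := eqP c18.
have [M19 E19 b19] := some_check table19_check.
have [MK EK cK] := some_check b19; have sK := eqP cK.
have [MB EB _] := some_check detection_check.
have sB := eqP size_block_monomials.
have d18 : (0 < 18 < 64)%N by [].
have d19 : (18.+1.*2 + 3 < 64)%N by [].
have span18 (p : cohit 5 -> Prop) : p 0 -> (forall a b, p a -> p b -> p (a + b)) ->
    (forall c, c \in free_columns 5 18 M18 -> p (cohit_pi (mono 5 (decode 5 c)))) ->
    forall f, f \is 18.-homog -> p (cohit_pi f).
  move=> p0 pD pF; apply: (@table_span 5 18 d18 1000 M18 E18 _ (@cohit_pi 5) p _ p0 pD pF).
  by move=> k l k0 _ _; apply: pi_Sq.
have dual18 := @table_dual 5 18 d18 1000 M18 E18.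
have span19 := fun p p0 pD pF => @block_span 5 18 1000 gaps M19 MK d19 E19 EK block3_Sq p p0 pD pF.
have freeB b := @detection_free mixed_form spike_form exotic_lists block_monomials 1000 MB
  mixed_check spike_check exotic_check level_check EB b.
have sE : size block_monomials = size (free_blocks 5 18 M19 MK) by rewrite sB sK.
have u18 : uniq (free_columns 5 18 M18) by apply: free_columns_uniq.
have h18 c : c \in free_columns 5 18 M18 -> mono 5 (decode 5 c) \is 18.-homog.
  exact: free_columns_homog.
have := @dimension41 (free_columns 5 18 M18) (free_blocks 5 18 M19 MK) block_monomials
  u18 h18 span18 dual18 span19 sE block_check freeB.
by rewrite s18 sB.
Qed.

Lemma degree_stage t : (5 * (2 ^ (t + 4) - 1) + 41 * 2 ^ (t + 4) = stage (t + 4))%N.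
Proof. by have := expn_gt0 2 (t + 4); rewrite /stage; move: (2 ^ _)%N => x; lia. Qed.

Lemma dimension_value : (63 * 2630 = 165690)%N.
Proof.
(* Unfolding the decimal numeral to its Horner form in ten lets [lia] compute with it without a
   unary expansion. *)
by cbv [Nat.of_num_uint Nat.of_uint Nat.of_uint_acc]; rewrite !PeanoNat.Nat.tail_mul_spec; lia.
Qed.

Local Close Scope ring_scope.

Theorem theorem2p6 (t : nat) (ht : 1 <= t) :
  has_dimension 'F_2
    (@cohit_deg 6 (5 * (2 ^ (t + 4) - 1) + 41 * 2 ^ (t + 4))) 165690.
Proof.
rewrite degree_stage -dimension_value; apply: dimension_stage dimension_cohit41.
by rewrite -(ltn_add2r 4) in ht.
Qed.
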